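(* Let $\varphi(z)$ be an entire function, let $k$ be a positive integer and let $a$ be a non-zero complex constant. Let $f$ be a meromorphic solution (on $\mathbb{C}$) of the equation $$f^{(k+1)}(z)\left(f^{(k)}(z)-f(z)\right)=\varphi(z)\,(f(z)-a)\,f^{(k)}(z)$$ such that either $f(z)$ has no zeros or all the zeros of $f(z)$ have multiplicity at least $k$, $f(z)=a\Rightarrow f^{(k)}(z)=a$ and $\lambda(f)<\rho(f)$. Then $f(z)=A\exp(\lambda z)$, where $A$ and $\lambda$ are non-zero constants such that $\lambda^k=1$.
   Context: $f^{(k)}$ denotes the $k$-th derivative of $f$. $\rho(f)$ denotes the order of $f$ (in the sense of Nevanlinna theory), and $\lambda(f)$ denotes the exponent of convergence of the zeros of $f$ (not to be confused with the constant $\lambda$ in the conclusion). For functions $f,g$ and a finite complex number $c$: $f(z)=c\Rightarrow g(z)=c$ means that every zero of $f(z)-c$ is a zero of $g(z)-c$ (multiplicities ignored). *)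

(* Defs.v *)
From HB Require Import structures.
From mathcomp Require Import all_boot all_order all_algebra.
From mathcomp Require Export complex.
From mathcomp Require Import all_classical all_reals all_analysis.

Set Implicit Arguments.
Unset Strict Implicit.
Unset Printing Implicit Defensive.

Import Order.TTheory GRing.Theory Num.Theory numFieldNormedType.Exports.
Import ComplexField.Normc.

Local Open Scope classical_set_scope.
Local Open Scope ring_scope.
Local Open Scope complex_scope.

(* The complex numbers as a normed module over themselves, so that [derivable]
   and [derive1n] at this type are complex differentiability and complex
   derivatives. *)
HB.instance Definition _ (R : realType) := NormedModule.copy R[i] (R[i]^o).

Section Complex_functions.
Variable R : realType.
Implicit Types (f g : R[i] -> R[i]) (z c : R[i]) (r : R).

Definition cis (t : R) : R[i] := cos t +i* sin t.

Definition cexp z : R[i] := (expR (complex.Re z))%:C * cis (complex.Im z).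

Definition entire f := forall z, derivable f z 1.

Definition holomorphic_at f z := \forall w \near z, derivable f w 1.

Definition is_pole f z :=
  (\forall w \near z^', derivable f w 1) /\
  normc (f w) @[w --> z^'] --> +oo.

(* A meromorphic function is represented by a total function whose values at
   the poles are irrelevant. At every other point the function is required to
   be holomorphic, so there are no removable singularities, and whatever
   depends on the values of [f] must be restricted to points where [f] is
   holomorphic. *)
Definition meromorphic f := forall z, holomorphic_at f z \/ is_pole f z.

Definition takes_value f c z := holomorphic_at f z /\ f z = c.

(* f = c => g = c *)
Definition value_implies f g c :=
  forall z, takes_value f c z -> takes_value g c z.

(* f(w) = (w - z)^n g(w) near z, with g holomorphic at z and g(z) <> 0 *)
Definition has_order f z (n : int) := exists g,
  [/\ holomorphic_at g z, g z != 0 &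
      \forall w \near z^', f w = (w - z) ^ n * g w].

(* Such an n is unique when it exists; the default 0 is used only if there is
   none, e.g. when f vanishes identically. *)
Definition mero_order f z : int := xget 0 [set n | has_order f z n].

Definition zero_mult f z : nat :=
  if 0 < mero_order f z then `|mero_order f z|%N else 0%N.

Definition pole_mult f z : nat :=
  if mero_order f z < 0 then `|mero_order f z|%N else 0%N.

Local Open Scope ereal_scope.

(* n(r, f): the poles in the closed disc of radius r, with multiplicity *)
Definition pole_count f r : \bar R :=
  \esum_(z in [set z | (normc z <= r)%R]) ((pole_mult f z)%:R)%:E.

(* N(r, f) *)
Definition integrated_count f r : \bar R :=
  \int[lebesgue_measure]_(t in `]0%R, r[)
    ((pole_count f t - pole_count f 0) * (t^-1)%:E)
  + pole_count f 0 * (ln r)%:E.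

(* m(r, f); the library's [ln] is 0 at 0, hence so is log^+ *)
Definition proximity f r : \bar R :=
  ((2 * pi)^-1)%:E *
  \int[lebesgue_measure]_(t in `[0%R, (2 * pi)%R])
    (Num.max 0 (ln (normc (f (r%:C * cis t)))))%:E.

(* T(r, f) *)
Definition characteristic f r : \bar R := proximity f r + integrated_count f r.

(* rho(f) = limsup_(r -> oo) log^+ T(r, f) / log r *)
Definition growth_order f : \bar R :=
  limf_esup (fun r => maxe 0 (lne (characteristic f r)) * ((ln r)^-1)%:E)
    (pinfty_nbhs R).

(* lambda(f): the infimum of the s > 0 such that the sum of |z|^(-s) over the
   non-zero zeros z of f, counted with multiplicity, is finite *)
Definition zeros_exponent f : \bar R :=
  ereal_inf [set s%:E | s in [set s : R | (0 < s)%R /\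
    \esum_(z in [set z | (z != 0)%R])
      ((zero_mult f z)%:R * normc z `^ (- s))%:E < +oo]].

End Complex_functions.

(* Main.v *)
Require Import Defs.
From mathcomp Require Import all_boot all_order all_algebra.
From mathcomp Require Import all_classical all_reals all_analysis.
From mathcomp Require Import measurable_realfun zify ring lra.

Set Implicit Arguments.
Unset Strict Implicit.
Unset Printing Implicit Defensive.

Import Order.TTheory GRing.Theory Num.Theory numFieldNormedType.Exports.
Import ComplexField.Normc.
Local Open Scope ring_scope.
Local Open Scope complex_scope.
Local Open Scope classical_set_scope.

(** Why the theorem is true.

   Comparing pole orders in the differential equation shows that [f] is entire
   ([entire_solution]). The rest of the argument rests on the shared value, on the
   condition on the zeros and on the inequality between the exponent of convergence and the
   order.

   Suppose that f^(k) is not [f]. Since [a] is shared, the quotient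
   G = f' (f^(k) - f) / (f - a) is entire ([shared_quotient]), and it is not identically zero. On a
   circle where the logarithmic derivatives of f - a, f, f', ..., f^(k-1) are at most Q one has
   (1 + |f|) |G| <= B |f|^2 with B a multiple of Q^(k+1) ([shared_pointwise]). Taking means of
   logarithms, the mean of ln (1 + |f|) is at most twice the mean of ln |f|, minus the mean of
   ln |G|, plus O(ln Q). By the Jensen formula the mean of ln |G| is bounded below, and the mean of
   ln |f| is O(r^q) as soon as the sum of |w|^-q over the nonzero zeros w converges, which holds for
   some q below the order of [f]. Pushing the bound inside the disc by the Schwarz formula gives
   [main_estimate]: the logarithm of the maximum modulus is O(r^q) times ln Q, divided by the
   relative gap between the radii involved. Here ln Q is of the order of ln [logmax] on a
   slightly larger disc: good circles are found by removing small rings around the moduli of the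
   zeros of the functions concerned ([good_circle]). A lemma of Borel type
   ([growth_contradiction]) turns this into a contradiction with the order being larger than q.
   In place of an exceptional set of radii, the loss is absorbed by iterating over geometrically
   decreasing gaps.

   So f^(k) = f ([shared_value_fixed]). A zero of multiplicity at least k would then make all the
   derivatives of order less than k vanish at a point, and [f] would vanish identically
   ([fixed_zero]). Hence [f] has no zeros. It grows at most exponentially ([fixed_growth]), so f'/f
   is entire and bounded, hence a constant lambda, and f = A exp(lambda z) with lambda^k = 1
   ([zero_free_exponential]).

   The complex analysis behind this is organized around means over circles: the
   Goursat theorem and primitives on discs lead to the Cauchy and Schwarz formulas, from which
   differentiability of derivatives, orders of zeros, logarithms of zero-free functions, the
   Jensen formula and the bounds for logarithmic derivatives are derived. *)

(** * Complex derivatives in epsilon-delta form *)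

(** Everything below uses this form of differentiability: it is insensitive to the
   topology put on the field, so that real curves, complex functions and their compositions
   can be handled by one argument. *)
Lemma is_derive_epsdelta (K : numFieldType) (f : K -> K) (z l : K) :
  is_derive (z : K^o) 1 (f : K^o -> K^o) l <->
  (forall e : K, 0 < e -> exists2 d : K, 0 < d &
     forall w, `|w - z| < d -> `|f w - f z - l * (w - z)| <= e * `|w - z|).
Proof.
split=> [[df <-] e e0|H].
  move: df; rewrite /derivable /derive => /cvgrPdist_le /(_ e e0).
  rewrite near_withinE => /nbhs_ballP[d/= d0 Hd]; exists d => // w wd.
  have [->|wz] := eqVneq w z; first by rewrite !subrr mulr0 subr0 normr0 mulr0.
  have wz0 : w - z != 0 by rewrite subr_eq0.
  have := Hd (w - z); rewrite /ball/= sub0r normrN => /(_ wd wz0).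
  set L := lim _; rewrite /GRing.scale/= mulr1 subrK => H.
  have -> : f w - f z - L * (w - z) = ((w - z)^-1 * (f w - f z) - L) * (w - z).
    by rewrite mulrBl mulrAC mulVf// mul1r.
  by rewrite normrM ler_wpM2r// distrC.
have D : (fun h : K => h^-1 *: ((f : K^o -> K^o) (h *: (1:K^o) + z) - f z)) @ 0^' --> (l : K^o).
  apply/cvgrPdist_le => e e0; have [d d0 Hd] := H e e0.
  rewrite near_withinE; apply/nbhs_ballP; exists d => // h.
  rewrite /ball/= sub0r normrN => hd h0.
  have := Hd (h + z); rewrite addrK => /(_ hd) H1.
  rewrite /GRing.scale/= mulr1 -(ler_pM2r (_ : 0 < `|h|)) ?normr_gt0//.
  by rewrite -normrM mulrBl mulrAC mulVf// mul1r distrC.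
apply: DeriveDef; first by apply/cvg_ex; exists l.
exact: (cvg_lim (@norm_hausdorff _ K^o) D).
Qed.

Section Complex_basics.
Variable R : realType.
Implicit Types (z w : R[i]) (x y : R).

Lemma normc_ge0 z : 0 <= normc z.
Proof. by case: z => a b; exact: sqrtr_ge0. Qed.
Hint Resolve normc_ge0 : core.

Lemma ler_normcD z w : normc (z + w) <= normc z + normc w.
Proof. exact: le_normcD. Qed.

Lemma normcN z : normc (- z) = normc z.
Proof. by case: z => a b /=; rewrite !sqrrN. Qed.

Lemma ler_normcB z w : normc (z - w) <= normc z + normc w.
Proof. by rewrite -(normcN w) ler_normcD. Qed.

Lemma distcC z w : normc (z - w) = normc (w - z).
Proof. by rewrite -opprB normcN. Qed.

Lemma normc_eq0 z : (normc z == 0) = (z == 0).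
Proof. by apply/eqP/eqP => [/eq0_normc|->]; rewrite ?normc0. Qed.

Lemma normc_gt0 z : (0 < normc z) = (z != 0).
Proof. by rewrite lt_def normc_ge0 andbT normc_eq0. Qed.

Lemma normc_real x : normc x%:C = `|x|.
Proof. by rewrite /= expr0n addr0 sqrtr_sqr. Qed.

Lemma normcX z n : normc (z ^+ n) = normc z ^+ n.
Proof. by elim: n => [|n IH]; rewrite ?expr0 ?normc1// !exprS normcM IH. Qed.

Lemma normc_div z w : normc (z / w) = normc z / normc w.
Proof. by rewrite normcM normcV. Qed.

Lemma ler_distc z w : normc z - normc w <= normc (z - w).
Proof. by rewrite lerBlDr -[X in normc X <= _](subrK w) ler_normcD. Qed.

Lemma Re_le_normc z : `|complex.Re z| <= normc z.
Proof. by case: z => a b /=; rewrite -sqrtr_sqr ler_wsqrtr// lerDl sqr_ge0. Qed.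

Lemma Im_le_normc z : `|complex.Im z| <= normc z.
Proof. by case: z => a b /=; rewrite -sqrtr_sqr ler_wsqrtr// lerDr sqr_ge0. Qed.

Lemma normc_le_ReIm z : normc z <= `|complex.Re z| + `|complex.Im z|.
Proof.
case: z => a b /=; rewrite -(@ler_pXn2r _ 2%N) ?nnegrE ?sqrtr_ge0 ?addr_ge0//.
rewrite sqr_sqrtr ?addr_ge0 ?sqr_ge0// sqrrD !real_normK ?num_real//.
by rewrite lerD2r lerDl mulrn_wge0 ?mulr_ge0.
Qed.

Lemma cReD z w : complex.Re (z + w) = complex.Re z + complex.Re w.
Proof. by case: z; case: w. Qed.
Lemma cImD z w : complex.Im (z + w) = complex.Im z + complex.Im w.
Proof. by case: z; case: w. Qed.
Lemma cReN z : complex.Re (- z) = - complex.Re z.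
Proof. by case: z. Qed.
Lemma cImN z : complex.Im (- z) = - complex.Im z.
Proof. by case: z. Qed.
Lemma cReM z w : complex.Re (z * w) =
  complex.Re z * complex.Re w - complex.Im z * complex.Im w.
Proof. by case: z; case: w. Qed.
Lemma cImM z w : complex.Im (z * w) =
  complex.Re z * complex.Im w + complex.Im z * complex.Re w.
Proof. by case: z; case: w. Qed.

Lemma complex_eqP z w : complex.Re z = complex.Re w ->
  complex.Im z = complex.Im w -> z = w.
Proof. by case: z => a b; case: w => c d /= -> ->. Qed.

Lemma normc_sqr z : (normc z ^+ 2)%:C = z * conjc z.
Proof.
case: z => a b /=; rewrite sqr_sqrtr ?addr_ge0 ?sqr_ge0//.
by apply: complex_eqP; rewrite ?cReM ?cImM /=; ring.
Qed.

Lemma normc_conj z : normc (conjc z) = normc z.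
Proof. by case: z => a b /=; rewrite sqrrN. Qed.

Lemma normc_cis x : normc (cis x) = 1 :> R.
Proof. by rewrite /= cos2Dsin2 sqrtr1. Qed.

Lemma normc_cexp z : normc (cexp z) = expR (complex.Re z).
Proof. by rewrite normcM normc_cis mulr1 normc_real ger0_norm ?expR_ge0. Qed.

(** The derivative of [f] with respect to a coordinate map [s]. With [s] the identity
   this is the complex derivative, with [s] the inclusion of the reals it is the derivative
   of a curve; one chain rule covers both. *)
Definition gder (T : Type) (s f : T -> R[i]) (t : T) (l : R[i]) :=
  forall e : R, 0 < e -> exists2 d : R, 0 < d & forall u,
    normc (s u - s t) < d ->
    normc (f u - f t - l * (s u - s t)) <= e * normc (s u - s t).

Definition gcont (T : Type) (s f : T -> R[i]) (t : T) :=
  forall e : R, 0 < e -> exists2 d : R, 0 < d & forall u,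
    normc (s u - s t) < d -> normc (f u - f t) < e.

Definition cder := @gder R[i] id.
Definition ccont := @gcont R[i] id.
Definition rder := @gder R (real_complex R).
Definition rcont := @gcont R (real_complex R).

Lemma gder_cont T (s f : T -> R[i]) t l : gder s f t l -> gcont s f t.
Proof.
move=> H e e0; have [d d0 Hd] := H 1 ltr01.
have n0 : 0 < normc l + 1 by rewrite ltr_wpDl.
exists (Num.min d (e / (normc l + 1))); first by rewrite lt_min d0 divr_gt0.
move=> u; rewrite lt_min => /andP[ud ue].
rewrite -[f u - f t](subrK (l * (s u - s t))).
apply: (le_lt_trans (ler_normcD _ _)); rewrite normcM.
apply: (@le_lt_trans _ _ ((normc l + 1) * normc (s u - s t))).
  by rewrite mulrDl addrC lerD2l; exact: Hd.
by rewrite mulrC -ltr_pdivlMr.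
Qed.

Lemma gder_comp T (s g : T -> R[i]) f t l m :
  gder s g t m -> cder f (g t) l -> gder s (f \o g) t (l * m).
Proof.
move=> hg hf e e0.
have n0 : 0 < normc m + 1 by rewrite ltr_wpDl.
have nl0 : 0 < normc l + 1 by rewrite ltr_wpDl.
have e1 : 0 < e / 2 / (normc m + 1) by rewrite !divr_gt0.
have e2 : 0 < Num.min 1 (e / 2 / (normc l + 1)).
  by rewrite lt_min ltr01 !divr_gt0.
have [d d0 Hd] := hf _ e1; have [d' d'0 Hd'] := hg _ e2.
have [d'' d''0 Hd''] := gder_cont hg d0.
exists (Num.min d' d''); first by rewrite lt_min d'0.
move=> u; rewrite lt_min => /andP[u1 u2].
have A := Hd _ (Hd'' _ u2); have B := Hd' _ u1.
rewrite /= in A *; have N0 : 0 <= normc (s u - s t) by [].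
set N := normc (s u - s t) in B N0 *.
have gN : normc (g u - g t) <= (normc m + 1) * N.
  rewrite -[g u - g t](subrK (m * (s u - s t))).
  apply: (le_trans (ler_normcD _ _)); rewrite normcM mulrDl addrC lerD2l.
  by apply: (le_trans B); rewrite ler_wpM2r// ge_min lexx.
have -> : f (g u) - f (g t) - l * m * (s u - s t) =
  (f (g u) - f (g t) - l * (g u - g t)) + l * (g u - g t - m * (s u - s t)).
  by ring.
apply: (le_trans (ler_normcD _ _)).
have -> : e * N = e / 2 * N + e / 2 * N by field.
apply: lerD.
  apply: (le_trans A); apply: (le_trans (ler_wpM2l (ltW e1) gN)).
  by rewrite mulrA divfK ?gt_eqF.
rewrite normcM; apply: (@le_trans _ _ (normc l * (e / 2 / (normc l + 1) * N))).
  rewrite ler_wpM2l//; apply: (le_trans B).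
  by rewrite ler_wpM2r// ge_min lexx orbT.
rewrite mulrA ler_wpM2r// mulrCA ler_piMr ?divr_ge0 ?ltW//.
by rewrite ltr_pdivrMr// mul1r ltrDl.
Qed.

Lemma gder_near T (s f g : T -> R[i]) t l (r : R) : 0 < r ->
  (forall u, normc (s u - s t) < r -> f u = g u) ->
  gder s f t l -> gder s g t l.
Proof.
move=> r0 fg H e e0; have [d d0 Hd] := H e e0.
exists (Num.min d r); first by rewrite lt_min d0.
move=> u; rewrite lt_min => /andP[u1 u2].
by rewrite -!fg// ?subrr ?normc0//; exact: Hd.
Qed.

Lemma gcont_cst T (s : T -> R[i]) t c : gcont s (fun=> c) t.
Proof. by move=> e e0; exists 1 => // u _; rewrite subrr normc0. Qed.

Lemma gcont_coord T (s : T -> R[i]) t : gcont s s t.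
Proof. by move=> e e0; exists e. Qed.

Lemma gcontD T (s f g : T -> R[i]) t : gcont s f t -> gcont s g t ->
  gcont s (fun u => f u + g u) t.
Proof.
move=> hf hg e e0; have e2 : 0 < e / 2 by rewrite divr_gt0.
have [d d0 Hd] := hf _ e2; have [d' d'0 Hd'] := hg _ e2.
exists (Num.min d d'); first by rewrite lt_min d0.
move=> u; rewrite lt_min => /andP[u1 u2].
rewrite opprD addrACA [e]splitr.
by apply: (le_lt_trans (ler_normcD _ _)); rewrite ltrD ?Hd ?Hd'.
Qed.

Lemma gcont_comp T (s g : T -> R[i]) f t :
  gcont s g t -> ccont f (g t) -> gcont s (f \o g) t.
Proof.
move=> hg hf e e0; have [d d0 Hd] := hf e e0; have [d' d'0 Hd'] := hg _ d0.
by exists d' => // u ud; apply: Hd; exact: Hd'.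
Qed.

Lemma gcontM T (s f g : T -> R[i]) t : gcont s f t -> gcont s g t ->
  gcont s (fun u => f u * g u) t.
Proof.
move=> hf hg e e0.
have nf : 0 < normc (f t) + 1 by rewrite ltr_wpDl.
have ng : 0 < normc (g t) + 1 by rewrite ltr_wpDl.
have e1 : 0 < e / 2 / (normc (g t) + 1) by rewrite !divr_gt0.
have e2 : 0 < Num.min 1 (e / 2 / (normc (f t) + 1)).
  by rewrite lt_min ltr01 !divr_gt0.
have [d d0 Hd] := hf _ e1; have [d' d'0 Hd'] := hg _ e2.
exists (Num.min d d'); first by rewrite lt_min d0.
move=> u; rewrite lt_min => /andP[/Hd A /Hd']; rewrite lt_min => /andP[B C].
have -> : f u * g u - f t * g t = (f u - f t) * g u + f t * (g u - g t) by ring.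
apply: (le_lt_trans (ler_normcD _ _)); rewrite !normcM [e]splitr.
have gu : normc (g u) <= normc (g t) + 1.
  rewrite -[X in normc X](subrK (g t)); apply: (le_trans (ler_normcD _ _)).
  by rewrite addrC lerD2l ltW.
apply: ltr_leD.
  apply: (@le_lt_trans _ _ (normc (f u - f t) * (normc (g t) + 1))).
    by rewrite ler_wpM2l.
  by rewrite -ltr_pdivlMr.
apply: (@le_trans _ _ ((normc (f t) + 1) * (e / 2 / (normc (f t) + 1)))).
  by rewrite ler_pM// ?ltW// ltrDl.
by rewrite mulrC divfK ?gt_eqF.
Qed.

Lemma gcontN T (s f : T -> R[i]) t : gcont s f t -> gcont s (fun u => - f u) t.
Proof.
move=> H e e0; have [d d0 Hd] := H e e0; exists d => // u ud.
by rewrite -opprD normcN Hd.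
Qed.

Lemma ccont_re (f : R -> R[i]) :
  (forall t, rcont f t) -> continuous (fun t => complex.Re (f t)).
Proof.
move=> H t; apply/cvgrPdist_lt => e e0; have [d d0 Hd] := H t e e0.
apply/nbhs_ballP; exists d => // u; rewrite /ball/= distrC => ud.
rewrite distrC -cReN -cReD; apply: (le_lt_trans (Re_le_normc _)); apply: Hd.
by rewrite -rmorphB normc_real.
Qed.

Lemma ccont_im (f : R -> R[i]) :
  (forall t, rcont f t) -> continuous (fun t => complex.Im (f t)).
Proof.
move=> H t; apply/cvgrPdist_lt => e e0; have [d d0 Hd] := H t e e0.
apply/nbhs_ballP; exists d => // u; rewrite /ball/= distrC => ud.
rewrite distrC -cImN -cImD; apply: (le_lt_trans (Im_le_normc _)); apply: Hd.
by rewrite -rmorphB normc_real.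
Qed.

Lemma rcont_normc (f : R -> R[i]) :
  (forall t, rcont f t) -> continuous (fun t => normc (f t)).
Proof.
move=> H t; apply/cvgrPdist_lt => e e0; have [d d0 Hd] := H t e e0.
apply/nbhs_ballP; exists d => // u; rewrite /ball/= distrC => ud.
apply: (@le_lt_trans _ _ (normc (f u - f t))).
  by rewrite ler_norml lerNl opprB ler_distc [normc (_ - f t)]distcC ler_distc.
by apply: Hd; rewrite -rmorphB normc_real.
Qed.

Lemma posC (e : R[i]) : 0 < e -> exists2 r : R, 0 < r & e = r%:C.
Proof.
rewrite ltcE /= => /andP[/eqP i0 r0]; exists (complex.Re e) => //.
by case: e i0 {r0} => a b /= ->.
Qed.

Lemma is_deriveP f z (l : R[i]) : is_derive z 1 f l <-> cder f z l.
Proof.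
apply: (iff_trans (is_derive_epsdelta f z l)); split=> H e e0.
  have [|d d0 Hd] := H e%:C; first by rewrite ltcR.
  have [r r0 dr] := posC d0; exists r => // w wr.
  by have := Hd w; rewrite dr -lecR rmorphM/=; apply; rewrite ltcR.
have [r r0 ->] := posC e0; have [d d0 Hd] := H _ r0.
exists d%:C => [|w]; first by rewrite ltcR.
by move=> wd; have := Hd w; rewrite -lecR rmorphM/=; apply; rewrite -ltcR.
Qed.

Lemma cder_cst c z : cder (fun=> c) z 0.
Proof.
by move=> e e0; exists 1 => // u _; rewrite mul0r !subrr normc0 mulr_ge0// ltW.
Qed.

Lemma cder_id z : cder id z 1.
Proof.
by move=> e e0; exists 1 => // u _; rewrite mul1r !subrr normc0 mulr_ge0// ltW.
Qed.

Lemma gderD T (s f g : T -> R[i]) t a b : gder s f t a -> gder s g t b ->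
  gder s (fun u => f u + g u) t (a + b).
Proof.
move=> hf hg e e0; have e2 : 0 < e / 2 by rewrite divr_gt0.
have [d d0 Hd] := hf _ e2; have [d' d'0 Hd'] := hg _ e2.
exists (Num.min d d'); first by rewrite lt_min d0.
move=> u; rewrite lt_min => /andP[/Hd A /Hd' B].
rewrite [e]splitr [X in _ <= X]mulrDl.
have -> : f u + g u - (f t + g t) - (a + b) * (s u - s t) =
 (f u - f t - a * (s u - s t)) + (g u - g t - b * (s u - s t)) by ring.
by apply: (le_trans (ler_normcD _ _)); rewrite lerD.
Qed.

Lemma cderM f g z (a b : R[i]) : cder f z a -> cder g z b ->
  cder (fun w => f w * g w) z (a * g z + f z * b).
Proof.
move=> hf hg e e0.
have nf : 0 < normc (f z) + 1 by rewrite ltr_wpDl.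
have ng : 0 < normc (g z) + 1 by rewrite ltr_wpDl.
have nb : 0 < normc b + 1 by rewrite ltr_wpDl.
have e3 : 0 < e / 3%:R by rewrite divr_gt0// ltr0n.
have [d1 d10 H1] := hf _ (divr_gt0 e3 ng).
have [d2 d20 H2] := hg _ (divr_gt0 e3 nf).
have [d3 d30 H3] := gder_cont hf ltr01.
have [d4 d40 H4] := gder_cont hf (divr_gt0 e3 nb).
exists (Num.min (Num.min d1 d2) (Num.min d3 d4)).
  by rewrite !lt_min d10 d20 d30.
move=> w; rewrite !lt_min => /andP[/andP[/H1 A /H2 B] /andP[/H3 C /H4 D]].
rewrite /= in A B C D *; set N := normc (w - z) in A B *.
have N0 : 0 <= N by exact: normc_ge0.
have fw : normc (f w) <= normc (f z) + 1.
  rewrite -[X in normc X](subrK (f z)); apply: (le_trans (ler_normcD _ _)).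
  by rewrite addrC lerD2l ltW.
have -> : f w * g w - f z * g z - (a * g z + f z * b) * (w - z) =
  (f w - f z - a * (w - z)) * g z + f w * (g w - g z - b * (w - z)) +
  (f w - f z) * b * (w - z) by ring.
have -> : e * N = e / 3%:R * N + e / 3%:R * N + e / 3%:R * N by field.
apply: (le_trans (ler_normcD _ _)); apply: lerD; first last.
  rewrite !normcM ler_wpM2r//.
  apply: (@le_trans _ _ (e / 3%:R / (normc b + 1) * (normc b + 1))).
    by rewrite ler_pM// ?ltW// ltrDl.
  by rewrite divfK ?gt_eqF.
apply: (le_trans (ler_normcD _ _)); rewrite !normcM; apply: lerD.
  apply: (le_trans (ler_pM _ _ A (_ : _ <= normc (g z) + 1))) => //.
    by rewrite lerDl.
  by rewrite mulrAC divfK ?gt_eqF.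
apply: (le_trans (ler_pM _ _ fw B)) => //.
by rewrite mulrA [_ * (_ / _)]mulrC divfK ?gt_eqF.
Qed.

Lemma cderZ f c z (a : R[i]) : cder f z a -> cder (fun w => c * f w) z (c * a).
Proof.
by move=> /(cderM (cder_cst c z)); rewrite mul0r add0r.
Qed.

Lemma cderN f z (a : R[i]) : cder f z a -> cder (fun w => - f w) z (- a).
Proof.
move=> /(cderZ (-1)); rewrite mulN1r; congr (cder _ z _).
by apply/funext => w; rewrite mulN1r.
Qed.

Lemma cderB f g z (a b : R[i]) : cder f z a -> cder g z b ->
  cder (fun w => f w - g w) z (a - b).
Proof. by move=> hf /cderN; exact: gderD. Qed.

Lemma cderV f z (a : R[i]) : cder f z a -> f z != 0 ->
  cder (fun w => (f w)^-1) z (- a / f z ^+ 2).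
Proof.
move=> hf fz; refine (iffLR (is_deriveP (fun w => (f w)^-1) z _) _).
have [df D] := iffRL (is_deriveP f z a) hf.
apply: DeriveDef; first exact: derivableV.
rewrite (@deriveV R[i] _ f z 1 fz df); rewrite D.
by rewrite /GRing.scale/= !mulNr mulrC.
Qed.

Lemma cder_unique f z (a b : R[i]) : cder f z a -> cder f z b -> a = b.
Proof.
move=> ha hb; have [_ <-] := iffRL (is_deriveP f z a) ha.
by have [_ <-] := iffRL (is_deriveP f z b) hb.
Qed.

Lemma cderP f z : derivable f z 1 <-> exists l, cder f z l.
Proof.
split=> [df|[l h]]; last by case: (iffRL (is_deriveP f z l) h).
by exists ('D_1 f z); apply: (iffLR (is_deriveP _ _ _)); exact: DeriveDef.
Qed.

Lemma derive1_cder f z l : cder f z l -> derive1 f z = l.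
Proof. by move=> h; rewrite derive1E; case: (iffRL (is_deriveP f z l) h). Qed.

Lemma cderX n z : cder (fun w => w ^+ n) z (n%:R * z ^+ n.-1).
Proof.
elim: n => [|n IH]; first by rewrite mul0r; exact: cder_cst.
have := cderM (cder_id z) IH; rewrite mul1r /=.
have -> : z ^+ n + z * (n%:R * z ^+ n.-1) = n.+1%:R * z ^+ n.
  rewrite -addn1 natrD mulrDl mul1r addrC; congr (_ + _).
  by case: n {IH} => [|n]; rewrite ?mul0r ?mulr0// mulrCA -exprS.
by congr (cder _ z _); apply/funext => w; rewrite exprS.
Qed.

Lemma rder_re (f : R -> R[i]) t l : rder f t l ->
  is_derive t 1 (fun x => complex.Re (f x)) (complex.Re l).
Proof.
move=> H; apply/(is_derive_epsdelta (fun x => complex.Re (f x))) => e e0.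
have [d d0 Hd] := H e e0.
exists d => // w wd; have := Hd w; rewrite -rmorphB normc_real => /(_ wd).
apply: le_trans; apply: le_trans (Re_le_normc _).
by rewrite !cReD !cReN cReM /= mulr0 subr0.
Qed.

Lemma rder_im (f : R -> R[i]) t l : rder f t l ->
  is_derive t 1 (fun x => complex.Im (f x)) (complex.Im l).
Proof.
move=> H; apply/(is_derive_epsdelta (fun x => complex.Im (f x))) => e e0.
have [d d0 Hd] := H e e0.
exists d => // w wd; have := Hd w; rewrite -rmorphB normc_real => /(_ wd).
apply: le_trans; apply: le_trans (Im_le_normc _).
by rewrite !cImD !cImN cImM /= mulr0 add0r.
Qed.

Lemma rder_ReIm (u v : R -> R) (t a b : R) :
  is_derive t 1 u a -> is_derive t 1 v b -> rder (fun x => u x +i* v x) t (a +i* b).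
Proof.
move=> /is_derive_epsdelta hu /is_derive_epsdelta hv e e0.
have e2 : 0 < e / 2 by rewrite divr_gt0.
have [d d0 Hd] := hu _ e2; have [d' d'0 Hd'] := hv _ e2.
exists (Num.min d d'); first by rewrite lt_min d0.
move=> w; rewrite lt_min -rmorphB normc_real => /andP[/Hd A /Hd' B].
apply: (le_trans (normc_le_ReIm _)).
rewrite [e]splitr mulrDl lerD//=.
  by rewrite !mulr0 subr0.
by rewrite !mulr0 add0r.
Qed.

Lemma rder_cis t : rder (@cis R) t ('i * cis t).
Proof.
have -> : 'i * cis t = - sin t +i* cos t :> R[i].
  by apply: complex_eqP; rewrite ?cReM ?cImM /=; ring.
exact: rder_ReIm.
Qed.

Lemma rder_affine a b t : rder (fun x => a + x%:C * b) t b.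
Proof.
move=> e e0; exists 1 => // u _.
have -> : a + u%:C * b - (a + t%:C * b) - b * (u%:C - t%:C) = 0 by ring.
by rewrite normc0 mulr_ge0// ltW.
Qed.

End Complex_basics.
#[global] Hint Resolve normc_ge0 : core.

(** * Means over a period *)

Section Real_mean.
Variable R : realType.
Implicit Types (u v U : R -> R) (f g F : R -> R[i]).
Local Notation mu := (@lebesgue_measure R).

Lemma antiderivative u (M : R) : continuous u ->
  exists U : R -> R, forall t : R, `|t| < M -> is_derive t 1 U (u t).
Proof.
move=> cu; exists (fun x => \int[mu]_(t in `[- M, x]) (u t))%R => t.
rewrite ltr_norml => /andP[tM Mt].
have iu : mu.-integrable `[- M, M] (EFin \o u).
  apply: continuous_compact_integrable; first exact: segment_compact.
  exact: continuous_subspaceT.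
have [D E] := @continuous_FTC1_closed R u (- M) t M Mt iu tM (cu t).
apply: DeriveDef; first exact: D.
by rewrite -derive1E; exact: E.
Qed.

Lemma mean_value_real U u (a b B : R) : a <= b ->
  (forall t : R, a <= t <= b -> is_derive t 1 U (u t)) ->
  (forall t, a <= t <= b -> `|u t| <= B) -> `|U b - U a| <= B * (b - a).
Proof.
move=> ab dU bu.
have [||c cab ->] := @MVT_segment R U u a b ab.
- by move=> x /itvP xab; apply: dU; rewrite ltW ?xab// ltW ?xab.
- apply: derivable_within_continuous => x.
  by rewrite in_itv/= => xab; have [] := dU _ xab.
rewrite normrM [X in _ * X]ger0_norm ?subr_ge0// ler_wpM2r ?subr_ge0//.
exact: bu.
Qed.

(** The factor 2 comes from applying the real mean value theorem to the real and imaginary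
   parts separately; no estimate below depends on its size. *)
Lemma mean_value_curve F f (a b B : R) : a <= b ->
  (forall t, a <= t <= b -> rder F t (f t)) ->
  (forall t, a <= t <= b -> normc (f t) <= B) ->
  normc (F b - F a) <= 2 * B * (b - a).
Proof.
move=> ab dF bf; apply: (le_trans (normc_le_ReIm _)).
rewrite !cReD !cImD !cReN !cImN.
have -> : 2 * B * (b - a) = B * (b - a) + B * (b - a) by ring.
apply: lerD.
  apply: (@mean_value_real (fun t => complex.Re (F t))) => // t tab.
    exact/rder_re/dF.
  exact: le_trans (Re_le_normc _) (bf _ tab).
apply: (@mean_value_real (fun t => complex.Im (F t))) => // t tab.
  exact/rder_im/dF.
exact: le_trans (Im_le_normc _) (bf _ tab).
Qed.

(** All contour integrals of the proof are averages over a period, so orientation and length of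
   contours never have to be discussed. *)
Definition rmean u : R := (2 * pi)^-1 * \int[mu]_(x in `[0%R, 2 * pi]) (u x).
Definition cmean f : R[i] :=
  rmean (fun t => complex.Re (f t)) +i* rmean (fun t => complex.Im (f t)).

Let pi2 : 0 < 2 * pi :> R.
Proof. by rewrite mulr_gt0// pi_gt0. Qed.

Let int_cont u : continuous u -> mu.-integrable `[0, 2 * pi] (EFin \o u).
Proof.
move=> cu; apply: continuous_compact_integrable; first exact: segment_compact.
exact: continuous_subspaceT.
Qed.

Lemma rmeanD u v : continuous u -> continuous v ->
  rmean (fun t => u t + v t) = rmean u + rmean v.
Proof.
move=> cu cv; rewrite /rmean -mulrDr RintegralD//; exact: int_cont.
Qed.

Lemma rmeanZ c u : continuous u -> rmean (fun t => c * u t) = c * rmean u.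
Proof.
by move=> cu; rewrite /rmean RintegralZl; [exact: mulrCA|exact: measurable_itv|exact: int_cont].
Qed.

Lemma rmean_cst c : rmean (fun=> c) = c.
Proof.
rewrite /rmean Rintegral_cst//= lebesgue_measure_itv/= lte_fin pi2.
by rewrite -EFinD/= subr0 mulrCA mulVf ?mulr1// gt_eqF.
Qed.

Lemma rmean_le u v : continuous u -> continuous v -> (forall t, u t <= v t) ->
  rmean u <= rmean v.
Proof.
move=> cu cv uv; rewrite /rmean ler_pM2l ?invr_gt0//.
by apply: le_Rintegral => //; exact: int_cont.
Qed.

Lemma eq_rmean u v : u =1 v -> rmean u = rmean v.
Proof. by move=> /funext ->. Qed.

Lemma rmeanN u : continuous u -> rmean (fun t => - u t) = - rmean u.
Proof.
move=> cu; rewrite -mulN1r -rmeanZ//.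
by apply: eq_rmean => t; rewrite mulN1r.
Qed.

Lemma rmean_periodic U u : continuous u ->
  (forall t : R, is_derive t 1 U (u t)) -> U 0 = U (2 * pi) -> rmean u = 0.
Proof.
move=> cu dU U02; rewrite /rmean /Rintegral.
have cU : continuous U.
  by move=> t; apply/differentiable_continuous/derivable1_diffP; case: (dU t).
rewrite (@continuous_FTC2 R u U)// ?U02 ?subee ?mulr0//.
- exact: continuous_subspaceT.
- split=> [x _| |]; first by case: (dU x).
  + exact/cvg_at_right_filter/cU.
  + exact/cvg_at_left_filter/cU.
- by move=> x _; rewrite derive1E; case: (dU x).
Qed.

Definition rcontinuous f := forall t, rcont f t.

Lemma cmeanD f g : rcontinuous f -> rcontinuous g ->
  cmean (fun t => f t + g t) = cmean f + cmean g.
Proof.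
move=> cf cg; apply: complex_eqP; rewrite ?cReD ?cImD/=.
  rewrite -rmeanD; try exact: ccont_re.
  by apply: eq_rmean => t; rewrite cReD.
rewrite -rmeanD; try exact: ccont_im.
by apply: eq_rmean => t; rewrite cImD.
Qed.

Lemma cmeanZ c f : rcontinuous f -> cmean (fun t => c * f t) = c * cmean f.
Proof.
move=> cf; have cr := ccont_re cf; have ci := ccont_im cf.
have Z a (h : R -> R) : continuous h -> continuous (fun t => a * h t).
  by move=> ch t; apply: cvgMr; exact: ch.
apply: complex_eqP.
  rewrite cReM -(rmeanZ (complex.Re c) cr) -(rmeanZ (complex.Im c) ci) -rmeanN.
    rewrite -rmeanD; [|exact: Z|by move=> t; apply: cvgN; exact: Z].
    by apply: eq_rmean => t; rewrite cReM.
  exact: Z.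
rewrite cImM -(rmeanZ (complex.Re c) ci) -(rmeanZ (complex.Im c) cr).
rewrite -rmeanD; [|exact: Z|exact: Z].
by apply: eq_rmean => t; rewrite cImM.
Qed.

Lemma cmean_cst c : cmean (fun=> c) = c.
Proof. by apply: complex_eqP; rewrite /= rmean_cst. Qed.

Lemma eq_cmean f g : f =1 g -> cmean f = cmean g.
Proof. by move=> /funext ->. Qed.

Lemma normc_cmean f (b : R -> R) : rcontinuous f -> continuous b ->
  (forall t, normc (f t) <= b t) -> normc (cmean f) <= 2 * rmean b.
Proof.
move=> cf cb fb; apply: (le_trans (normc_le_ReIm _)) => /=.
have H u : continuous u -> (forall t, `|u t| <= b t) -> `|rmean u| <= rmean b.
  move=> cu ub; rewrite ler_norml -rmeanN//; apply/andP; split.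
    apply: rmean_le => // [t|t]; first by apply: cvgN; exact: cb.
    by rewrite lerNl; apply: le_trans (ub t); rewrite -normrN ler_norm.
  by apply: rmean_le => // t; apply: le_trans (ub t); rewrite ler_norm.
rewrite mulr_natl mulr2n; apply: lerD; apply: H.
- exact: ccont_re.
- by move=> t; exact: le_trans (Re_le_normc _) (fb t).
- exact: ccont_im.
- by move=> t; exact: le_trans (Im_le_normc _) (fb t).
Qed.

Lemma normc_cmean_cst f (b : R) : rcontinuous f ->
  (forall t, normc (f t) <= b) -> normc (cmean f) <= 2 * b.
Proof.
move=> cf fb; rewrite -(rmean_cst b); apply: normc_cmean => // t; exact: cvg_cst.
Qed.

Lemma cmean_periodic F f : rcontinuous f ->
  (forall t, rder F t (f t)) -> F 0 = F (2 * pi) -> cmean f = 0.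
Proof.
move=> cf dF F02; apply: complex_eqP => /=.
  apply: (@rmean_periodic (fun t => complex.Re (F t))); rewrite ?F02//.
    exact: ccont_re.
  by move=> t; exact: rder_re.
apply: (@rmean_periodic (fun t => complex.Im (F t))); rewrite ?F02//.
  exact: ccont_im.
by move=> t; exact: rder_im.
Qed.

End Real_mean.

(** * The Goursat theorem on rectangles *)

Section Goursat.
Variable R : realType.
Implicit Types (x y t a b : R) (z w p : R[i]).

Lemma mean_value_affine (f G : R -> R[i]) c a b (e : R) : a <= b ->
  (forall t, a <= t <= b -> rder G t (f t)) ->
  (forall t, a <= t <= b -> normc (f t - c) <= e) ->
  normc (G b - G a - c * (b - a)%:C) <= 2 * e * (b - a).
Proof.
move=> ab dG fe; pose H t := G t + (0 + t%:C * (- c)).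
have -> : G b - G a - c * (b - a)%:C = H b - H a by rewrite /H rmorphB/=; ring.
apply: (mean_value_curve ab (f := fun t => f t + - c)) => // t tab.
by apply: gderD; [exact: dG|exact: rder_affine].
Qed.

Lemma mean_value_affine_abs (f G : R -> R[i]) c a b (e : R) :
  (forall t, Num.min a b <= t <= Num.max a b -> rder G t (f t)) ->
  (forall t, Num.min a b <= t <= Num.max a b -> normc (f t - c) <= e) ->
  normc (G b - G a - c * (b - a)%:C) <= 2 * e * `|b - a|.
Proof.
have [ab|/ltW ba] := leP a b => dG fe.
  by rewrite ger0_norm ?subr_ge0//; exact: (mean_value_affine ab dG fe).
have -> : G b - G a - c * (b - a)%:C = - (G a - G b - c * (a - b)%:C).
  by rewrite !rmorphB/=; ring.
rewrite normcN -normrN opprB ger0_norm ?subr_ge0//.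
exact: (mean_value_affine ba dG fe).
Qed.

(** Instead of contour integrals, fixed antiderivatives [X y] and [Y x] of [f] along the
   horizontal and vertical lines are used; the integral of [f] over a segment is then a
   difference of two values, and additivity is an identity of a commutative group. *)
Section Boundary.
Variables (f : R[i] -> R[i]) (M : R) (X Y : R -> R -> R[i]).
Hypothesis dX : forall y t, `|t| < M -> rder (X y) t (f (t +i* y)).
Hypothesis dY : forall x t, `|t| < M -> rder (Y x) t (f (x +i* t)).

Definition bdry x1 x2 y1 y2 : R[i] :=
  (X y1 x2 - X y1 x1) + 'i * (Y x2 y2 - Y x2 y1) -
  (X y2 x2 - X y2 x1) - 'i * (Y x1 y2 - Y x1 y1).

Lemma bdry_split_x x x1 x2 y1 y2 :
  bdry x1 x2 y1 y2 = bdry x1 x y1 y2 + bdry x x2 y1 y2.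
Proof. by rewrite /bdry; ring. Qed.

Lemma bdry_split_y y x1 x2 y1 y2 :
  bdry x1 x2 y1 y2 = bdry x1 x2 y1 y + bdry x1 x2 y y2.
Proof. by rewrite /bdry; ring. Qed.

Lemma bdry_swap_x x1 x2 y1 y2 : bdry x2 x1 y1 y2 = - bdry x1 x2 y1 y2.
Proof. by rewrite /bdry; ring. Qed.

Lemma bdry_swap_y x1 x2 y1 y2 : bdry x1 x2 y2 y1 = - bdry x1 x2 y1 y2.
Proof. by rewrite /bdry; ring. Qed.

Let inM a b c : `|a| < M -> `|b| < M -> a <= c <= b -> `|c| < M.
Proof.
rewrite !ltr_norml => /andP[h1 h2] /andP[h3 h4] /andP[h5 h6].
by rewrite (lt_le_trans h1 h5) (le_lt_trans h6 h4).
Qed.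

(** Affine functions have global primitives, hence vanishing boundary sums; so the boundary
   sum only sees how far [f] is from being affine on the rectangle. *)
Lemma bdry_affine x1 x2 y1 y2 c l p (e : R) :
  `|x1| < M -> `|x2| < M -> `|y1| < M -> `|y2| < M ->
  x1 <= x2 -> y1 <= y2 ->
  (forall x y, x1 <= x <= x2 -> y1 <= y <= y2 ->
     normc (f (x +i* y) - (c + l * (x +i* y - p))) <= e) ->
  normc (bdry x1 x2 y1 y2) <= 4 * e * ((x2 - x1) + (y2 - y1)).
Proof.
move=> X1 X2 Y1 Y2 xx yy H.
pose A z := (c - l * p) * z + l / 2 * (z * z).
have dA z : cder A z (c + l * (z - p)).
  have := gderD (cderZ (c - l * p) (cder_id z))
    (cderZ (l / 2) (cderM (cder_id z) (cder_id z))).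
  rewrite !mulr1 mul1r; congr (cder _ z _).
  by rewrite -mulr2n mulrnAr -mulrnAl -[l / 2 *+ 2]mulr_natr divfK ?pnatr_eq0//; ring.
(* A is a primitive of the affine function, restricted to horizontal and vertical lines *)
have EX y t : rder (fun t : R => A (t +i* y)) t (c + l * (t +i* y - p)).
  rewrite -[X in rder _ _ X]mulr1.
  apply: (@gder_comp R R (real_complex R) (fun t => t +i* y) A) => //.
  have -> : (fun t => t +i* y) = (fun t : R => ('i * y%:C) + t%:C * 1).
    by apply/funext => s; apply: complex_eqP; rewrite ?cReD ?cImD ?cReM ?cImM/=; ring.
  exact: rder_affine.
have EY x t : rder (fun t : R => - 'i * A (x +i* t)) t (c + l * (x +i* t - p)).
  have -> : c + l * (x +i* t - p) = (- 'i) * (c + l * (x +i* t - p)) * 'i.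
    have -> : (- 'i) * (c + l * (x +i* t - p)) * 'i =
       - ('i ^+ 2) * (c + l * (x +i* t - p)) :> R[i] by ring.
    by rewrite sqr_i opprK mul1r.
  apply: (@gder_comp R R (real_complex R) (fun t => x +i* t) (fun z => - 'i * A z)).
    have -> : (fun t => x +i* t) = (fun t : R => x%:C + t%:C * 'i).
      by apply/funext => s; apply: complex_eqP; rewrite ?cReD ?cImD ?cReM ?cImM/=; ring.
    exact: rder_affine.
  exact: cderZ.
have KX y : y1 <= y <= y2 ->
  normc (X y x2 - X y x1 - (A (x2 +i* y) - A (x1 +i* y))) <= 2 * e * (x2 - x1).
  move=> yI; pose G t := X y t - A (t +i* y).
  have -> : X y x2 - X y x1 - (A (x2 +i* y) - A (x1 +i* y)) = G x2 - G x1.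
    by rewrite /G; ring.
  apply: (@mean_value_curve R G (fun t => f (t +i* y) - (c + l * (t +i* y - p)))) => //.
    move=> t tI; apply: gderD; first by apply: dX; exact: inM tI.
    rewrite -mulN1r; have := gder_comp (EX y t) (cderZ (-1) (cder_id _)).
    rewrite mulr1; congr (gder _ _ _ _).
    by apply/funext => s /=; rewrite mulN1r.
  by move=> t tI; exact: H.
have KY x : x1 <= x <= x2 ->
  normc ('i * (Y x y2 - Y x y1) - (A (x +i* y2) - A (x +i* y1))) <= 2 * e * (y2 - y1).
  move=> xI; pose G t := Y x t + (-1) * (- 'i * A (x +i* t)).
  have -> : 'i * (Y x y2 - Y x y1) - (A (x +i* y2) - A (x +i* y1)) = 'i * (G y2 - G y1).
    transitivity ('i * (Y x y2 - Y x y1) + 'i ^+ 2 * (A (x +i* y2) - A (x +i* y1))).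
      by rewrite sqr_i mulN1r.
    by rewrite /G; ring.
  rewrite normcM /= expr0n expr1n add0r sqrtr1 mul1r.
  apply: (@mean_value_curve R G (fun t => f (x +i* t) + (-1) * (c + l * (x +i* t - p)))) => //.
    move=> t tI; apply: gderD; first by apply: dY; exact: inM tI.
    have := gder_comp (EY x t) (cderZ (-1) (cder_id _)).
    by rewrite mulr1.
  by move=> t tI; rewrite mulN1r; exact: H.
pose KX' y := X y x2 - X y x1 - (A (x2 +i* y) - A (x1 +i* y)).
pose KY' x := 'i * (Y x y2 - Y x y1) - (A (x +i* y2) - A (x +i* y1)).
have -> : bdry x1 x2 y1 y2 = KX' y1 + KY' x2 - KX' y2 - KY' x1.
  by rewrite /bdry /KX' /KY'; ring.
have -> : 4 * e * (x2 - x1 + (y2 - y1)) = 2 * e * (x2 - x1) + 2 * e * (y2 - y1) +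
  2 * e * (x2 - x1) + 2 * e * (y2 - y1) by ring.
apply: (le_trans (ler_normcB _ _)); apply: lerD; last by apply: KY; rewrite lexx.
apply: (le_trans (ler_normcB _ _)); apply: lerD; last by apply: KX; rewrite lexx yy.
apply: (le_trans (ler_normcD _ _)); apply: lerD; first by apply: KX; rewrite lexx.
by apply: KY; rewrite lexx xx.
Qed.

Lemma nested_intervals (u v : nat -> R) :
  (forall n, u n <= u n.+1) -> (forall n, v n.+1 <= v n) ->
  (forall n, u n <= v n) -> exists c, forall n, u n <= c <= v n.
Proof.
move=> uS vS uv.
have um n k : u n <= u (n + k)%N.
  by elim: k => [|k IH]; rewrite ?addn0// addnS (le_trans IH).
have vm n k : v (n + k)%N <= v n.
  by elim: k => [|k IH]; rewrite ?addn0// addnS (le_trans _ IH).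
have uvm n m : u n <= v m.
  apply: (le_trans (um n m)); apply: (le_trans (uv _)).
  by rewrite addnC vm.
exists (sup (range u)) => n; apply/andP; split.
  apply: ub_le_sup; last by exists n.
  by exists (v 0%N) => _ [m _ <-].
apply: ge_sup; first by exists (u 0%N), 0%N.
by move=> _ [m _ <-].
Qed.

Lemma exists_pow2_small a (d : R) : 0 < d -> exists n, a / 2 ^+ n < d.
Proof.
move=> d0; exists (Num.bound (a / d)).
rewrite ltr_pdivrMr ?exprn_gt0// mulrC -ltr_pdivrMr//.
have [ad|ad] := leP 0 (a / d); last by apply: (lt_le_trans ad); rewrite exprn_ge0.
apply: (lt_trans (archi_boundP ad)); rewrite -natrX ltr_nat.
exact: ltn_expl.
Qed.

Let quarter (q q' : (R * R) * (R * R)) := [/\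
  [/\ q.1.1 <= q'.1.1, q'.1.2 <= q.1.2, q.2.1 <= q'.2.1 & q'.2.2 <= q.2.2],
  q'.1.2 - q'.1.1 = (q.1.2 - q.1.1) / 2, q'.2.2 - q'.2.1 = (q.2.2 - q.2.1) / 2 &
  normc (bdry q.1.1 q.1.2 q.2.1 q.2.2) <=
  4 * normc (bdry q'.1.1 q'.1.2 q'.2.1 q'.2.2)].

Let exists_quarter q : exists q',
  q.1.1 <= q.1.2 -> q.2.1 <= q.2.2 -> quarter q q'.
Proof.
case: q => [[x1 x2] [y1 y2]] /=.
pose x := (x1 + x2) / 2; pose y := (y1 + y2) / 2.
have E : bdry x1 x2 y1 y2 = bdry x1 x y1 y + bdry x1 x y y2 + bdry x x2 y1 y + bdry x x2 y y2.
  by rewrite (bdry_split_x x) (bdry_split_y y x1) (bdry_split_y y x x2) addrA.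
have H : normc (bdry x1 x2 y1 y2) <= normc (bdry x1 x y1 y) +
    normc (bdry x1 x y y2) + normc (bdry x x2 y1 y) + normc (bdry x x2 y y2).
  rewrite E; do ?apply: le_trans (ler_normcD _ _) (lerD _ _) => //.
have := H.
set b := normc _; set b1 := normc (bdry x1 x y1 y).
set b2 := normc (bdry x1 x y y2); set b3 := normc (bdry x x2 y1 y).
set b4 := normc (bdry x x2 y y2) => Hb.
have [c1|c1] := leP b (4 * b1).
  by exists ((x1, x), (y1, y)) => xx yy; split=> //=; [split|..]; rewrite /x /y; lra.
have [c2|c2] := leP b (4 * b2).
  by exists ((x1, x), (y, y2)) => xx yy; split=> //=; [split|..]; rewrite /x /y; lra.
have [c3|c3] := leP b (4 * b3).
  by exists ((x, x2), (y1, y)) => xx yy; split=> //=; [split|..]; rewrite /x /y; lra.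
exists ((x, x2), (y, y2)) => xx yy; split=> //=; [split|..]; rewrite /x /y; try lra.
rewrite -/b -/b4; lra.
Qed.

(** Bisection: some quarter of a rectangle carries at least a quarter of its boundary sum.
   The nested quarters shrink to a point, where [f] is affine up to a small error, and
   [bdry_affine] bounds the boundary sums by that error times the squared diameter. *)
Lemma goursat x1 x2 y1 y2 :
  `|x1| < M -> `|x2| < M -> `|y1| < M -> `|y2| < M -> x1 <= x2 -> y1 <= y2 ->
  (forall x y, x1 <= x <= x2 -> y1 <= y <= y2 -> exists l, cder f (x +i* y) l) ->
  bdry x1 x2 y1 y2 = 0.
Proof.
move=> X1 X2 Y1 Y2 xx yy df.
have [g Hg] := choice exists_quarter.
pose q0 := ((x1, x2), (y1, y2)); pose S n := iter n g q0.
pose w := (x2 - x1); pose h := (y2 - y1).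
have SP n : [/\ (S n).1.1 <= (S n).1.2, (S n).2.1 <= (S n).2.2,
  (S n).1.2 - (S n).1.1 = w / 2 ^+ n & (S n).2.2 - (S n).2.1 = h / 2 ^+ n].
  elim: n => [|n [a1 a2 a3 a4]]; first by rewrite /= expr0 !divr1.
  have [_ E1 E2 _] := Hg _ a1 a2.
  have E3 : (S n.+1).1.2 - (S n.+1).1.1 = w / 2 ^+ n.+1.
    by rewrite [LHS]E1 a3 exprS invfM mulrA mulrAC.
  have E4 : (S n.+1).2.2 - (S n.+1).2.1 = h / 2 ^+ n.+1.
    by rewrite [LHS]E2 a4 exprS invfM mulrA mulrAC.
  split => //; first by rewrite -subr_ge0 E3 divr_ge0 ?subr_ge0// exprn_ge0.
  by rewrite -subr_ge0 E4 divr_ge0 ?subr_ge0// exprn_ge0.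
have SQ n : quarter (S n) (S n.+1) by have [a1 a2 _ _] := SP n; exact: Hg.
have SN n : normc (bdry x1 x2 y1 y2) <= 4 ^+ n *
    normc (bdry (S n).1.1 (S n).1.2 (S n).2.1 (S n).2.2).
  elim: n => [|n IH]; first by rewrite expr0 mul1r.
  apply: (le_trans IH); rewrite exprS mulrAC [X in _ <= X]mulrC ler_wpM2l ?exprn_ge0//.
  by have [_ _ _] := SQ n.
have [px Hpx] : exists c, forall n, (S n).1.1 <= c <= (S n).1.2.
  by apply: nested_intervals => n; [have [[]] := SQ n|have [[]] := SQ n|have [] := SP n].
have [py Hpy] : exists c, forall n, (S n).2.1 <= c <= (S n).2.2.
  by apply: nested_intervals => n; [have [[]] := SQ n|have [[]] := SQ n|have [] := SP n].
have [l dl] := df _ _ (Hpx 0%N) (Hpy 0%N).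
apply/eqP; rewrite -normc_eq0 eq_le normc_ge0 andbT; apply/ler_addgt0Pr => e e0.
rewrite add0r; have wh0 : 0 <= w + h by rewrite addr_ge0 ?subr_ge0.
pose k := 4 * (w + h) ^+ 2 + 1.
have k0 : 0 < k by rewrite ltr_wpDl// mulr_ge0 ?sqr_ge0.
have [d d0 Hd] := dl _ (divr_gt0 e0 k0).
have [n Hn] := exists_pow2_small (w + h) d0.
apply: (le_trans (SN n)).
have [i1 i2 W H] := SP n.
have mono m : [/\ x1 <= (S m).1.1, (S m).1.2 <= x2, y1 <= (S m).2.1 & (S m).2.2 <= y2].
  elim: m => [|m [b1 b2 b3 b4]]; first by rewrite !lexx.
  have [[c1 c2 c3 c4] _ _ _] := SQ m.
  by rewrite (le_trans b1 c1) (le_trans c2 b2) (le_trans b3 c3) (le_trans c4 b4).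
have [m1 m2 m3 m4] := mono n.
have close x y : (S n).1.1 <= x <= (S n).1.2 -> (S n).2.1 <= y <= (S n).2.2 ->
  normc (x +i* y - (px +i* py)) <= (w + h) / 2 ^+ n.
  move=> /andP[xI1 xI2] /andP[yI1 yI2].
  have /andP[p1 p2] := Hpx n; have /andP[p3 p4] := Hpy n.
  rewrite mulrDl -W -H; apply: (le_trans (normc_le_ReIm _)) => /=.
  by apply: lerD; rewrite ler_norml; lra.
have B := @bdry_affine _ _ _ _ (f (px +i* py)) l (px +i* py)
  (e / k * ((w + h) / 2 ^+ n)) (inM X1 X2 _) (inM X1 X2 _) (inM Y1 Y2 _) (inM Y1 Y2 _)
  i1 i2.
have {}B : normc (bdry (S n).1.1 (S n).1.2 (S n).2.1 (S n).2.2) <=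
  4 * (e / k * ((w + h) / 2 ^+ n)) *
      ((S n).1.2 - (S n).1.1 + ((S n).2.2 - (S n).2.1)).
  apply: B; rewrite ?m1 ?m2 ?m3 ?m4 ?(le_trans m1 i1) ?(le_trans i1 m2)
    ?(le_trans m3 i2) ?(le_trans i2 m4)// => x y xI yI.
  have N := close x y xI yI; rewrite opprD addrA.
  have := Hd (x +i* y); rewrite /= => /(_ (le_lt_trans N Hn)) HH.
  by apply: (le_trans HH); rewrite ler_pM2l// divr_gt0.
apply: (@le_trans _ _ (4 ^+ n * (4 * (e / k * ((w + h) / 2 ^+ n)) *
      ((S n).1.2 - (S n).1.1 + ((S n).2.2 - (S n).2.1))))).
  by rewrite ler_wpM2l ?exprn_ge0.
rewrite W H -mulrDl.
have -> : 4 ^+ n * (4 * (e / k * ((w + h) / 2 ^+ n)) * ((w + h) / 2 ^+ n)) =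
  e / k * (4 * (w + h) ^+ 2) * (4 ^+ n / (2 ^+ n * 2 ^+ n)).
  by rewrite invfM; ring.
have -> : 4 ^+ n / (2 ^+ n * 2 ^+ n) = 1 :> R.
  rewrite -exprMn; have -> : 2 * 2 = 4 :> R by ring.
  by rewrite divff// expf_neq0.
rewrite mulr1 mulrAC ler_pdivrMr// ler_pM2l// /k; lra.
Qed.

End Boundary.
End Goursat.

(** * A point of mere continuity is harmless *)

Section Primitive.
Variable R : realType.
Implicit Types (x y t a b : R) (z w p : R[i]).

Section Global.
Variables (f : R[i] -> R[i]) (M : R) (X Y : R -> R -> R[i]).
Hypothesis dX : forall y t, `|t| < M -> rder (X y) t (f (t +i* y)).
Hypothesis dY : forall x t, `|t| < M -> rder (Y x) t (f (x +i* t)).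
Local Notation bdry := (bdry X Y).

Definition between a b t := Num.min a b <= t <= Num.max a b.

Lemma betweenC a b t : between a b t = between b a t.
Proof. by rewrite /between minC maxC. Qed.

Lemma between_le a b t : a <= b -> between a b t = (a <= t <= b).
Proof. by move=> ab; rewrite /between min_l// max_r. Qed.

Lemma between_l a b : between a b a.
Proof. by rewrite /between ge_min le_max lexx. Qed.

Lemma between_trans a b c t : between a b c -> between c b t -> between a b t.
Proof.
rewrite /between !ge_min !le_max => /andP[h1 h2] /andP[h3 h4].
move: h1 h2 h3 h4; lra.
Qed.

Lemma between_transl a b c t : between a b c -> between a c t -> between a b t.
Proof.
rewrite /between !ge_min !le_max => /andP[h1 h2] /andP[h3 h4].
move: h1 h2 h3 h4; lra.
Qed.

Lemma between_dist a b t : between a b t -> `|t - a| <= `|b - a|.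
Proof.
have [ab|/ltW ba] := leP a b.
  rewrite between_le// => /andP[h1 h2].
  by rewrite !ger0_norm ?subr_ge0// lerD2r.
rewrite betweenC between_le// => /andP[h1 h2].
by rewrite distrC [X in _ <= X]distrC !ger0_norm ?subr_ge0// lerD2l lerN2.
Qed.

(** The version for sides in any order, which is what path independence needs. *)
Lemma goursat_signed x1 x2 y1 y2 :
  `|x1| < M -> `|x2| < M -> `|y1| < M -> `|y2| < M ->
  (forall x y, between x1 x2 x -> between y1 y2 y ->
    exists l, cder f (x +i* y) l) -> bdry x1 x2 y1 y2 = 0.
Proof.
wlog xx : x1 x2 / x1 <= x2.
  move=> H X1 X2 Y1 Y2 D; have [|/ltW x21] := leP x1 x2; first by move=> /H; exact.
  rewrite bdry_swap_x H ?oppr0// => x y xI; apply: D; by rewrite betweenC.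
wlog yy : y1 y2 / y1 <= y2.
  move=> H X1 X2 Y1 Y2 D; have [|/ltW y21] := leP y1 y2; first by move=> /H; exact.
  rewrite bdry_swap_y H ?oppr0// => x y xI yI; apply: D => //; by rewrite betweenC.
move=> X1 X2 Y1 Y2 D; apply: (goursat dX dY) => // x y xI yI.
by apply: D; rewrite between_le.
Qed.

(** Away from the corner the previous theorem applies, and near the corner [f] is bounded,
   so the boundary sum is at most a constant times the size of an arbitrarily small corner
   rectangle. *)
Lemma goursat_corner x1 x2 y1 y2 :
  `|x1| < M -> `|x2| < M -> `|y1| < M -> `|y2| < M ->
  (forall x y, between x1 x2 x -> between y1 y2 y ->
    x +i* y != x1 +i* y1 -> exists l, cder f (x +i* y) l) ->
  ccont f (x1 +i* y1) -> bdry x1 x2 y1 y2 = 0.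
Proof.
move=> X1 X2 Y1 Y2 D cf.
have [x12|x12] := eqVneq x1 x2; first by rewrite x12 /bdry; ring.
have [y12|y12] := eqVneq y1 y2; first by rewrite y12 /bdry; ring.
have [d d0 Hd] := cf 1 ltr01.
pose W := `|x2 - x1| + `|y2 - y1|.
have W0 : 0 < W by rewrite ltr_pwDl// normr_gt0 subr_eq0 eq_sym.
have P s : 0 < s <= 1 -> W * s < d ->
    normc (bdry x1 x2 y1 y2) <= (8 * (1 + normc (f (x1 +i* y1))) * W) * s.
  move=> /andP[s0 s1] sd.
  pose x' := x1 + s * (x2 - x1); pose y' := y1 + s * (y2 - y1).
  have bx' : between x1 x2 x'.
    rewrite /between ge_min le_max /x'; apply/andP; split; apply/orP.
      have [h|h] := leP x1 x2; [left|right]; nra.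
    have [h|h] := leP x1 x2; [right|left]; nra.
  have by' : between y1 y2 y'.
    rewrite /between ge_min le_max /y'; apply/andP; split; apply/orP.
      have [h|h] := leP y1 y2; [left|right]; nra.
    have [h|h] := leP y1 y2; [right|left]; nra.
  have inM a b c : `|a| < M -> `|b| < M -> between a b c -> `|c| < M.
    rewrite /between ge_min le_max !ltr_norml => h1 h2 h3; move: h1 h2 h3; lra.
  have X' : `|x'| < M by exact: inM X1 X2 bx'.
  have Y' : `|y'| < M by exact: inM Y1 Y2 by'.
  have off u v t : u != v -> between (u + s * (v - u)) v t -> t != u.
    rewrite /between ge_min le_max neq_lt => /orP[uv|uv] /andP[h1 h2].
      have h : 0 < s * (v - u) by rewrite mulr_gt0// subr_gt0.
      by apply/eqP => E; move: h1 h2; rewrite E; lra.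
    have h : 0 < s * (u - v) by rewrite mulr_gt0// subr_gt0.
    by apply/eqP => E; move: h1 h2; rewrite E; lra.
  have nx x : between x' x2 x -> x != x1 by exact: off.
  have ny y : between y' y2 y -> y != y1 by exact: off.
  have E1 : bdry x' x2 y1 y2 = 0.
    apply: goursat_signed => // x y xI yI; apply: D => //.
      exact: between_trans bx' xI.
    by apply: contraNneq (nx x xI) => -[-> _].
  have E2 : bdry x1 x' y' y2 = 0.
    apply: goursat_signed => // x y xI yI; apply: D.
    - exact: between_transl bx' xI.
    - exact: between_trans by' yI.
    by apply: contraNneq (ny y yI) => -[_ ->].
  rewrite (bdry_split_x X Y x') E1 addr0 (bdry_split_y X Y y') E2 addr0.
  have nb x y : between x1 x' x -> between y1 y' y ->
      normc (f (x +i* y) - 0) <= 1 + normc (f (x1 +i* y1)).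
    move=> xI yI; rewrite subr0 -[f (x +i* y)](subrK (f (x1 +i* y1))).
    apply: (le_trans (ler_normcD _ _)); rewrite lerD2r ltW// Hd//.
    apply: (le_lt_trans (normc_le_ReIm _)) => /=.
    apply: le_lt_trans sd; rewrite mulrDl.
    apply: lerD.
      apply: (le_trans (between_dist xI)).
      by rewrite /x' [x1 + _]addrC addrK normrM [`|s|]gtr0_norm// mulrC.
    apply: (le_trans (between_dist yI)).
    by rewrite /y' [y1 + _]addrC addrK normrM [`|s|]gtr0_norm// mulrC.
  have EX y : between y1 y' y ->
      normc (X y x' - X y x1) <= 2 * (1 + normc (f (x1 +i* y1))) * (s * W).
    move=> yI; have := @mean_value_affine_abs R (fun t => f (t +i* y)) (X y) 0 x1 x'
      (1 + normc (f (x1 +i* y1))).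
    rewrite mul0r subr0 => H; apply: (le_trans (H _ _)) => [t tI|t tI|].
    - by apply: dX; exact: inM X1 X' tI.
    - exact: nb.
    rewrite ler_wpM2l ?mulr_ge0 ?addr_ge0//.
    rewrite /x' [x1 + _]addrC addrK normrM [`|s|]gtr0_norm//.
    by rewrite ler_pM2l// lerDl.
  have EY x : between x1 x' x ->
      normc ('i * (Y x y' - Y x y1)) <= 2 * (1 + normc (f (x1 +i* y1))) * (s * W).
    move=> xI; rewrite normcM /= expr0n expr1n add0r sqrtr1 mul1r.
    have := @mean_value_affine_abs R (fun t => f (x +i* t)) (Y x) 0 y1 y'
      (1 + normc (f (x1 +i* y1))).
    rewrite mul0r subr0 => H; apply: (le_trans (H _ _)) => [t tI|t tI|].
    - by apply: dY; exact: inM Y1 Y' tI.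
    - exact: nb.
    rewrite ler_wpM2l ?mulr_ge0 ?addr_ge0//.
    rewrite /y' [y1 + _]addrC addrK normrM [`|s|]gtr0_norm//.
    by rewrite ler_pM2l// lerDr.
  set B := 1 + _ in EX EY *; rewrite /bdry.
  have -> : 8 * B * W * s = 2 * B * (s * W) + 2 * B * (s * W) +
    2 * B * (s * W) + 2 * B * (s * W) by ring.
  apply: (le_trans (ler_normcB _ _)); apply: lerD; last by rewrite EY// between_l.
  apply: (le_trans (ler_normcB _ _)); apply: lerD; last by rewrite EX// betweenC between_l.
  apply: (le_trans (ler_normcD _ _)); apply: lerD; first by rewrite EX// between_l.
  by rewrite EY// betweenC between_l.
apply/eqP; rewrite -normc_eq0 eq_le normc_ge0 andbT; apply/ler_addgt0Pr => e e0.
rewrite add0r; set K := 8 * (1 + normc (f (x1 +i* y1))) * W in P.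
have A0 : 0 < 1 + normc (f (x1 +i* y1)) by apply: ltr_pwDl; [exact: ltr01|exact: normc_ge0].
have K0 : 0 < K by exact: (mulr_gt0 (mulr_gt0 (ltr0n _ 8) A0) W0).
pose s := Num.min 1 (Num.min (d / 2 / W) (e / K)).
have s0 : 0 < s by rewrite !lt_min ltr01 !divr_gt0.
have sW : s <= d / 2 / W by rewrite /s !ge_min lexx !orbT.
have sK : s <= e / K by rewrite /s !ge_min lexx !orbT.
apply: (@le_trans _ _ (K * s)); last by rewrite mulrC -ler_pdivlMr.
apply: P; first by rewrite s0/= /s ge_min lexx.
rewrite mulrC; move: sW; rewrite ler_pdivlMr// => h; apply: (le_lt_trans h); lra.
Qed.

(** The exceptional point cuts the rectangle into four rectangles that have it as a corner.
   It will be the centre of a difference quotient in the proof of the Cauchy formula. *)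
Lemma goursat_except w x1 x2 y1 y2 :
  `|x1| < M -> `|x2| < M -> `|y1| < M -> `|y2| < M ->
  (forall x y, between x1 x2 x -> between y1 y2 y ->
    x +i* y != w -> exists l, cder f (x +i* y) l) ->
  ccont f w -> bdry x1 x2 y1 y2 = 0.
Proof.
case: w => a b X1 X2 Y1 Y2 D cf.
have inM u v t : `|u| < M -> `|v| < M -> between u v t -> `|t| < M.
  rewrite /between ge_min le_max !ltr_norml => h1 h2 h3; move: h1 h2 h3; lra.
have [/andP[aI bI]|nI] := boolP (between x1 x2 a && between y1 y2 b); last first.
  apply: goursat_signed => // x y xI yI; apply: D => //.
  by apply: contraNneq nI => -[<- <-]; rewrite xI yI.
have A := inM _ _ _ X1 X2 aI; have B := inM _ _ _ Y1 Y2 bI.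
have C x y : between x1 x2 x -> between y1 y2 y -> bdry a x b y = 0.
  move=> xI yI; apply: goursat_corner => //.
  - exact: inM X1 X2 xI.
  - exact: inM Y1 Y2 yI.
  move=> s t sI tI; rewrite /between !ge_min !le_max in aI bI xI yI sI tI *.
  apply: D; rewrite /between !ge_min !le_max.
    by move: aI xI sI; lra.
  by move: bI yI tI; lra.
rewrite (bdry_split_x X Y a) (bdry_split_y X Y b x1) (bdry_split_y X Y b a).
rewrite [bdry x1 a y1 b]bdry_swap_x [bdry a x1 y1 b]bdry_swap_y.
rewrite [bdry x1 a b y2]bdry_swap_x [bdry a x2 y1 b]bdry_swap_y.
by rewrite !C ?oppr0 ?addr0// ?between_l// betweenC between_l.
Qed.

End Global.
End Primitive.

(** * Primitives on discs *)

Section Primitive_disc.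
Variable R : realType.
Implicit Types (x y t a b : R) (z w p : R[i]).

Lemma normc_i : normc 'i = 1 :> R.
Proof. by rewrite /= expr0n expr1n add0r sqrtr1. Qed.

Lemma normc_realB a b : normc (a%:C - b%:C) = `|a - b|.
Proof. by rewrite -rmorphB normc_real. Qed.

Lemma ler_normc z w : `|complex.Re z| <= `|complex.Re w| ->
  `|complex.Im z| <= `|complex.Im w| -> normc z <= normc w.
Proof.
case: z => a b; case: w => c d /= h1 h2; rewrite ler_wsqrtr// lerD//.
  by rewrite -[a ^+ 2]real_normK ?num_real// -[c ^+ 2]real_normK ?num_real// ler_pXn2r ?nnegrE.
by rewrite -[b ^+ 2]real_normK ?num_real// -[d ^+ 2]real_normK ?num_real// ler_pXn2r ?nnegrE.
Qed.

Lemma rder_of_continuous (f : R -> R[i]) (M : R) : rcontinuous f ->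
  exists F : R -> R[i], forall t, `|t| < M -> rder F t (f t).
Proof.
move=> cf; have [U HU] := antiderivative M (ccont_re cf).
have [V HV] := antiderivative M (ccont_im cf).
exists (fun t => U t +i* V t) => t tM; have := rder_ReIm (HU t tM) (HV t tM).
by case: (f t).
Qed.

Lemma rcont_line_x y t : rcont (fun s : R => s +i* y) t.
Proof.
move=> e e0; exists e => // u.
suff -> : u +i* y - t +i* y = u%:C - t%:C :> R[i] by [].
by apply: complex_eqP; rewrite ?cReD ?cImD ?cReN ?cImN/=; ring.
Qed.

Lemma rcont_line_y x t : rcont (fun s : R => x +i* s) t.
Proof.
move=> e e0; exists e => // u.
have -> : x +i* u - x +i* t = 'i * (u%:C - t%:C) :> R[i].
  by apply: complex_eqP; rewrite ?cReD ?cImD ?cReN ?cImN ?cReM ?cImM ?cReD ?cImD/=; ring.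
by rewrite normcM normc_i mul1r.
Qed.

Lemma line_antiderivatives (f : R[i] -> R[i]) (M : R) : (forall z, ccont f z) ->
  exists XY : (R -> R -> R[i]) * (R -> R -> R[i]),
   (forall y t, `|t| < M -> rder (XY.1 y) t (f (t +i* y))) /\
   (forall x t, `|t| < M -> rder (XY.2 x) t (f (x +i* t))).
Proof.
move=> cf.
have HX y : exists F : R -> R[i], forall t, `|t| < M -> rder F t (f (t +i* y)).
  apply: rder_of_continuous => t.
  exact: (gcont_comp (rcont_line_x y t) (cf _)).
have HY x : exists F : R -> R[i], forall t, `|t| < M -> rder F t (f (x +i* t)).
  apply: rder_of_continuous => t.
  exact: (gcont_comp (rcont_line_y x t) (cf _)).
have [X dX] := choice HX; have [Y dY] := choice HY.
by exists (X, Y).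
Qed.

(** Integrate along a horizontal and then a vertical segment, or in the other order: the
   two candidates agree by [goursat_except], and each makes one partial derivative obvious. *)
Lemma primitive_global (f : R[i] -> R[i]) (rho : R) w :
  (forall z, ccont f z) ->
  (forall z, normc z < rho -> z != w -> exists l, cder f z l) ->
  exists F, forall z, normc z < rho -> cder F z (f z).
Proof.
move=> cf df; have [[X Y] /= [dX dY]] := line_antiderivatives (rho + 1) cf.
pose F z := X 0 (complex.Re z) - X 0 0 + 'i * (Y (complex.Re z) (complex.Im z) - Y (complex.Re z) 0).
exists F.
have Mc z : normc z < rho -> [/\ `|complex.Re z| < rho + 1, `|complex.Im z| < rho + 1 & `|0 : R| < rho + 1].
  move=> zr; rewrite normr0.
  have := Re_le_normc z; have := Im_le_normc z; have := normc_ge0 z.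
  split; lra.
have FE z : normc z < rho -> F z = X (complex.Im z) (complex.Re z) - X (complex.Im z) 0 + 'i * (Y 0 (complex.Im z) - Y 0 0).
  move=> zr; have [M1 M2 M3] := Mc z zr.
  have := goursat_except dX dY M3 M1 M3 M2 (w := w) _ (cf w).
  rewrite /bdry => H; apply/eqP; rewrite -subr_eq0 -[X in _ == X]H.
    by apply/eqP; rewrite /F; ring.
  move=> x y xI yI; apply: df; apply: le_lt_trans zr.
  by apply: ler_normc => /=; [have := between_dist xI|have := between_dist yI]; rewrite !subr0.
move=> z zr e e0.
have [d d0 Hd] := cf z (e / 4) (divr_gt0 e0 (ltr0n _ 4)).
exists (Num.min d (rho - normc z)); first by rewrite lt_min d0 subr_gt0.
move=> u; rewrite lt_min /= => /andP[ud ur].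
set x := complex.Re z; set y := complex.Im z.
set x' := complex.Re u; set y' := complex.Im u.
have xx : `|x' - x| <= normc (u - z) by rewrite -cReN -cReD Re_le_normc.
have yy : `|y' - y| <= normc (u - z) by rewrite -cImN -cImD Im_le_normc.
have close s t : between x x' s -> between y y' t -> normc (s +i* t - z) <= normc (u - z).
  move=> sI tI; apply: ler_normc; rewrite ?cReD ?cReN ?cImD ?cImN.
    exact: between_dist sI.
  exact: between_dist tI.
have inr s t : between x x' s -> between y y' t -> normc (s +i* t) < rho.
  move=> sI tI; rewrite -[s +i* t](subrK z); apply: (le_lt_trans (ler_normcD _ _)).
  by rewrite -ltrBrDr (le_lt_trans (close _ _ sI tI)).
have zE : z = x +i* y by rewrite /x /y; case: (z).
have uE : u = x' +i* y' by rewrite /x' /y'; case: (u).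
have -> : F u - F z - f z * (u - z) =
   (X y x' - X y x - f z * (x' - x)%:C) + 'i * (Y x' y' - Y x' y - f z * (y' - y)%:C).
  have -> : F u - F z = (F u - F (x' +i* y)) + (F (x' +i* y) - F z) by ring.
  have -> : F (x' +i* y) - F z = X y x' - X y x.
    rewrite zE !FE/= ?inr// ?between_l// ?(betweenC x) ?between_l//.
    by rewrite -/x -/y; ring.
  have -> : F u - F (x' +i* y) = 'i * (Y x' y' - Y x' y) by rewrite uE /F/=; ring.
  have -> : u - z = (x' - x)%:C + 'i * (y' - y)%:C.
    by rewrite uE zE; apply: complex_eqP; rewrite ?cReD ?cImD ?cReN ?cImN ?cReM ?cImM ?cReD ?cImD ?cReN ?cImN/=; ring.
  ring.
apply: (le_trans (ler_normcD _ _)); rewrite normcM.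
rewrite normc_i mul1r.
have -> : e * normc (u - z) = 2 * (e / 4) * normc (u - z) + 2 * (e / 4) * normc (u - z) by field.
have [zM1 zM2 _] := Mc z zr; have ur' : normc u < rho by rewrite uE inr// betweenC between_l.
have [uM1 uM2 _] := Mc u ur'.
have inM a b t : `|a| < rho + 1 -> `|b| < rho + 1 -> between a b t -> `|t| < rho + 1.
  rewrite /between ge_min le_max !ltr_norml => h1 h2 h3; move: h1 h2 h3; lra.
apply: lerD.
  apply: (@le_trans _ _ (2 * (e / 4) * `|x' - x|)); last by rewrite ler_pM2l// mulr_gt0// divr_gt0.
  apply: (@mean_value_affine_abs R (fun t => f (t +i* y))) => t tI.
    apply: dX; exact: inM tI.
  by rewrite ltW// Hd//; apply: le_lt_trans ud; apply: close => //; exact: between_l.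
apply: (@le_trans _ _ (2 * (e / 4) * `|y' - y|)); last by rewrite ler_pM2l// mulr_gt0// divr_gt0.
apply: (@mean_value_affine_abs R (fun t => f (x' +i* t))) => t tI.
  apply: dY; exact: inM tI.
by rewrite ltW// Hd//; apply: le_lt_trans ud; apply: close => //; rewrite betweenC between_l.
Qed.

Lemma ccont_retract (r : R) z : 0 < r ->
  ccont (fun z => z * (r / Num.max r (normc z))%:C) z.
Proof.
move=> r0; apply: gcontM; first exact: gcont_coord.
move=> e e0; exists (e * r); first exact: mulr_gt0.
move=> u ue; rewrite normc_realB.
have m0 v : 0 < Num.max r (normc v) by rewrite lt_max r0.
have -> : r / Num.max r (normc u) - r / Num.max r (normc z) =
   r * (Num.max r (normc z) - Num.max r (normc u)) / (Num.max r (normc u) * Num.max r (normc z)).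
  by field; rewrite !gt_eqF.
rewrite normrM normrM normfV (gtr0_norm r0) (gtr0_norm (mulr_gt0 (m0 u) (m0 z))).
rewrite ltr_pdivrMr ?mulr_gt0//.
have A : `|Num.max r (normc z) - Num.max r (normc u)| <= normc (u - z).
  have h1 := ler_distc u z; have h2 := ler_distc z u; rewrite distcC in h2.
  have h3 := normc_ge0 (u - z).
  rewrite ler_norml; case: (leP r (normc z)) => h4; case: (leP r (normc u)) => h5; lra.
apply: (@lt_le_trans _ _ (r * (e * r))).
  by rewrite ltr_pM2l//; exact: le_lt_trans A ue.
have -> : r * (e * r) = e * (r * r) by ring.
by rewrite ler_pM2l//; apply: ler_pM; rewrite ?(ltW r0)// le_max lexx.
Qed.

(** Composing with the radial retraction onto a smaller disc turns a function on a disc into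
   a continuous function on the plane, to which [primitive_global] applies. *)
Lemma primitive_disc (f : R[i] -> R[i]) (r rho : R) w : r < rho ->
  (forall z, normc z < rho -> ccont f z) ->
  (forall z, normc z < rho -> z != w -> exists l, cder f z l) ->
  exists F, forall z, normc z < r -> cder F z (f z).
Proof.
have [r0 rr cf df|r0 _ _ _] := ltP 0 r; last first.
  by exists id => z zr; have := lt_le_trans zr r0; rewrite ltNge normc_ge0.
pose k z := z * (r / Num.max r (normc z))%:C.
have kr z : normc (k z) <= r.
  have m0 : 0 < Num.max r (normc z) by rewrite lt_max r0.
  rewrite /k normcM normc_real gtr0_norm ?divr_gt0// mulrCA ger_pMr//.
  by rewrite ler_pdivrMr// mul1r le_max lexx orbT.
have kid z : normc z < r -> k z = z.
  by move=> zr; rewrite /k max_l ?ltW// divff ?gt_eqF// mulr1.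
have nk z u : normc z < r -> normc (u - z) < r - normc z -> normc u < r.
  move=> zr uz; rewrite -[u](subrK z); apply: (le_lt_trans (ler_normcD _ _)).
  by rewrite -ltrBrDr.
have [|z zr zw|F HF] := @primitive_global (f \o k) r w.
- move=> z; apply: (gcont_comp (ccont_retract z r0)); apply: cf.
  exact: le_lt_trans (kr z) rr.
- have [l dl] := df z (lt_trans zr rr) zw; exists l.
  apply: (@gder_near R R[i] id f (f \o k) z l (r - normc z)); first by rewrite subr_gt0.
    by move=> u uz /=; rewrite kid//; exact: nk uz.
  exact: dl.
by exists F => z zr; have := HF z zr; rewrite /= kid.
Qed.

End Primitive_disc.

(** * The Cauchy formula *)

Section Cauchy.
Variable R : realType.
Implicit Types (r x y t a b rho : R) (z w p : R[i]) (f g : R[i] -> R[i]).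

Lemma exists_between a b : a < b -> exists s, a < s < b.
Proof. by move=> ab; exists ((a + b) / 2); apply/andP; split; lra. Qed.

Lemma conjcM z w : conjc (z * w) = conjc z * conjc w.
Proof. exact: rmorphM. Qed.

Lemma conjcV z : conjc (z^-1) = (conjc z)^-1.
Proof. exact: conjc_inv. Qed.

Lemma conj1c : conjc (1 : R[i]) = 1.
Proof. exact: conjc1. Qed.

Lemma conjcB z w : conjc (z - w) = conjc z - conjc w.
Proof. exact: rmorphB. Qed.

Definition hol f rho := forall z, normc z < rho -> exists l, cder f z l.

Lemma hol_cont f rho z : hol f rho -> normc z < rho -> ccont f z.
Proof. by move=> hf /hf[l]; exact: gder_cont. Qed.

Lemma hol_le f rho rho' : rho' <= rho -> hol f rho -> hol f rho'.
Proof. by move=> h hf z zr; apply: hf; exact: lt_le_trans zr h. Qed.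

Lemma gcontV T (s f : T -> R[i]) (t : T) : gcont s f t -> f t != 0 ->
  gcont s (fun u => (f u)^-1) t.
Proof.
move=> cf f0; apply: (gcont_comp cf).
exact: gder_cont (cderV (cder_id _) f0).
Qed.

Definition circle r t : R[i] := r%:C * cis t.

Lemma normc_circle r t : 0 <= r -> normc (circle r t) = r.
Proof. by move=> r0; rewrite normcM normc_cis mulr1 normc_real ger0_norm. Qed.

Lemma circle_neq0 r t : 0 < r -> circle r t != 0.
Proof. by move=> r0; rewrite -normc_gt0 normc_circle ?ltW. Qed.

Lemma circle_sub_neq0 r t w : normc w < r -> circle r t - w != 0.
Proof.
move=> wr; have r0 : 0 <= r by rewrite (le_trans _ (ltW wr)).
rewrite -normc_gt0 (lt_le_trans _ (ler_distc _ _))// normc_circle//.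
by rewrite subr_gt0.
Qed.

Lemma circle_dist r t w : normc w < r -> r - normc w <= normc (circle r t - w).
Proof.
move=> wr; have r0 : 0 <= r by rewrite (le_trans _ (ltW wr)).
by apply: le_trans (ler_distc _ _); rewrite normc_circle.
Qed.

Lemma rder_circle r t : rder (circle r) t ('i * circle r t).
Proof.
have := gder_comp (rder_cis t) (cderZ r%:C (cder_id _)).
by rewrite mulr1 /circle mulrCA.
Qed.

Lemma rcont_circle r t : rcont (circle r) t.
Proof. exact: gder_cont (rder_circle r t). Qed.

Lemma circle_periodic r : circle r 0 = circle r (2 * pi).
Proof. by rewrite /circle /cis cos0 sin0 mulr_natl cos2pi sin2pi. Qed.

Lemma circle_conj r t : 0 < r -> conjc (circle r t) = (r ^+ 2)%:C / circle r t.
Proof.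
move=> r0; have c0 := circle_neq0 t r0.
apply: (mulfI c0); rewrite -normc_sqr normc_circle ?ltW//.
by rewrite mulrCA divff// mulr1.
Qed.

Lemma rcont_hol_circle f rho r t : hol f rho -> 0 < r < rho ->
  rcont (fun t => f (circle r t)) t.
Proof.
move=> hf /andP[r0 rr]; apply: (gcont_comp (rcont_circle r t)).
by apply: (hol_cont hf); rewrite normc_circle ?ltW.
Qed.

Lemma rcont_kernel r w t : normc w < r -> rcont (fun t => (circle r t - w)^-1) t.
Proof.
move=> wr; apply: gcontV; last exact: circle_sub_neq0.
by apply: gcontD; [exact: rcont_circle|exact: gcont_cst].
Qed.

Lemma cmean_conj (u : R -> R[i]) : rcontinuous u ->
  cmean (fun t => conjc (u t)) = (conjc (cmean u)).
Proof.
move=> cu; apply: complex_eqP => /=.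
  by apply: eq_rmean => t; case: (u t).
rewrite -(rmeanN (ccont_im cu)).
by apply: eq_rmean => t; case: (u t).
Qed.

(** The difference quotient of [f] at [w], extended by the derivative, is continuous
   everywhere and holomorphic off [w], so it has a primitive and its integral over the circle
   vanishes. *)
Lemma slope_zero_mean f rho r w : hol f rho -> 0 < r < rho -> normc w < r ->
  cmean (fun t => (f (circle r t) - f w) * (circle r t - w)^-1 * circle r t) = 0.
Proof.
move=> hf /andP[r0 rr] wr.
have [l dl] := hf w (lt_trans wr rr).
pose q z := if z == w then l else (f z - f w) / (z - w).
have qder z : normc z < rho -> z != w -> exists l, cder q z l.
  move=> zr zw; have [m dm] := hf z zr.
  have zw0 : z - w != 0 by rewrite subr_eq0.
  have d1 := cderB dm (cder_cst (f w) z).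
  have d2 := cderV (cderB (cder_id z) (cder_cst w z)) zw0.
  eexists; apply: gder_near (cderM d1 d2); first by rewrite -normc_gt0 in zw0; exact: zw0.
  move=> u uz; rewrite /q ifN//; apply: contraTneq uz => /= ->.
  by rewrite distcC ltxx.
have cq z : normc z < rho -> ccont q z.
  move=> zr; have [->|zw] := eqVneq z w; last first.
    by have [m] := qder z zr zw; exact: gder_cont.
  move=> e e0; have [d d0 Hd] := dl (e / 2) (divr_gt0 e0 (ltr0n _ 2)).
  exists d => // u ud; rewrite /q eqxx; case: eqVneq => [_|uw].
    by rewrite subrr normc0.
  have uw0 : u - w != 0 by rewrite subr_eq0.
  have -> : (f u - f w) / (u - w) - l = (f u - f w - l * (u - w)) / (u - w).
    by field.
  rewrite normc_div ltr_pdivrMr ?normc_gt0//; apply: (le_lt_trans (Hd u ud)).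
  by rewrite ltr_pM2r ?normc_gt0// ltr_pdivrMr// ltr_pMr// ltr1n.
have [s /andP[rs srho]] := exists_between rr.
have [Q dQ] := primitive_disc srho cq qder.
have cr : rcontinuous (fun t => q (circle r t) * circle r t).
  move=> t; apply: gcontM; last exact: rcont_circle.
  by apply: (gcont_comp (rcont_circle r t)); apply: cq; rewrite normc_circle ?ltW.
have : cmean (fun t => q (circle r t) * circle r t) = 0.
  apply: (@cmean_periodic R (fun t => - 'i * Q (circle r t))) => // [t|]; last first.
    by rewrite circle_periodic.
  have := gder_comp (rder_circle r t) (cderZ (- 'i) (dQ _ _)).
  rewrite normc_circle ?ltW// => /(_ rs).
  have -> : - 'i * q (circle r t) * ('i * circle r t) =
     - ('i ^+ 2) * (q (circle r t) * circle r t) :> R[i] by ring.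
  by rewrite sqr_i opprK mul1r.
move=> <-; apply: eq_cmean => t; congr (_ * _); rewrite /q ifN//.
by rewrite -subr_eq0 circle_sub_neq0.
Qed.

Lemma mean_value_property f rho r : hol f rho -> 0 < r < rho ->
  cmean (fun t => f (circle r t)) = f 0.
Proof.
move=> hf rI; have /andP[r0 rr] := rI.
have := slope_zero_mean hf rI (w := 0); rewrite normc0 => /(_ r0) H.
have cf : rcontinuous (fun t => f (circle r t)).
  by move=> t; exact: rcont_hol_circle hf rI.
have : cmean (fun t => f (circle r t) + - f 0) = 0.
  rewrite -[RHS]H; apply: eq_cmean => t.
  by rewrite subr0 mulfVK// circle_neq0.
rewrite cmeanD// ?cmean_cst; last by move=> t; exact: gcont_cst.
by move/eqP; rewrite subr_eq0 => /eqP.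
Qed.

(** On the circle of radius [r] the conjugate of a point is r^2 over the point; hence the
   Cauchy kernel is there the conjugate of the function (1 - conj(w) z / r^2)^-1, which is
   holomorphic beyond the disc. *)
Lemma reflected_kernel r w : normc w < r ->
  exists g s, [/\ r < s, hol g s, g 0 = 1, (forall z, normc z < s -> g z != 0) &
    forall t, circle r t * (circle r t - w)^-1 = conjc (g (circle r t))].
Proof.
move=> wr; have r0 : 0 < r by rewrite (le_lt_trans _ wr).
pose g z := (1 - conjc w / (r ^+ 2)%:C * z)^-1.
have r2 : (r ^+ 2)%:C != 0 :> R[i].
  by rewrite -normc_gt0 normc_real normr_gt0 expf_neq0// gt_eqF.
have [s [rs sw]] : exists s, r < s /\ normc w * s < r ^+ 2.
  have [->|w0] := eqVneq w 0.
    by exists (r + 1); rewrite normc0 mul0r exprn_gt0// ltrDl.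
  have : r < r ^+ 2 / normc w by rewrite ltr_pdivlMr ?normc_gt0// expr2 ltr_pM2l.
  move=> /exists_between[s /andP[h1 h2]]; exists s; split=> //.
  by rewrite mulrC -ltr_pdivlMr ?normc_gt0.
have n0 z : normc z < s -> 1 - conjc w / (r ^+ 2)%:C * z != 0.
  move=> zs; rewrite subr_eq0; apply/eqP => E.
  have E1 : (r ^+ 2)%:C = conjc w * z.
    by rewrite -[LHS]mulr1 E mulrA mulrCA divff// mulr1.
  have := congr1 (@normc R) E1; rewrite normc_real ger0_norm ?sqr_ge0//.
  rewrite normcM normc_conj => E2.
  by have := ler_wpM2l (normc_ge0 w) (ltW zs); rewrite -E2 leNgt sw.
exists g, s; split => //.
- move=> z zs; eexists; apply: cderV; last exact: n0.
  by apply: cderB; [exact: cder_cst|apply: cderZ; exact: cder_id].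
- by rewrite /g mulr0 subr0 invr1.
- by move=> z zs; rewrite invr_eq0 n0.
move=> t; have c0 := circle_neq0 t r0.
have cw := circle_sub_neq0 t wr.
rewrite /g conjcV conjcB conj1c 2!conjcM conjcV conjcK conjc_real circle_conj//.
rewrite mulrA divfK//.
by field; rewrite cw c0.
Qed.

Lemma hol_mul f g rho : hol f rho -> hol g rho -> hol (fun z => f z * g z) rho.
Proof.
move=> hf hg z zr; have [a da] := hf z zr; have [b db] := hg z zr.
by eexists; exact: cderM da db.
Qed.

(** By [reflected_kernel] the integrand is the conjugate of a holomorphic function, so that
   the mean value property evaluates the integral. This is what isolates the real part of a
   holomorphic function in the Schwarz formula. *)
Lemma conj_kernel_mean f rho r w : hol f rho -> 0 < r < rho -> normc w < r ->
  cmean (fun t => conjc (f (circle r t)) * (circle r t * (circle r t - w)^-1)) =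
  conjc (f 0).
Proof.
move=> hf /andP[r0 rr] wr.
have [g [s [rs hg g0 _ gE]]] := reflected_kernel wr.
have rI : 0 < r < Num.min rho s by rewrite r0 lt_min rr.
have hfg : hol (fun z => f z * g z) (Num.min rho s).
  by apply: hol_mul; [apply: hol_le hf|apply: hol_le hg]; rewrite ge_min lexx ?orbT.
have -> : conjc (f 0) = conjc (f 0 * g 0) by rewrite g0 mulr1.
have M : cmean (fun t => f (circle r t) * g (circle r t)) = f 0 * g 0.
  exact: (mean_value_property hfg rI).
rewrite -M -cmean_conj; last first.
  by move=> t; exact: rcont_hol_circle hfg rI.
by apply: eq_cmean => t; rewrite gE conjcM.
Qed.

Lemma cmean_poisson_one r w : normc w < r ->
  cmean (fun t => circle r t * (circle r t - w)^-1) = 1.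
Proof.
move=> wr; have h1 : hol (fun=> 1) (r + 1) by move=> z _; exists 0; exact: cder_cst.
have rI : 0 < r < r + 1 by rewrite ltrDl ltr01 (le_lt_trans _ wr).
rewrite -[RHS]conj1c -(conj_kernel_mean h1 rI wr).
by apply: eq_cmean => t; rewrite conj1c mul1r.
Qed.

Lemma cauchy_formula f rho r w : hol f rho -> 0 < r < rho -> normc w < r ->
  f w = cmean (fun t => f (circle r t) * circle r t * (circle r t - w)^-1).
Proof.
move=> hf rI wr; have := slope_zero_mean hf rI wr.
have cf : rcontinuous (fun t => f (circle r t) * circle r t * (circle r t - w)^-1).
  move=> t; apply: gcontM; last exact: rcont_kernel.
  by apply: gcontM; [exact: rcont_hol_circle hf rI|exact: rcont_circle].
have ck : rcontinuous (fun t => circle r t * (circle r t - w)^-1).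
  by move=> t; apply: gcontM; [exact: rcont_circle|exact: rcont_kernel].
have -> : (fun t => (f (circle r t) - f w) * (circle r t - w)^-1 * circle r t) =
   (fun t => f (circle r t) * circle r t * (circle r t - w)^-1 +
     (- f w) * (circle r t * (circle r t - w)^-1)).
  by apply/funext => t; ring.
rewrite cmeanD//; last by move=> t; exact: (gcontM (gcont_cst _ t _) (ck t)).
rewrite cmeanZ// cmean_poisson_one// mulr1 => /eqP.
by rewrite subr_eq0 => /eqP.
Qed.

End Cauchy.

(** * Derivatives and zeros of holomorphic functions *)

Section Regularity.
Variable R : realType.
Implicit Types (r a b rho B : R) (z w p : R[i]) (f g : R[i] -> R[i]).

Lemma cder_quadratic f w l (d C : R) : 0 < d -> 0 <= C ->
  (forall z, normc (z - w) < d ->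
    normc (f z - f w - l * (z - w)) <= C * normc (z - w) ^+ 2) -> cder f w l.
Proof.
move=> d0 C0 H e e0; have C1 : 0 < C + 1 by rewrite ltr_wpDl.
exists (Num.min d (e / (C + 1))); first by rewrite lt_min d0 divr_gt0.
move=> z; rewrite lt_min => /andP[/H h1 h2]; apply: (le_trans h1).
rewrite expr2 mulrA ler_wpM2r//; move: h2; rewrite ltr_pdivlMr// => h2.
have := normc_ge0 (z - w); rewrite /= in h2 *; lra.
Qed.

Section Transform.
Variables (r : R) (u : R -> R[i]) (w : R[i]).
Hypotheses (cu : rcontinuous u) (wr : normc w < r).

Local Notation k z := (fun t => (circle r t - z)^-1).

Lemma kernel_bound z t : normc z < r -> normc ((circle r t - z)^-1) <= (r - normc z)^-1.
Proof.
move=> zr; rewrite normcV lef_pV2 ?posrE ?subr_gt0//; first exact: circle_dist.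
by rewrite (lt_le_trans _ (circle_dist t zr))// subr_gt0.
Qed.

Let near_w z : normc (z - w) < (r - normc w) / 2 -> (r - normc w) / 2 <= r - normc z.
Proof. by move=> h; have := ler_distc z w; move: h; lra. Qed.

Let near_r z : normc (z - w) < (r - normc w) / 2 -> normc z < r.
Proof.
move=> /near_w h; have := wr; move: h.
by rewrite -(subr_gt0 (normc z)) -(subr_gt0 (normc w)); lra.
Qed.

Let ck z : normc z < r -> rcontinuous (k z).
Proof. by move=> zr t; exact: rcont_kernel. Qed.

Let cM (f g : R -> R[i]) : rcontinuous f -> rcontinuous g ->
  rcontinuous (fun t => f t * g t).
Proof. by move=> cf cg t; exact: gcontM (cf t) (cg t). Qed.

Let cD (f g : R -> R[i]) : rcontinuous f -> rcontinuous g ->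
  rcontinuous (fun t => f t + g t).
Proof. by move=> cf cg t; exact: gcontD (cf t) (cg t). Qed.

Let cc (c : R[i]) : rcontinuous (fun=> c).
Proof. by move=> t; exact: gcont_cst. Qed.

Let transform_bound (h : R -> R[i]) C : 0 <= C -> rcontinuous h ->
  (forall t, normc (h t) <= C) ->
  normc (cmean (fun t => u t * h t)) <= 2 * (C * rmean (fun t => normc (u t))).
Proof.
move=> C0 ch hC; rewrite -rmeanZ; last exact: rcont_normc.
apply: normc_cmean; first exact: cM.
  by move=> t; apply: cvgMr; exact: rcont_normc.
by move=> t; rewrite normcM mulrC ler_wpM2r.
Qed.

Lemma rmean_normc_ge0 : 0 <= rmean (fun t => normc (u t)).
Proof.
rewrite -(rmean_cst (0 : R)); apply: rmean_le => //; first by move=> t; exact: cvg_cst.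
  exact: rcont_normc.
by move=> t; exact: normc_ge0.
Qed.

(** Differentiation under the integral sign is replaced by an explicit second-order
   expansion of the Cauchy kernel, whose remainder is uniformly bounded on the circle. *)
Lemma cder_transform1 :
  cder (fun z => cmean (fun t => u t * k z t)) w (cmean (fun t => u t * k w t ^+ 2)).
Proof.
have d0 : 0 < r - normc w by rewrite subr_gt0.
pose d := r - normc w; pose C := 2 * (d^-1 ^+ 2 * (d / 2)^-1 * rmean (fun t => normc (u t))).
have dd : 0 <= d^-1 ^+ 2 * (d / 2)^-1.
  by rewrite mulr_ge0 ?exprn_ge0 ?invr_ge0 ?divr_ge0 ?ltW.
apply: (@cder_quadratic _ _ _ (d / 2) C); first by rewrite divr_gt0.
  exact: (mulr_ge0 (ler0n _ 2) (mulr_ge0 dd rmean_normc_ge0)).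
move=> z zd; have zr := near_r zd; have zd' := near_w zd.
set e := z - w.
have -> : (fun t => u t * k z t) = fun t => u t * k w t + (e * (u t * k w t ^+ 2) +
    e ^+ 2 * (u t * (k w t ^+ 2 * k z t))).
  apply/funext => t; have := circle_sub_neq0 t zr; have := circle_sub_neq0 t wr.
  by rewrite /e => h1 h2; field; rewrite h1 h2.
have c1 := ck wr; have c2 := ck zr.
have c3 : rcontinuous (fun t => k w t ^+ 2) by exact: cM.
have c4 : rcontinuous (fun t => k w t ^+ 2 * k z t) by exact: cM.
have c5 := cM cu c3; have c6 := cM cu c4; have c7 := cM cu c1.
rewrite cmeanD//; last by apply: cD; apply: cM => //; exact: cc.
rewrite cmeanD; [|exact: (cM (cc _) c5)|exact: (cM (cc _) c6)].
rewrite !cmeanZ//.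
have -> : forall a b c : R[i], a + (e * b + e ^+ 2 * c) - a - b * e = e ^+ 2 * c by move=> *; ring.
rewrite normcM normcX mulrC ler_wpM2r ?exprn_ge0//.
apply: transform_bound => // t.
have di : 0 <= d^-1 by rewrite invr_ge0 (ltW d0).
rewrite normcM normcX ler_pM ?exprn_ge0//.
  by rewrite ler_pXn2r ?nnegrE//; exact: kernel_bound.
apply: (le_trans (kernel_bound t zr)).
by rewrite lef_pV2 ?posrE ?subr_gt0 ?divr_gt0.
Qed.

Lemma cder_transform2 :
  cder (fun z => cmean (fun t => u t * k z t ^+ 2)) w
       (cmean (fun t => u t * (2 * k w t ^+ 3))).
Proof.
have d0 : 0 < r - normc w by rewrite subr_gt0.
pose d := r - normc w; pose K := d^-1 ^+ 2 * (d / 2)^-1 ^+ 2 + 2 * d^-1 ^+ 3 * (d / 2)^-1.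
pose C := 2 * (K * rmean (fun t => normc (u t))).
have di : 0 <= d^-1 by rewrite invr_ge0 ltW.
have d2i : 0 <= (d / 2)^-1 by rewrite invr_ge0 divr_ge0 ?ltW.
have K0 : 0 <= K by rewrite addr_ge0 ?mulr_ge0 ?exprn_ge0.
apply: (@cder_quadratic _ _ _ (d / 2) C); first by rewrite divr_gt0.
  exact: (mulr_ge0 (ler0n _ 2) (mulr_ge0 K0 rmean_normc_ge0)).
move=> z zd; have zr := near_r zd; have zd' := near_w zd.
set e := z - w.
have -> : (fun t => u t * k z t ^+ 2) = fun t => u t * k w t ^+ 2 +
   (e * (u t * (2 * k w t ^+ 3)) +
    e ^+ 2 * (u t * (k w t ^+ 2 * k z t ^+ 2 + 2 * k w t ^+ 3 * k z t))).
  apply/funext => t; have := circle_sub_neq0 t zr; have := circle_sub_neq0 t wr.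
  by rewrite /e => h1 h2; field; rewrite h1 h2.
have c1 := ck wr; have c2 := ck zr.
have c3 : rcontinuous (fun t => k w t ^+ 2) by exact: cM.
have c3' : rcontinuous (fun t => k z t ^+ 2) by exact: cM.
have c8 : rcontinuous (fun t => 2 * k w t ^+ 3) by apply: (cM (cc 2)); apply: cM.
have c4 : rcontinuous (fun t => k w t ^+ 2 * k z t ^+ 2 + 2 * k w t ^+ 3 * k z t).
  by apply: cD; exact: cM.
have c5 := cM cu c8; have c6 := cM cu c4; have c7 := cM cu c3.
rewrite cmeanD//; last by apply: cD; apply: cM => //; exact: cc.
rewrite cmeanD; [|exact: (cM (cc _) c5)|exact: (cM (cc _) c6)].
rewrite !cmeanZ//.
have -> : forall a b c : R[i], a + (e * b + e ^+ 2 * c) - a - b * e = e ^+ 2 * c by move=> *; ring.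
rewrite normcM normcX mulrC ler_wpM2r ?exprn_ge0//.
apply: transform_bound => // t.
have kw := kernel_bound t wr.
have kz : normc ((circle r t - z)^-1) <= (d / 2)^-1.
  apply: (le_trans (kernel_bound t zr)).
  by rewrite lef_pV2 ?posrE ?subr_gt0 ?divr_gt0.
set A := (circle r t - w)^-1 in kw *; set B := (circle r t - z)^-1 in kz *.
have n2 : normc (2 : R[i]) = 2.
  by rewrite -[2]/(2%:R) -(rmorph_nat (real_complex R)) normc_real ger0_norm.
apply: (le_trans (ler_normcD _ _)).
rewrite (normcM (A ^+ 2) (B ^+ 2)) (normcM (2 * A ^+ 3) B) (normcM 2 (A ^+ 3)) !normcX n2.
have hA n : normc A ^+ n <= d^-1 ^+ n by apply: lerXn2r; rewrite ?nnegrE.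
have hB n : normc B ^+ n <= (d / 2)^-1 ^+ n by apply: lerXn2r; rewrite ?nnegrE.
apply: lerD; first by apply: ler_pM; rewrite ?exprn_ge0.
apply: ler_pM; rewrite ?mulr_ge0 ?exprn_ge0//.
by apply: ler_pM; rewrite ?exprn_ge0.
Qed.

End Transform.

Lemma hol_derive_formula f rho r w : hol f rho -> 0 < r < rho -> normc w < r ->
  cder f w (cmean (fun t => f (circle r t) * circle r t * ((circle r t - w)^-1) ^+ 2)).
Proof.
move=> hf rI wr; have cf : rcontinuous (fun t => f (circle r t) * circle r t).
  by move=> t; apply: gcontM; [exact: rcont_hol_circle hf rI|exact: rcont_circle].
apply: (@gder_near R R[i] id _ _ _ _ (r - normc w)); last exact: (cder_transform1 cf wr).
  by rewrite subr_gt0.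
move=> z /= zw; rewrite -(cauchy_formula hf rI)//.
by have := ler_distc z w; move: zw; lra.
Qed.

(** By the Cauchy formula the derivative is again a Cauchy transform, of the squared kernel. *)
Lemma hol_derive1 f rho : hol f rho -> hol (derive1 f) rho.
Proof.
move=> hf w wr; have [r /andP[wr' rr]] := exists_between wr.
have rI : 0 < r < rho by rewrite rr (le_lt_trans (normc_ge0 w)).
have cf : rcontinuous (fun t => f (circle r t) * circle r t).
  by move=> t; apply: gcontM; [exact: rcont_hol_circle hf rI|exact: rcont_circle].
eexists; apply: (@gder_near R R[i] id _ _ _ _ (r - normc w));
  last exact: (cder_transform2 cf wr').
  by rewrite subr_gt0.
move=> z /= zw; apply/esym/derive1_cder/(hol_derive_formula hf rI).
by have := ler_distc z w; move: zw; lra.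
Qed.

Lemma hol_cder f rho z : hol f rho -> normc z < rho -> cder f z (derive1 f z).
Proof. by move=> hf /hf[l dl]; rewrite (derive1_cder dl). Qed.

Lemma hol_bound f rho r w B : hol f rho -> 0 < r < rho -> normc w < r -> 0 <= B ->
  (forall z, normc z = r -> normc (f z) <= B) ->
  normc (f w) <= 2 * (B * r / (r - normc w)).
Proof.
move=> hf rI wr B0 fB; have /andP[r0 _] := rI.
rewrite (cauchy_formula hf rI wr); apply: normc_cmean_cst.
  move=> t; apply: gcontM; last exact: rcont_kernel.
  by apply: gcontM; [exact: rcont_hol_circle hf rI|exact: rcont_circle].
move=> t; rewrite normcM (normcM (f _)) normc_circle ?(ltW r0)//.
apply: ler_pM; rewrite ?mulr_ge0 ?(ltW r0)//; last exact: kernel_bound.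
by rewrite ler_pM2r// fB// normc_circle ?(ltW r0).
Qed.

Lemma hol_derive_bound f rho r w B : hol f rho -> 0 < r < rho -> normc w < r -> 0 <= B ->
  (forall z, normc z = r -> normc (f z) <= B) ->
  normc (derive1 f w) <= 2 * (B * r / (r - normc w) ^+ 2).
Proof.
move=> hf rI wr B0 fB; have /andP[r0 _] := rI.
rewrite (derive1_cder (hol_derive_formula hf rI wr)); apply: normc_cmean_cst.
  move=> t; have K := @rcont_kernel R r w t wr.
  apply: gcontM; last exact: (gcontM K K).
  by apply: gcontM; [exact: rcont_hol_circle hf rI|exact: rcont_circle].
move=> t; rewrite normcM (normcM (f _)) normc_circle ?(ltW r0)// normcX.
apply: ler_pM; rewrite ?mulr_ge0 ?exprn_ge0 ?(ltW r0)//.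
  by rewrite ler_pM2r// fB// normc_circle ?(ltW r0).
rewrite -exprVn ler_pXn2r ?nnegrE ?invr_ge0 ?subr_ge0 ?(ltW wr)//.
exact: kernel_bound.
Qed.

Lemma hol_div0 f rho : 0 < rho -> hol f rho ->
  exists2 g, hol g rho & forall z, normc z < rho -> f z = f 0 + z * g z.
Proof.
move=> rho0 hf; pose g z := if z == 0 then derive1 f 0 else (f z - f 0) / z.
have gE z : normc z < rho -> f z = f 0 + z * g z.
  move=> _; rewrite /g; case: eqVneq => [->|z0]; first by rewrite mul0r addr0.
  by rewrite mulrC divfK// addrC subrK.
exists g => // z zr; have [->|z0] := eqVneq z 0; last first.
  have [l dl] := hf z zr; eexists.
  apply: (gder_near (r := normc z)); last first.
  - exact: (cderM (cderB dl (cder_cst (f 0) z)) (cderV (cder_id z) z0)).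
  - move=> u uz; rewrite /g ifN//; apply: contraTneq uz => -> /=.
    by rewrite sub0r normcN ltxx.
  - by rewrite normc_gt0.
have [r rI] := exists_between rho0; have /andP[r0 rr] := rI.
have cf : rcontinuous (fun t => f (circle r t)).
  by move=> t; exact: rcont_hol_circle hf rI.
have n0 : normc (0 : R[i]) < r by rewrite normc0.
eexists; apply: (gder_near (r := r) r0); last exact: (cder_transform1 cf n0).
move=> u /=; rewrite subr0 => ur; rewrite /g; case: eqVneq => [->|u0].
  rewrite (derive1_cder (hol_derive_formula hf rI n0)).
  apply: eq_cmean => t; rewrite subr0; have := circle_neq0 t r0 => c0.
  by field.
apply: (mulfI u0); rewrite mulrC [RHS]mulrC divfK//.
rewrite (cauchy_formula hf rI ur) (cauchy_formula hf rI n0).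
have ck v t : normc v < r -> rcont (fun t => f (circle r t) * circle r t / (circle r t - v)) t.
  move=> zr'; apply: gcontM; last exact: rcont_kernel.
  exact: (gcontM (cf t) (rcont_circle r t)).
rewrite -[- cmean _]mulN1r -(cmeanZ (-1)); last by move=> t; exact: ck.
rewrite -cmeanD; last first.
- by move=> t; apply: gcontM; [exact: gcont_cst|exact: ck].
- by move=> t; exact: ck.
rewrite mulrC -(cmeanZ u); last first.
  by move=> t; exact: (gcontM (cf t) (rcont_kernel t ur)).
apply: eq_cmean => t; have h1 := circle_neq0 t r0; have h2 := circle_sub_neq0 t ur.
by rewrite subr0; field; rewrite h1 h2.
Qed.

Lemma exists_pow_small (q e : R) : 0 <= q < 1 -> 0 < e -> exists n, q ^+ n < e.
Proof.
move=> /andP[q0 q1] e0.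
have : (q ^+ n @[n --> \oo] --> (0 : R))%classic by apply: cvg_expr; rewrite ger0_norm.
move=> /cvgrPdist_lt/(_ e e0)[n _ /(_ n (leqnn n))] /=.
by rewrite sub0r normrN ger0_norm ?exprn_ge0//; exists n.
Qed.

(** Otherwise [f] could be divided by [z] indefinitely, and the Cauchy formula on a fixed
   circle bounds |f(z0)| by a constant times (|z0|/r)^m for all m. *)
Lemma hol_order0 f rho : 0 < rho -> hol f rho ->
  (exists2 z, normc z < rho & f z != 0) ->
  exists m g, [/\ hol g rho, g 0 != 0 & forall z, normc z < rho -> f z = z ^+ m * g z].
Proof.
move=> rho0 hf [z0 z0r fz0]; apply: contrapT => H.
have D m : exists2 g, hol g rho & forall z, normc z < rho -> f z = z ^+ m * g z.
  elim: m => [|m [g hg gE]]; first by exists f => // z _; rewrite expr0 mul1r.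
  have [g0|g0] := eqVneq (g 0) 0; last by case: H; exists m, g.
  have [g' hg' g'E] := hol_div0 rho0 hg; exists g' => // z zr.
  by rewrite gE// g'E// g0 add0r exprSr mulrA.
have [r /andP[zr rr]] := exists_between z0r.
have r0 : 0 < r by exact: (le_lt_trans (normc_ge0 z0) zr).
have rI : 0 < r < rho by rewrite r0.
pose B := rmean (fun t => normc (f (circle r t))).
have cf : rcontinuous (fun t => f (circle r t)) by move=> t; exact: rcont_hol_circle hf rI.
pose C := 2 * (r / (r - normc z0) * B).
have C0 : 0 <= C.
  rewrite mulr_ge0// mulr_ge0 ?divr_ge0 ?subr_ge0 ?(ltW r0) ?(ltW zr)//.
  exact: (rmean_normc_ge0 cf).
have bnd m : normc (f z0) <= C * (normc z0 / r) ^+ m.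
  have [g hg gE] := D m.
  rewrite gE// normcM normcX expr_div_n [X in _ <= X]mulrC -mulrA.
  rewrite ler_wpM2l ?exprn_ge0//.
  rewrite (cauchy_formula hg rI zr).
  have -> : (r ^+ m)^-1 * C = 2 * ((r ^+ m)^-1 * r / (r - normc z0) * B) by rewrite /C; ring.
  rewrite -rmeanZ; last exact: rcont_normc.
  apply: normc_cmean.
  - move=> t; apply: gcontM; last exact: rcont_kernel.
    by apply: gcontM; [exact: rcont_hol_circle hg rI|exact: rcont_circle].
  - by move=> t; apply: cvgMr; exact: (rcont_normc cf).
  move=> t; rewrite normcM (normcM (g _)) gE ?normc_circle ?(ltW r0)//.
  rewrite normcM normcX normc_circle ?(ltW r0)//.
  have -> : forall a b : R, (r ^+ m)^-1 * r * a * (r ^+ m * b) = b * r * a.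
    by move=> a b; field; rewrite expf_neq0 ?gt_eqF.
  by rewrite ler_wpM2l ?mulr_ge0 ?(ltW r0)//; exact: kernel_bound.
have fpos : 0 < normc (f z0) / (C + 1) by rewrite divr_gt0 ?normc_gt0// ltr_wpDl.
have [|n Hn] := exists_pow_small (q := normc z0 / r) _ fpos.
  by rewrite ltr_pdivrMr// mul1r zr andbT; apply: divr_ge0; [exact: normc_ge0|exact: ltW].
have := bnd n; move: Hn; rewrite ltr_pdivlMr ?ltr_wpDl// => h1 h2.
have : 0 <= (normc z0 / r) ^+ n by apply/exprn_ge0/divr_ge0; [exact: normc_ge0|exact: ltW].
by move: h1 h2; lra.
Qed.

End Regularity.

(** * Logarithms of zero-free functions *)

Section Logarithm.
Variable R : realType.
Implicit Types (r x y a b rho B : R) (z w p : R[i]) (f g h : R[i] -> R[i]).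

Lemma cisD a b : cis (a + b) = cis a * cis b :> R[i].
Proof. by apply: complex_eqP; rewrite ?cReM ?cImM/= ?cosD ?sinD//; ring. Qed.

Lemma cexpD z w : cexp (z + w) = cexp z * cexp w.
Proof. by rewrite /cexp cReD cImD expRD cisD rmorphM/=; ring. Qed.

Lemma cexp0 : cexp 0 = 1 :> R[i].
Proof. by rewrite /cexp/= expR0 /cis cos0 sin0 mul1r. Qed.

Lemma cexp_neq0 z : cexp z != 0.
Proof. by rewrite -normc_gt0 normc_cexp expR_gt0. Qed.

Lemma cexpN z : cexp (- z) = (cexp z)^-1.
Proof. by apply: (mulfI (cexp_neq0 z)); rewrite -cexpD subrr cexp0 divff// cexp_neq0. Qed.

(** The exponential is given as the product of the real exponential of the real part and of
   a point of the unit circle; the two real derivatives are combined by hand. *)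
Lemma cder_cexp0 : cder (@cexp R) 0 1.
Proof.
move=> e e0.
have e4 : 0 < e / 4 by rewrite divr_gt0// ltr0n.
have e4' : 0 < e / 4 / expR 1 by rewrite divr_gt0// expR_gt0.
have [d1 d10 H1] := rder_cis (0 : R) e4'.
have [d2 d20 H2] := iffLR (is_derive_epsdelta _ _ _) (is_derive_expR (0 : R)) _ e4.
pose d3 := Num.min 1 (e / 4).
exists (Num.min (Num.min d1 d2) d3).
  by rewrite !lt_min d10 d20 ltr01 e4.
move=> h; rewrite /= subr0 cexp0 mul1r !lt_min => /andP[/andP[hd1 hd2] /andP[h1 h4]].
set a := complex.Re h; set b := complex.Im h.
have ah : `|a| <= normc h by exact: Re_le_normc.
have bh : `|b| <= normc h by exact: Im_le_normc.
have A : `|expR a - 1 - a| <= e / 4 * `|a|.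
  by have := H2 a; rewrite expR0 subr0 mul1r; apply; exact: le_lt_trans ah hd2.
have B : normc (cis b - 1 - 'i * b%:C) <= e / 4 / expR 1 * `|b|.
  have := H1 b; rewrite normc_realB subr0.
  have -> : cis 0 = 1 :> R[i] by rewrite /cis cos0 sin0.
  have -> : (0 : R)%:C = 0 by [].
  by rewrite mulr1 subr0; apply; exact: le_lt_trans bh hd1.
have ea : `|expR a - 1| <= e / 2.
  have -> : expR a - 1 = (expR a - 1 - a) + a by ring.
  apply: (le_trans (ler_normD _ _)).
  have : e / 4 * `|a| <= e / 4 * 1.
    by rewrite ler_pM2l// (le_trans ah)// ltW.
  have := le_trans ah (ltW h4); move: A; lra.
have hE : h = a%:C + 'i * b%:C.
  by apply: complex_eqP; rewrite ?cReD ?cImD ?cReM ?cImM/= /a /b; ring.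
have -> : cexp h - 1 - h = (expR a)%:C * (cis b - 1 - 'i * b%:C) +
   (expR a - 1 - a)%:C + (expR a - 1)%:C * ('i * b%:C).
  rewrite {2}hE /cexp -/a -/b !rmorphB/= rmorph1; ring.
have ea1 : expR a <= expR 1.
  by rewrite ler_expR (le_trans (ler_norm _))// (le_trans ah)// ltW.
apply: (le_trans (ler_normcD _ _)).
have -> : e * normc h = e / 4 * normc h + e / 4 * normc h + e / 2 * normc h by field.
apply: lerD.
  apply: (le_trans (ler_normcD _ _)); apply: lerD.
    rewrite normcM normc_real ger0_norm ?expR_ge0//.
    apply: (@le_trans _ _ (expR 1 * (e / 4 / expR 1 * `|b|))).
      by apply: ler_pM; rewrite ?expR_ge0 ?normc_ge0.
    rewrite mulrA [expR 1 * _]mulrC divfK ?gt_eqF ?expR_gt0//.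
    by rewrite ler_pM2l.
  rewrite normc_real; apply: (le_trans A); by rewrite ler_pM2l.
rewrite normcM normc_real normcM normc_i mul1r normc_real.
by apply: ler_pM.
Qed.

Lemma cder_cexp z : cder (@cexp R) z (cexp z).
Proof.
have D : cder (fun w => w + (- z)) z 1.
  by have := gderD (cder_id z) (cder_cst (- z) z); rewrite addr0.
have := gder_comp D (f := @cexp R) (l := 1); rewrite subrr mulr1.
move=> /(_ cder_cexp0) /(cderZ (cexp z)); rewrite mulr1.
congr (cder _ z _); apply/funext => w /=.
by rewrite -cexpD addrC subrK.
Qed.

Lemma disc_mean_value f f' rho B z w :
  (forall u, normc u < rho -> cder f u (f' u)) ->
  (forall u, normc u < rho -> normc (f' u) <= B) -> normc z < rho -> normc w < rho ->
  normc (f z - f w) <= 2 * B * normc (z - w).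
Proof.
move=> df fB zr wr.
have inD t : 0 <= t <= 1 -> normc (w + t%:C * (z - w)) < rho.
  move=> /andP[t0 t1].
  have -> : w + t%:C * (z - w) = (1 - t)%:C * w + t%:C * z by rewrite rmorphB rmorph1; ring.
  apply: (le_lt_trans (ler_normcD _ _)).
  rewrite !normcM !normc_real !ger0_norm ?subr_ge0//.
  have [->|tn0] := eqVneq t 0; first by rewrite subr0 mul0r addr0 mul1r.
  have tp : 0 < t by rewrite lt_def tn0.
  have h1 : t * normc z < t * rho by rewrite ltr_pM2l.
  have h2 : (1 - t) * normc w <= (1 - t) * rho by rewrite ler_wpM2l ?subr_ge0// ltW.
  by move: h1 h2; lra.
pose G (t : R) := f (w + t%:C * (z - w)).
have := @mean_value_curve R G (fun t => f' (w + t%:C * (z - w)) * (z - w)) 0 1 (B * normc (z - w)) ler01.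
rewrite /G rmorph1 mul1r rmorph0 mul0r addr0 [w + _]addrC subrK subr0 mulr1 mulrA.
apply=> t tI.
  exact: (gder_comp (rder_affine w (z - w) t) (df _ (inD t tI))).
by rewrite normcM ler_wpM2r// fB// inD.
Qed.

Lemma zero_derive_const f rho z :
  (forall u, normc u < rho -> cder f u 0) -> normc z < rho -> f z = f 0.
Proof.
move=> df zr; apply/eqP; rewrite -subr_eq0 -normc_eq0 eq_le normc_ge0 andbT.
have r0 : normc (0 : R[i]) < rho by rewrite normc0 (le_lt_trans _ zr).
have := @disc_mean_value f (fun=> 0) rho 0 z 0 df _ zr r0.
by rewrite mulr0 mul0r; apply=> u _; rewrite normc0.
Qed.

(** A primitive h of f'/f exists on a smaller disc, and f exp(-h) has zero derivative. *)
Lemma hol_log f rho r : hol f rho -> r < rho -> (forall z, normc z < rho -> f z != 0) ->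
  exists h, [/\ (forall z, normc z < r -> cder h z (derive1 f z / f z)) &
    forall z, normc z < r -> ln (normc (f z)) = complex.Re (h z)].
Proof.
move=> hf rr fn0.
have [r0|r0] := leP r 0.
  by exists id; split=> z zr; have := lt_le_trans zr r0; rewrite ltNge normc_ge0.
have dq z : normc z < rho -> exists l, cder (fun z => derive1 f z / f z) z l.
  move=> zr; have [l dl] := hol_derive1 hf zr.
  by eexists; apply: (cderM dl (cderV (hol_cder hf zr) (fn0 z zr))).
have [h0 dh0] : exists h0, forall z, normc z < r -> cder h0 z (derive1 f z / f z).
  apply: (@primitive_disc R _ r rho 0 rr) => z zr; last by move=> _; exact: dq.
  by have [l] := dq z zr; exact: gder_cont.
pose P z := f z * cexp (- h0 z).
have PE z : normc z < r -> P z = P 0.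
  apply: zero_derive_const => u ur; have uro := lt_trans ur rr.
  have := cderM (hol_cder hf uro) (gder_comp (cderN (dh0 u ur)) (cder_cexp _)).
  congr (cder _ _ _); rewrite /=.
  by have := fn0 u uro => n0; field.
have z0r : normc (0 : R[i]) < r by rewrite normc0.
have P0 : P 0 != 0 by rewrite mulf_neq0 ?cexp_neq0 ?fn0// (lt_trans z0r).
exists (fun z => h0 z + (ln (normc (P 0)))%:C); split=> z zr.
  by have := gderD (dh0 z zr) (cder_cst (ln (normc (P 0)))%:C z); rewrite addr0.
have fE : f z = P 0 * cexp (h0 z).
  by rewrite -(PE z zr) /P cexpN divfK// cexp_neq0.
rewrite fE normcM lnM ?posrE ?normc_gt0 ?cexp_neq0//.
by rewrite normc_cexp expRK addrC cReD.
Qed.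

Section Zero_free.
Variables (f : R[i] -> R[i]) (rho r : R).
Hypotheses (hf : hol f rho) (rI : 0 < r < rho).
Hypothesis fn0 : forall z, normc z < rho -> f z != 0.

Let r0 : 0 < r. Proof. by case/andP : rI. Qed.
Let rr : r < rho. Proof. by case/andP : rI. Qed.

Let L t := ln (normc (f (circle r t))).

Let log_setup : exists s h, [/\ r < s < rho, hol h s,
  (forall z, normc z < s -> cder h z (derive1 f z / f z)) &
  forall z, normc z < s -> ln (normc (f z)) = complex.Re (h z)].
Proof.
have [s /andP[rs sr]] := exists_between rr.
have [h [dh hE]] := hol_log hf sr fn0; exists s, h; split => //; first by rewrite rs.
by move=> z zs; exists (derive1 f z / f z); exact: dh.
Qed.

Lemma ln_circle_cont : continuous L.
Proof.
have [s [h [/andP[rs sr] hh _ hE]]] := log_setup.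
rewrite (_ : L = fun t => complex.Re (h (circle r t))).
  by apply: ccont_re => t; apply: (rcont_hol_circle _ hh); rewrite r0.
by apply/funext => t; rewrite /L hE// normc_circle ?ltW.
Qed.

(** The logarithm of |f| is the real part of a holomorphic function. *)
Lemma jensen_zero_free : rmean L = ln (normc (f 0)).
Proof.
have [s [h [/andP[rs sr] hh _ hE]]] := log_setup.
rewrite hE ?normc0 ?(lt_trans r0)//.
have rs' : 0 < r < s by rewrite r0.
rewrite -(mean_value_property hh rs') /=.
by apply: eq_rmean => t; rewrite /L hE// normc_circle ?ltW.
Qed.

Lemma log_abs_cont : continuous (fun t => `|L t|).
Proof. by move=> t; apply: cvg_norm; exact: ln_circle_cont. Qed.

(** The Schwarz formula: a holomorphic [h] is determined, up to an imaginary constant, by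
   its real part on a circle. Add the Cauchy formula for [h] and [conj_kernel_mean]. *)
Lemma schwarz_setup : exists s h, [/\ r < s < rho, hol h s,
  (forall z, normc z < s -> cder h z (derive1 f z / f z)),
  (forall z, normc z < s -> ln (normc (f z)) = complex.Re (h z)) &
  forall z, normc z < r -> h z =
   2 * cmean (fun t => (L t)%:C * circle r t * (circle r t - z)^-1) - conjc (h 0)].
Proof.
have [s [h [/andP[rs sr] hh dh hE]]] := log_setup.
have rs' : 0 < r < s by rewrite r0.
exists s, h; split => //; first by rewrite rs.
move=> z zr.
rewrite -(conj_kernel_mean hh rs' zr) (cauchy_formula hh rs' zr).
have ch : rcontinuous (fun t => h (circle r t)) by move=> t; exact: rcont_hol_circle hh rs'.
have ck : rcontinuous (fun t => circle r t * (circle r t - z)^-1).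
  by move=> t; apply: gcontM; [exact: rcont_circle|exact: rcont_kernel].
have cL : rcontinuous (fun t => (L t)%:C).
  have := ln_circle_cont => c t e e0.
  have /cvgrPdist_lt/(_ e e0)/nbhs_ballP[d d0 Hd] := c t.
  exists d => // u; rewrite !normc_realB => ud; rewrite distrC; apply: Hd.
  by rewrite /ball/= distrC.
have cLk : rcontinuous (fun t => (L t)%:C * circle r t * (circle r t - z)^-1).
  move=> t; apply: gcontM; last exact: rcont_kernel.
  exact: (gcontM (cL t) (rcont_circle r t)).
have chk : rcontinuous (fun t => h (circle r t) * circle r t * (circle r t - z)^-1).
  move=> t; apply: gcontM; last exact: rcont_kernel.
  exact: (gcontM (ch t) (rcont_circle r t)).
rewrite -cmeanZ//.
set A := cmean _; set B := cmean _; set C := cmean _.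
suff -> : B = A + C by rewrite addrK.
have -> : C = cmean (fun t => 2 * ((L t)%:C * circle r t * (circle r t - z)^-1) +
   (-1) * (h (circle r t) * circle r t * (circle r t - z)^-1)).
  apply: eq_cmean => t; rewrite /L hE ?normc_circle ?(ltW r0)//.
  have -> : 2 * ((complex.Re (h (circle r t)))%:C * circle r t / (circle r t - z)) =
    (2%:R * (complex.Re (h (circle r t)))%:C) * (circle r t / (circle r t - z)) by ring.
  by rewrite -addcJ; ring.
rewrite /B /A cmeanD; last first.
- by move=> t; apply: gcontM; [exact: gcont_cst|exact: chk].
- by move=> t; apply: gcontM; [exact: gcont_cst|exact: cLk].
by rewrite [cmean (fun t => -1 * _)]cmeanZ// mulN1r [in RHS]addrC subrK.
Qed.

Let A := rmean (fun t => `|L t|).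

Let rcont_L : rcontinuous (fun t => (L t)%:C * circle r t).
Proof.
have cL : rcontinuous (fun t => (L t)%:C).
  have := ln_circle_cont => c t e e0.
  have /cvgrPdist_lt/(_ e e0)/nbhs_ballP[d d0 Hd] := c t.
  exists d => // u; rewrite !normc_realB => ud; rewrite distrC; apply: Hd.
  by rewrite /ball/= distrC.
by move=> t; exact: (gcontM (cL t) (rcont_circle r t)).
Qed.

Lemma log_abs_mean_ge : `|ln (normc (f 0))| <= A.
Proof.
rewrite -jensen_zero_free ler_norml -rmeanN; last exact: log_abs_cont.
apply/andP; split; apply: rmean_le.
- by move=> t; apply: cvgN; exact: log_abs_cont.
- exact: ln_circle_cont.
- by move=> t; rewrite lerNl -normrN ler_norm.
- exact: ln_circle_cont.
- exact: log_abs_cont.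
- by move=> t; exact: ler_norm.
Qed.

(** Read off from the Schwarz formula: the mean of |ln |f|| over a circle controls ln |f|
   from both sides inside, with a factor that is linear in the inverse distance to the circle. *)
Lemma log_abs_bound z : normc z < r -> `|ln (normc (f z))| <= 5 * (r / (r - normc z)) * A.
Proof.
move=> zr; have [s [h [/andP[rs sr] hh dh hE hS]]] := schwarz_setup.
have zs := lt_trans zr rs; have s0 := lt_trans r0 rs.
have A0 : 0 <= A by apply: le_trans log_abs_mean_ge.
have d0 : 0 < r - normc z by rewrite subr_gt0.
have H : normc (h z + conjc (h 0)) <= 4 * (r / (r - normc z)) * A.
  rewrite (hS z zr) subrK normcM.
  have -> : normc (2 : R[i]) = 2.
    by rewrite -[2]/(2%:R) -(rmorph_nat (real_complex R)) normc_real ger0_norm.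
  have -> : 4 * (r / (r - normc z)) * A = 2 * (2 * (r / (r - normc z) * A)) by ring.
  rewrite ler_pM2l// -rmeanZ; last exact: log_abs_cont.
  apply: normc_cmean.
  - by move=> t; apply: gcontM; [exact: rcont_L|exact: rcont_kernel].
  - by move=> t; apply: cvgMr; exact: log_abs_cont.
  move=> t; rewrite normcM (normcM (_%:C)) normc_circle ?(ltW r0)// normc_real.
  rewrite -mulrA mulrC ler_wpM2r// ler_pM2l//; exact: kernel_bound.
have : `|complex.Re (h z) + complex.Re (h 0)| <= 4 * (r / (r - normc z)) * A.
  apply: le_trans H; apply: le_trans (Re_le_normc _).
  by rewrite cReD; case: (h 0).
rewrite -!hE ?normc0//.
have := log_abs_mean_ge; set u := ln _; set v := ln _ => h1 h2.
have -> : v = (v + u) - u by ring.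
apply: (le_trans (ler_normB _ _)).
have q1 : 1 <= r / (r - normc z) by rewrite ler_pdivlMr// mul1r gerBl normc_ge0.
have : A <= r / (r - normc z) * A by rewrite ler_peMl.
by move: h1 h2; lra.
Qed.

(** The same formula, differentiated. *)
Lemma log_derive_bound z : normc z < r ->
  normc (derive1 f z / f z) <= 4 * (r / (r - normc z) ^+ 2) * A.
Proof.
move=> zr; have [s [h [/andP[rs sr] hh dh hE hS]]] := schwarz_setup.
have d0 : 0 < r - normc z by rewrite subr_gt0.
have D : cder h z (2 * cmean (fun t => (L t)%:C * circle r t * (circle r t - z)^-1 ^+ 2)).
  have D0 := cderB (cderZ 2 (cder_transform1 rcont_L zr)) (cder_cst (conjc (h 0)) z).
  rewrite subr0 in D0; apply: (gder_near d0 _ D0) => u /= uz; rewrite -hS//.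
  by have := ler_distc u z; move: uz; lra.
rewrite (cder_unique (dh z (lt_trans zr rs)) D) normcM.
have -> : normc (2 : R[i]) = 2.
  by rewrite -[2]/(2%:R) -(rmorph_nat (real_complex R)) normc_real ger0_norm.
have -> : 4 * (r / (r - normc z) ^+ 2) * A = 2 * (2 * (r / (r - normc z) ^+ 2 * A)) by ring.
rewrite ler_pM2l// -rmeanZ; last exact: log_abs_cont.
have ck t := @rcont_kernel R r z t zr.
apply: normc_cmean.
- by move=> t; apply: (gcontM (rcont_L t)); exact: (gcontM (ck t) (ck t)).
- by move=> t; apply: cvgMr; exact: log_abs_cont.
move=> t; rewrite normcM (normcM (_%:C)) normc_circle ?(ltW r0)// normc_real normcX.
rewrite -mulrA mulrC ler_wpM2r// ler_pM2l// -exprVn.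
by apply: lerXn2r; rewrite ?nnegrE ?invr_ge0 ?(ltW d0)//; exact: kernel_bound.
Qed.

End Zero_free.

(** For |w| < r the linear factor has a zero inside the disc; but on the circle |z - w| equals
   r / |g(z)| for the zero-free function g of [reflected_kernel], to which [jensen_zero_free]
   applies. *)
Lemma jensen_factor r w : 0 < r -> normc w != r ->
  continuous (fun t => ln (normc (circle r t - w))) /\
  rmean (fun t => ln (normc (circle r t - w))) = ln (Num.max r (normc w)).
Proof.
move=> r0; rewrite neq_lt => /orP[wr|rw]; last first.
  have hF : hol (fun z => z - w) (normc w).
    by move=> z _; eexists; exact: cderB (cder_id z) (cder_cst w z).
  have n0 z : normc z < normc w -> z - w != 0.
    by move=> zw; rewrite subr_eq0; apply: contraTneq zw => ->; rewrite ltxx.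
  have rI : 0 < r < normc w by rewrite r0.
  split; first exact: (ln_circle_cont hF rI n0).
  by rewrite (jensen_zero_free hF rI n0) sub0r normcN max_r// ltW.
have [g [s [rs hg g1 gn0 gE]]] := reflected_kernel wr.
have rI : 0 < r < s by rewrite r0.
have E : (fun t => ln (normc (circle r t - w))) =
  fun t => ln r + - ln (normc (g (circle r t))).
  apply/funext => t; have cw := circle_sub_neq0 t wr.
  have cE : circle r t = conjc (g (circle r t)) * (circle r t - w).
    by rewrite -gE divfK.
  have gp : 0 < normc (g (circle r t)).
    by rewrite normc_gt0 gn0// normc_circle ?ltW.
  have -> : ln r = ln (normc (g (circle r t)) * normc (circle r t - w)).
    by rewrite -normc_conj -normcM -cE normc_circle ?ltW.
  by rewrite lnM ?posrE// ?normc_gt0// [ln _ + ln _]addrC addrK.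
have cl := ln_circle_cont hg rI gn0.
have cN : continuous (fun t => - ln (normc (g (circle r t)))).
  by move=> t; apply: cvgN; exact: cl.
rewrite E; split; first by move=> t; apply: cvgD; [exact: cvg_cst|exact: cN].
rewrite rmeanD//; last by move=> t; exact: cvg_cst.
rewrite rmean_cst rmeanN// (jensen_zero_free hg rI gn0) g1 normc1 ln1 subr0.
by rewrite max_l// ltW.
Qed.

End Logarithm.

(** * Entire functions *)

Section Entire.
Variable R : realType.
Implicit Types (r x y a b rho B : R) (z w p c : R[i]) (f g h : R[i] -> R[i]).

(** [entire] unfolded into existence of an epsilon-delta derivative, the form that the
   calculus above consumes. *)
Definition ent f := forall z, exists l, cder f z l.

Lemma entP f : ent f <-> entire f.
Proof. by split=> H z; apply/cderP; exact: H. Qed.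

Lemma ent_hol f rho : ent f -> hol f rho.
Proof. by move=> hf z _. Qed.

Lemma hol_ent f : (forall rho, hol f rho) -> ent f.
Proof. by move=> hf z; apply: (hf (normc z + 1)); rewrite ltrDl. Qed.

Lemma ent_cder f z : ent f -> cder f z (derive1 f z).
Proof. by move=> hf; have [l dl] := hf z; rewrite (derive1_cder dl). Qed.

Lemma ent_cont f z : ent f -> ccont f z.
Proof. by move=> hf; exact: gder_cont (ent_cder z hf). Qed.

Lemma ent_derive1 f : ent f -> ent (derive1 f).
Proof. by move=> hf; apply: hol_ent => rho; apply/hol_derive1/ent_hol. Qed.

Lemma ent_derive1n f n : ent f -> ent (derive1n n f).
Proof.
by move=> hf; elim: n => [|n IH]; rewrite ?derive1n0// derive1nS; exact: ent_derive1.
Qed.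

Lemma ent_cst c : ent (fun=> c).
Proof. by move=> z; exists 0; exact: cder_cst. Qed.

Lemma ent_id : ent id.
Proof. by move=> z; exists 1; exact: cder_id. Qed.

Lemma entD f g : ent f -> ent g -> ent (fun z => f z + g z).
Proof. by move=> hf hg z; eexists; exact: gderD (ent_cder z hf) (ent_cder z hg). Qed.

Lemma entM f g : ent f -> ent g -> ent (fun z => f z * g z).
Proof. by move=> hf hg z; eexists; exact: cderM (ent_cder z hf) (ent_cder z hg). Qed.

Lemma entB f g : ent f -> ent g -> ent (fun z => f z - g z).
Proof. by move=> hf hg z; eexists; exact: cderB (ent_cder z hf) (ent_cder z hg). Qed.

Lemma cder_shift f c z l : cder f (c + z) l -> cder (fun u => f (c + u)) z l.
Proof.
move=> H; have D : cder (fun u => c + u) z 1.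
  by have := gderD (cder_cst c z) (cder_id z); rewrite add0r.
by have := gder_comp D H; rewrite mulr1.
Qed.

Lemma ent_shift f c : ent f -> ent (fun z => f (c + z)).
Proof. by move=> hf z; eexists; exact: cder_shift (ent_cder _ hf). Qed.

(** The local order of vanishing, extended to a global factorization because the quotient
   is defined explicitly off the zero. *)
Lemma ent_factor f w : ent f -> (exists z, f z != 0) ->
  exists m g, [/\ ent g, g w != 0 & forall z, f z = (z - w) ^+ m * g z].
Proof.
move=> hf [z0 fz0]; pose F z := f (w + z); pose rho := normc (z0 - w) + 1.
have rho0 : 0 < rho by rewrite ltr_wpDl.
have hF : hol F rho by apply/ent_hol/ent_shift.
have [|m [g [hg g0 gE]]] := hol_order0 rho0 hF.
  by exists (z0 - w); rewrite /rho ?ltrDl// /F addrC subrK.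
pose G z := if z == w then g 0 else f z / (z - w) ^+ m.
have GE z : normc (z - w) < rho -> G z = g (z - w).
  move=> zr; rewrite /G; case: eqVneq => [->|zw]; first by rewrite subrr.
  have -> : f z = F (z - w) by rewrite /F addrC subrK.
  by rewrite gE// mulrAC divff ?mul1r// expf_neq0// subr_eq0.
exists m, G; split.
- move=> z; have [->|zw] := eqVneq z w.
    have [|l dl] := hg 0; first by rewrite normc0.
    exists l; have D : cder (fun u => - w + u) w 1.
      by have := gderD (cder_cst (- w) w) (cder_id w); rewrite add0r.
    have C := gder_comp D (f := g) (l := l); rewrite addNr mulr1 in C.
    apply: (gder_near rho0 _ (C dl)) => //= u uw.
    by rewrite GE// addrC.
  have zw0 : z - w != 0 by rewrite subr_eq0.
  have D := cderB (cder_id z) (cder_cst w z).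
  have D1 := gder_comp D (cderX m (z - w)).
  have D2 := cderV D1 (expf_neq0 m zw0).
  eexists; apply: (gder_near (r := normc (z - w)) _ _ (cderM (ent_cder z hf) D2)).
    by rewrite normc_gt0.
  move=> u /= uz; rewrite /G ifN//; apply: contraTneq uz => ->.
  by rewrite distcC ltxx.
- by rewrite /G eqxx.
- move=> z; rewrite /G; case: eqVneq => [->|zw]; last first.
    by rewrite mulrC divfK// expf_neq0// subr_eq0.
  have -> : f w = F 0 by rewrite /F addr0.
  by rewrite gE ?normc0// subrr.
Qed.

Lemma ent_isolated f w : ent f -> (exists z, f z != 0) ->
  exists2 d : R, 0 < d & forall z, 0 < normc (z - w) < d -> f z != 0.
Proof.
move=> hf nf; have [m [g [hg gw gE]]] := ent_factor w hf nf.
have [|d d0 Hd] := ent_cont w hg (e := normc (g w)).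
  by rewrite normc_gt0.
exists d => // z /andP[zw zd]; rewrite gE mulf_neq0 ?expf_neq0 -?normc_gt0//.
rewrite normc_gt0; apply/eqP => gz; have := Hd z zd.
by rewrite gz sub0r normcN ltxx.
Qed.

Lemma ent_mul_eq0 f g : ent f -> ent g -> (forall z, f z * g z = 0) ->
  (forall z, f z = 0) \/ (forall z, g z = 0).
Proof.
move=> hf hg fg; apply: contrapT => /not_orP[nf ng].
have {}nf : exists z, f z != 0.
  by move/existsNP: nf => [z /eqP]; exists z.
have {}ng : exists z, g z != 0.
  by move/existsNP: ng => [z /eqP]; exists z.
have [d d0 Hd] := ent_isolated 0 hf nf; have [d' d'0 Hd'] := ent_isolated 0 hg ng.
pose z : R[i] := (Num.min d d' / 2)%:C.
have m0 : 0 < Num.min d d' by rewrite lt_min d0.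
have zn : normc (z - 0) = Num.min d d' / 2.
  by rewrite subr0 normc_real ger0_norm// divr_ge0// ltW.
have zm : Num.min d d' / 2 < Num.min d d' by rewrite ltr_pdivrMr// ltr_pMr// ltr1n.
have h1 : f z != 0.
  by apply: Hd; rewrite zn divr_gt0//= (lt_le_trans zm)// ge_min lexx.
have h2 : g z != 0.
  by apply: Hd'; rewrite zn divr_gt0//= (lt_le_trans zm)// ge_min lexx orbT.
by have /eqP := fg z; rewrite mulf_eq0 (negbTE h1) (negbTE h2).
Qed.

Lemma ltr_01D x : 0 <= x -> 0 < 1 + x.
Proof. by move=> x0; rewrite ltr_pwDl. Qed.

Lemma ler_ln1 x y : 0 <= x -> x <= y -> ln (1 + x) <= ln (1 + y).
Proof.
move=> x0 xy; have y0 := le_trans x0 xy.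
by rewrite ler_ln ?posrE ?ltr_01D// lerD2l.
Qed.

(** The logarithm of the maximum modulus, the measure of growth used throughout; the term 1
   makes it nonnegative, monotone and subadditive under sums and products. *)
Definition logmax f r : R := sup [set x | exists2 z, normc z <= r & x = ln (1 + normc (f z))].

Lemma ent_bounded f r : ent f -> exists2 B, 0 <= B & forall z, normc z <= r -> normc (f z) <= B.
Proof.
move=> hf; have [r0|r0] := leP 0 r; last first.
  exists 0 => // z zr; have := le_lt_trans zr r0; by rewrite ltNge normc_ge0.
have rI : 0 < r + 1 < r + 2 by rewrite ltr_wpDl// ltrD2l ltr1n.
have hh : hol f (r + 2) by exact: ent_hol.
have cf : rcontinuous (fun t => f (circle (r + 1) t)).
  by move=> t; exact: rcont_hol_circle hh rI.
pose B := 2 * ((r + 1) * rmean (fun t => normc (f (circle (r + 1) t)))).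
have B0 := rmean_normc_ge0 cf.
exists B; first exact: (mulr_ge0 (ler0n _ 2) (mulr_ge0 (addr_ge0 r0 ler01) B0)).
move=> z zr; have zr1 : normc z < r + 1 by rewrite (le_lt_trans zr)// ltrDl.
rewrite (cauchy_formula hh rI zr1) /B -rmeanZ; last exact: rcont_normc.
apply: normc_cmean.
- move=> t; apply: gcontM; last exact: rcont_kernel.
  exact: (gcontM (cf t) (rcont_circle _ t)).
- by move=> t; apply: cvgMr; exact: rcont_normc.
move=> t; rewrite normcM (normcM (f _)) normc_circle ?addr_ge0// [normc (f _) * _]mulrC.
rewrite -[X in _ <= X]mulr1; apply: ler_pM; rewrite ?mulr_ge0 ?addr_ge0 ?normc_ge0//.
apply: (le_trans (kernel_bound t zr1)); rewrite invf_le1 ?subr_gt0//.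
by move: zr; lra.
Qed.

Section Logmax.
Variables (f : R[i] -> R[i]).
Hypothesis hf : ent f.

Lemma ln1_ge0 x : 0 <= x -> 0 <= ln (1 + x).
Proof. by move=> x0; rewrite ln_ge0// lerDl. Qed.

Lemma logmax_ub r z : normc z <= r -> ln (1 + normc (f z)) <= logmax f r.
Proof.
move=> zr; apply: ub_le_sup; last by exists z.
have [B B0 HB] := ent_bounded r hf; exists (ln (1 + B)) => _ [u ur ->].
by apply: ler_ln1; [exact: normc_ge0|exact: HB].
Qed.

Lemma logmax_le r C : 0 <= r -> (forall z, normc z <= r -> ln (1 + normc (f z)) <= C) ->
  logmax f r <= C.
Proof.
move=> r0 H; apply: ge_sup; last by move=> _ [z zr ->]; exact: H.
by exists (ln (1 + normc (f 0))), 0; rewrite ?normc0.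
Qed.

Lemma logmax_ge0 r : 0 <= r -> 0 <= logmax f r.
Proof.
move=> r0; apply: (@le_trans _ _ (ln (1 + normc (f 0)))); first exact: (ln1_ge0 (normc_ge0 _)).
by apply: logmax_ub; rewrite normc0.
Qed.

Lemma logmax_mono r r' : 0 <= r -> r <= r' -> logmax f r <= logmax f r'.
Proof.
move=> r0 rr; apply: logmax_le => // z zr; apply: logmax_ub; exact: le_trans rr.
Qed.

Lemma logmax_normc r z : normc z <= r -> 1 + normc (f z) <= expR (logmax f r).
Proof.
move=> zr; rewrite -[X in X <= _]lnK ?ler_expR ?logmax_ub// posrE.
by apply/ltr_01D/normc_ge0.
Qed.

End Logmax.

(** The Cauchy estimate on a circle of radius [d] costs only ln (1 + 2/d). *)
Lemma logmax_derive1 f r d : ent f -> 0 <= r -> 0 < d ->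
  logmax (derive1 f) r <= logmax f (r + d) + ln (1 + 2 / d).
Proof.
move=> hf r0 d0; have hf' := ent_derive1 hf.
apply: logmax_le => // z zr; pose B := expR (logmax f (r + d)) - 1.
have rd : 0 <= r + d by exact: (addr_ge0 r0 (ltW d0)).
have B1 : 1 <= expR (logmax f (r + d)) by rewrite -expR0 ler_expR logmax_ge0.
have B0 : 0 <= B by rewrite subr_ge0.
have hF : hol (fun u => f (z + u)) (d + d) by apply/ent_hol/ent_shift.
have dI : 0 < d < d + d by rewrite d0 ltrDl.
have n0 : normc (0 : R[i]) < d by rewrite normc0.
have H : normc (derive1 f z) <= 2 * (B * d / (d - normc (0 : R[i])) ^+ 2).
  have -> : derive1 f z = derive1 (fun u => f (z + u)) 0.
    apply/esym/derive1_cder/cder_shift; rewrite addr0; exact: ent_cder.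
  apply: (hol_derive_bound hF dI n0 B0) => u ud.
  rewrite /B lerBrDl; apply: logmax_normc => //.
  by apply: (le_trans (ler_normcD _ _)); rewrite ud lerD2r.
rewrite normc0 subr0 in H.
have d1 : 0 < 1 + 2 / d by apply: ltr_01D; rewrite divr_ge0// ltW.
rewrite -{1}[logmax f (r + d)]expRK -lnM ?posrE ?expR_gt0//.
rewrite ler_ln ?posrE ?mulr_gt0 ?expR_gt0 ?d1 ?ltr_01D ?normc_ge0//.
have -> : expR (logmax f (r + d)) = 1 + B by rewrite /B; ring.
have -> : (1 + B) * (1 + 2 / d) = 1 + (B + 2 * (B * d / d ^+ 2) + 2 / d).
  by field; rewrite gt_eqF.
rewrite lerD2l; apply: (le_trans H).
have : 0 <= 2 / d by rewrite divr_ge0// ltW.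
by move: B0; lra.
Qed.

End Entire.

(** * Zeros of entire functions and the Jensen formula *)

Section Zeros.
Variable R : realType.
Implicit Types (r x y a b rho B : R) (z w p c : R[i]) (f g h F : R[i] -> R[i]) (s : seq R[i]).

Definition zprod s z : R[i] := \prod_(w <- s) (z - w).

Lemma zprod_cons w s z : zprod (w :: s) z = (z - w) * zprod s z.
Proof. by rewrite /zprod big_cons. Qed.

Lemma zprod_nil z : zprod [::] z = 1.
Proof. by rewrite /zprod big_nil. Qed.

Lemma ent_zprod s : ent (zprod s).
Proof.
elim: s => [|w s IH] z.
  by rewrite (_ : zprod [::] = fun=> 1); [exact: ent_cst|apply/funext => u; exact: zprod_nil].
rewrite (_ : zprod (w :: s) = fun z => (z - w) * zprod s z).
  by apply: entM => //; apply: entB; [exact: ent_id|exact: ent_cst].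
by apply/funext => u; exact: zprod_cons.
Qed.

Lemma zprod_eq0 s z : (zprod s z == 0) = (z \in s).
Proof.
elim: s => [|w s IH]; first by rewrite zprod_nil oner_eq0.
by rewrite zprod_cons mulf_eq0 IH subr_eq0 in_cons.
Qed.

Lemma normc_zprod_ge s z x : 0 <= x -> (forall w, w \in s -> x <= normc (z - w)) ->
  x ^+ size s <= normc (zprod s z).
Proof.
move=> x0; elim: s => [|w s IH] H; first by rewrite zprod_nil normc1.
rewrite zprod_cons normcM /= exprS; apply: ler_pM; rewrite ?exprn_ge0//.
  by apply: H; rewrite mem_head.
by apply: IH => u us; apply: H; rewrite in_cons us orbT.
Qed.

Lemma normc_zprod_le s z x : 0 <= x -> (forall w, w \in s -> normc (z - w) <= x) ->
  normc (zprod s z) <= x ^+ size s.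
Proof.
move=> x0; elim: s => [|w s IH] H; first by rewrite zprod_nil normc1.
rewrite zprod_cons normcM /= exprS; apply: ler_pM; rewrite ?normc_ge0//.
  by apply: H; rewrite mem_head.
by apply: IH => u us; apply: H; rewrite in_cons us orbT.
Qed.

(** Dividing by the zeros gains a factor 2 per zero on the circle of radius 3 rho compared
   with the disc of radius rho, while |g(0)| is fixed; so the number of zeros is bounded. *)
Lemma zprod_size_bound g rho : ent g -> g 0 != 0 -> 0 < rho ->
  exists N, forall s F, ent F -> (forall w, w \in s -> normc w <= rho) ->
    (forall z, g z = zprod s z * F z) -> (size s <= N)%N.
Proof.
move=> hg g0 rho0; have [M M0 HM] := ent_bounded (3 * rho) hg.
exists (Num.bound (2 * M / normc (g 0))) => s F hF sr gE.
set n := size s.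
have FB z : normc z = 3 * rho -> normc (F z) <= M / (2 * rho) ^+ n.
  move=> zr; rewrite ler_pdivlMr ?exprn_gt0 ?mulr_gt0//.
  have := HM z; rewrite zr lexx => /(_ isT); rewrite gE normcM mulrC; apply: le_trans.
  rewrite ler_wpM2l ?normc_ge0//; apply: normc_zprod_ge; first by rewrite mulr_ge0// ltW.
  move=> w /sr wr; apply: le_trans (ler_distc _ _).
  by rewrite zr; move: wr; lra.
have rI : 0 < 3 * rho < 4 * rho by rewrite mulr_gt0//= ltr_pM2r// ltr_nat.
have F0 : normc (F 0) <= 2 * (M / (2 * rho) ^+ n).
  have n0 : normc (0 : R[i]) < 3 * rho by rewrite normc0 mulr_gt0.
  have B0 : 0 <= M / (2 * rho) ^+ n by rewrite divr_ge0 ?exprn_ge0 ?mulr_ge0// ltW.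
  have := hol_bound (ent_hol (rho := 4 * rho) hF) rI n0 B0 FB.
  by rewrite normc0 subr0 mulfK// mulf_neq0// gt_eqF.
have : normc (g 0) <= rho ^+ n * (2 * (M / (2 * rho) ^+ n)).
  rewrite gE normcM; apply: ler_pM; rewrite ?normc_ge0//.
  apply: normc_zprod_le; first exact: ltW.
  by move=> w ws; rewrite sub0r normcN sr.
have -> : rho ^+ n * (2 * (M / (2 * rho) ^+ n)) = 2 * M / 2 ^+ n.
  by rewrite exprMn; field; rewrite !expf_neq0// gt_eqF.
rewrite ler_pdivlMr ?exprn_gt0// mulrC -ler_pdivlMr ?normc_gt0// => H.
have q0 : 0 <= 2 * M / normc (g 0) by rewrite divr_ge0 ?mulr_ge0 ?normc_ge0.
have := le_lt_trans H (archi_boundP q0).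
rewrite -natrX ltr_nat => /ltnW; apply: leq_trans.
exact/ltnW/ltn_expl.
Qed.

(** Split off zeros one at a time; [zprod_size_bound] makes the process stop. *)
Lemma zero_list g rho : ent g -> g 0 != 0 -> 0 < rho ->
  exists s F, [/\ ent F, (forall z, normc z <= rho -> F z != 0),
    (forall w, w \in s -> w != 0 /\ normc w <= rho) &
    forall z, g z = zprod s z * F z].
Proof.
move=> hg g0 rho0; have [N HN] := zprod_size_bound hg g0 rho0.
apply: contrapT => H.
have P n : exists s F, [/\ size s = n, ent F,
    (forall w, w \in s -> w != 0 /\ normc w <= rho) & forall z, g z = zprod s z * F z].
  elim: n => [|n [s [F [sn hF sr gE]]]].
    by exists [::], g; split => // z; rewrite zprod_nil mul1r.
  have [w [wr Fw]] : exists w, normc w <= rho /\ F w = 0.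
    apply: contrapT => nw; apply: H; exists s, F; split => // z zr.
    by apply/eqP => Fz; apply: nw; exists z.
  have F0 : F 0 != 0 by apply: contra_neq g0 => E; rewrite gE E mulr0.
  have [[|m] [G [hG Gw GE]]] := ent_factor w hF (ex_intro _ 0 F0).
    by move: Gw; have := GE w; rewrite Fw expr0 mul1r => <-; rewrite eqxx.
  exists (w :: s), (fun z => (z - w) ^+ m * G z); split.
  - by rewrite /= sn.
  - apply: entM => // z; eexists.
    exact: gder_comp (cderB (cder_id z) (cder_cst w z)) (cderX m (z - w)).
  - move=> u; rewrite in_cons => /orP[/eqP ->|/sr//]; split => //.
    by apply: contra_neq F0 => w0; move: Fw; rewrite w0.
  - by move=> z; rewrite zprod_cons gE GE exprS; ring.
have [s [F [sn hF sr gE]]] := P N.+1.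
have sr' w : w \in s -> normc w <= rho by move=> /sr[].
by have := HN s F hF sr' gE; rewrite sn ltnn.
Qed.

(** Pigeonhole: of one more candidate radii than points, spaced evenly, one is far from
   every point. *)
Lemma good_radius (s : seq R) a (d : R) : 0 < d ->
  exists2 r, a <= r <= a + d & forall x, x \in s -> d / (2 * (size s).+1%:R) <= `|r - x|.
Proof.
move=> d0; apply: contrapT => H.
set n := (size s).+1; pose h := d / n%:R.
have n0 : 0 < n%:R :> R by rewrite ltr0n.
have h0 : 0 < h by rewrite divr_gt0.
pose m (i : nat) := a + (i%:R + 2^-1) * h.
have hE : d / (2 * n%:R) = h / 2 by rewrite /h; field; rewrite gt_eqF.
have X (i : 'I_n) : exists x, x \in s /\ `|m i - x| < h / 2.
  apply: contrapT => nx; apply: H; exists (m i).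
    rewrite /m lerDl lerD2l mulr_ge0 ?addr_ge0 ?ler0n ?invr_ge0 ?(ltW h0)//=.
    have -> : d = n%:R * h by rewrite /h mulrC divfK// gt_eqF.
    rewrite ler_pM2r//; have : (i%:R + 1 <= n%:R :> R) by rewrite natr1 ler_nat.
    lra.
  move=> x xs; rewrite hE leNgt; apply/negP => xm; apply: nx; by exists x.
have [x Hx] := choice X.
have inj : injective x.
  move=> i j xij; have [_ h1] := Hx i; have [_ h2] := Hx j; rewrite -xij in h2.
  have : `|m i - m j| < h.
    have -> : m i - m j = (m i - x i) - (m j - x i) by ring.
    apply: (le_lt_trans (ler_normB _ _)); move: h1 h2; lra.
  have -> : m i - m j = (i%:R - j%:R) * h by rewrite /m; ring.
  rewrite normrM (gtr0_norm h0) -ltr_pdivlMr// divff ?gt_eqF// => h3.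
  apply/val_inj => /=; case: (ltngtP i j) => // ij.
    exfalso; have h4 : (i%:R + 1 <= j%:R :> R) by rewrite natr1 ler_nat.
    by move: h3 h4; rewrite ltr_norml => /andP[h5 h6] h4; clear ij; lra.
  exfalso; have h4 : (j%:R + 1 <= i%:R :> R) by rewrite natr1 ler_nat.
  by move: h3 h4; rewrite ltr_norml => /andP[h5 h6] h4; clear ij; lra.
have : (size (map x (enum 'I_n)) <= size s)%N.
  apply: uniq_leq_size; first by rewrite map_inj_uniq// enum_uniq.
  by move=> y /mapP[i _ ->]; have [] := Hx i.
by rewrite size_map size_enum_ord ltnn.
Qed.

Section Jensen.
Variables (g F : R[i] -> R[i]) (s : seq R[i]) (rho r : R).
Hypotheses (hF : hol F rho) (Fn0 : forall z, normc z < rho -> F z != 0).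
Hypothesis gE : forall z, g z = zprod s z * F z.
Hypothesis sn0 : forall w, w \in s -> w != 0.
Hypotheses (r0 : 0 < r) (rr : r < rho).
Hypothesis sr : forall w, w \in s -> normc w != r.

Let rI : 0 < r < rho. Proof. by rewrite r0. Qed.

Lemma circle_notin_zeros t : circle r t \notin s.
Proof. by apply/negP => /sr; rewrite normc_circle ?ltW// eqxx. Qed.

Lemma circle_nonzero t : g (circle r t) != 0.
Proof.
by rewrite gE mulf_neq0 ?zprod_eq0 ?circle_notin_zeros ?Fn0// normc_circle ?ltW.
Qed.

Lemma ln_factor z : z \notin s -> normc z < rho ->
  ln (normc (g z)) = \sum_(w <- s) ln (normc (z - w)) + ln (normc (F z)).
Proof.
move=> zs zr; rewrite gE normcM lnM ?posrE ?normc_gt0 ?zprod_eq0 ?Fn0//; congr (_ + _).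
elim: s zs => [|w l IH]; first by rewrite zprod_nil big_nil normc1 ln1.
rewrite in_cons negb_or => /andP[zw zl].
by rewrite zprod_cons normcM lnM ?posrE ?normc_gt0 ?zprod_eq0 ?subr_eq0// big_cons IH.
Qed.

Let mean_factors l : (forall w, w \in l -> normc w != r) ->
  continuous (fun t => \sum_(w <- l) ln (normc (circle r t - w))) /\
  rmean (fun t => \sum_(w <- l) ln (normc (circle r t - w))) =
  \sum_(w <- l) ln (Num.max r (normc w)).
Proof.
elim: l => [|w l IH] H.
  rewrite (_ : (fun=> _) = fun=> 0); last by apply/funext => t; rewrite big_nil.
  by rewrite rmean_cst big_nil; split => // t; exact: cvg_cst.
have [|c1 m1] := jensen_factor r0 (w := w); first by apply: H; rewrite mem_head.
have [|c2 m2] := IH; first by move=> u ul; apply: H; rewrite in_cons ul orbT.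
rewrite (_ : (fun t => \sum_(w <- w :: l) _) =
  fun t => ln (normc (circle r t - w)) + \sum_(w <- l) ln (normc (circle r t - w))).
  split; first by move=> t; apply: cvgD; [exact: c1|exact: c2].
  by rewrite rmeanD// m1 m2 big_cons.
by apply/funext => t; rewrite big_cons.
Qed.

Lemma ln_circle_E : (fun t => ln (normc (g (circle r t)))) =
  fun t => \sum_(w <- s) ln (normc (circle r t - w)) + ln (normc (F (circle r t))).
Proof.
apply/funext => t; rewrite ln_factor ?circle_notin_zeros//.
by rewrite normc_circle ?ltW.
Qed.

Lemma ln_circle_continuous : continuous (fun t => ln (normc (g (circle r t)))).
Proof.
rewrite ln_circle_E => t; apply: cvgD; first by have [c _] := mean_factors sr; exact: c.
exact: ln_circle_cont hF rI Fn0 t.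
Qed.

Lemma jensen : rmean (fun t => ln (normc (g (circle r t)))) =
  ln (normc (g 0)) + \sum_(w <- s) (ln (Num.max r (normc w)) - ln (normc w)).
Proof.
have [c m] := mean_factors sr.
rewrite ln_circle_E rmeanD//; last exact: ln_circle_cont hF rI Fn0.
rewrite m (jensen_zero_free hF rI Fn0).
have z0 : 0 \notin s by apply/negP => /sn0; rewrite eqxx.
rewrite ln_factor ?normc0 ?(lt_trans r0)// big_split/= sumrN.
have -> : \sum_(w <- s) ln (normc (0 - w)) = \sum_(w <- s) ln (normc w).
  by apply: eq_bigr => w _; rewrite sub0r normcN.
by ring.
Qed.

Lemma jensen_lower : ln (normc (g 0)) <= rmean (fun t => ln (normc (g (circle r t)))).
Proof.
rewrite jensen lerDl big_seq; apply: sumr_ge0 => w /sn0 w0.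
by rewrite subr_ge0 ler_ln ?posrE ?lt_max ?r0 ?normc_gt0// le_max lexx orbT.
Qed.

(** In the Jensen formula each zero contributes at most ln (r/|w|), which is at most
   (r/|w|)^q / q; hence a convergent sum of |w|^-q bounds the mean of ln |g| by a multiple of
   r^q. *)
Lemma jensen_upper (q : R) : 0 < q ->
  rmean (fun t => ln (normc (g (circle r t)))) <=
  ln (normc (g 0)) + q^-1 * (r `^ q * \sum_(w <- s) normc w `^ (- q)).
Proof.
move=> q0; rewrite jensen lerD2l mulr_sumr mulr_sumr big_seq [X in _ <= X]big_seq.
apply: ler_sum => w /sn0 w0; rewrite -normc_gt0 in w0.
rewrite mulrC -ler_pdivrMr ?invr_gt0// invrK mulrC.
rewrite /powR !gt_eqF// -expRD mulNr -mulrBr.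
have [rw|wr] := leP r (normc w); last by apply: le_trans (expR_ge1Dx _); rewrite lerDr.
by rewrite subrr mulr0 expR_ge0.
Qed.

(** Each zero of modulus at most [b] contributes at least ln (r/b). *)
Lemma jensen_count b : 0 < b -> b <= r ->
  (count (fun w => normc w <= b) s)%:R * (ln r - ln b) <=
  rmean (fun t => ln (normc (g (circle r t)))) - ln (normc (g 0)).
Proof.
move=> b0 br; rewrite jensen [ln (normc (g 0)) + _]addrC addrK -sum1_count natr_sum mulr_suml.
rewrite big_mkcond/= big_seq [X in _ <= X]big_seq; apply: ler_sum => w /sn0 w0.
rewrite -normc_gt0 in w0; case: ifP => wb.
  have wr := le_trans wb br.
  by rewrite mul1r max_l// lerD2l lerN2 ler_ln.
by rewrite subr_ge0 ler_ln ?posrE ?lt_max ?r0 ?w0 ?orbT// le_max lexx orbT.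
Qed.

End Jensen.
End Zeros.

(** * Logarithmic derivatives away from the zeros *)

Section Log_derivative.
Variable R : realType.
Implicit Types (r x y a b rho B : R) (z w p c : R[i]) (f g h F : R[i] -> R[i]) (s : seq R[i]).

Lemma ln_le_sub1 x : 0 < x -> ln x <= x - 1.
Proof.
move=> x0; rewrite -[X in _ <= X - 1](lnK x0) lerBrDl.
exact: expR_ge1Dx.
Qed.

Lemma ln_le_id x : 0 < x -> ln x <= x.
Proof. by move=> x0; apply: (le_trans (ln_le_sub1 x0)); rewrite gerBl. Qed.

Lemma zprod_filter (P : pred R[i]) s z :
  zprod s z = zprod (seq.filter P s) z * zprod (seq.filter (predC P) s) z.
Proof. by rewrite /zprod !big_filter (bigID P). Qed.

(** Here [X] is a large parameter that dominates the radius, the inverse of the width [d] and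
   the growth of [g]; every quantity is then bounded by a power of [X], and only logarithms of
   such powers will matter. *)
Section Zero_data.
Variables (g g1 : R[i] -> R[i]) (m : nat).
Hypotheses (hg : ent g) (hg1 : ent g1) (g10 : g1 0 != 0).
Hypothesis gE : forall z, g z = z ^+ m * g1 z.

Variables (Rd d X : R).
Hypotheses (R1 : 1 <= Rd) (d0 : 0 < d) (dR : d <= Rd).
Hypotheses (X20 : 20 <= X) (RX : Rd <= X) (dX : d^-1 <= X).
Hypotheses (LX : logmax g (Rd + 4 * d) <= X) (g1X : - ln (normc (g1 0)) <= X).

Let X0 : 0 < X. Proof. exact: lt_le_trans X20. Qed.
Let X1 : 1 <= X. Proof. by apply: le_trans X20; rewrite ler1n. Qed.
Let R0 : 0 < Rd. Proof. exact: lt_le_trans R1. Qed.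

Let ler_X i j : (i <= j)%N -> X ^+ i <= X ^+ j.
Proof. by move=> ij; apply: ler_weXn2l. Qed.

Let X_step i : 20 * X ^+ i <= X ^+ i.+1.
Proof. by rewrite exprS ler_wpM2r// exprn_ge0// ltW. Qed.

Let g1_le z : 1 <= normc z -> normc (g1 z) <= normc (g z).
Proof.
by move=> z1; rewrite gE normcM normcX ler_peMl ?normc_ge0// exprn_ege1.
Qed.

(** The number of zeros in the disc of radius Rd + 3 d follows from [jensen_count] on a
   slightly larger circle, because ln (r/b) is at least of size d/Rd. *)
Lemma zero_list_bound : exists s F, [/\ ent F,
  (forall z, normc z <= Rd + 3 * d -> F z != 0),
  (forall w, w \in s -> w != 0 /\ normc w <= Rd + 3 * d),
  (forall z, g1 z = zprod s z * F z) & (size s)%:R <= X ^+ 4].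
Proof.
have rho0 : 0 < Rd + 4 * d by rewrite addr_gt0// mulr_gt0.
have [s' [F' [hF' F'n s'r g1E]]] := zero_list hg1 g10 rho0.
pose b := Rd + 3 * d; pose P w := normc w <= b.
exists (seq.filter P s'), (fun z => zprod (seq.filter (predC P) s') z * F' z).
have bd : b <= Rd + 4 * d by rewrite lerD2l ler_wpM2r ?ler_nat// ltW.
split.
- by apply: entM => //; exact: ent_zprod.
- move=> z zb; rewrite mulf_neq0 ?F'n//; last exact: le_trans bd.
  by rewrite zprod_eq0 mem_filter /= /P zb.
- by move=> w; rewrite mem_filter => /andP[wb /s'r[]].
- by move=> z; rewrite g1E (zprod_filter P) mulrA.
have [r /andP[ra rb] rs] := good_radius [seq normc w | w <- s'] (Rd + 7 / 2 * d)
  (divr_gt0 d0 (ltr0n _ 4)).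
have rr : r < Rd + 4 * d by move: rb; have := d0; lra.
have br : b <= r by rewrite /b; move: ra; have := d0; lra.
have b0 : 0 < b by rewrite /b addr_gt0// mulr_gt0.
have r0 : 0 < r by exact: lt_le_trans br.
have r1 : 1 <= r by move: ra R1; have := d0; lra.
have sr w : w \in s' -> normc w != r.
  move=> ws; have := rs (normc w) (map_f _ ws); apply: contraTneq => ->.
  by rewrite subrr normr0 -ltNge divr_gt0 ?mulr_gt0 ?divr_gt0// ltr0n.
have sn0 w : w \in s' -> w != 0 by move=> /s'r[].
have Fn0 z : normc z < Rd + 4 * d -> F' z != 0 by move=> /ltW; exact: F'n.
have hF'' := ent_hol (rho := Rd + 4 * d) hF'.
have := jensen_count hF'' Fn0 g1E sn0 r0 rr sr b0 br.
rewrite size_filter; set n := count _ _ => H.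
have M : rmean (fun t => ln (normc (g1 (circle r t)))) <= X.
  rewrite -(rmean_cst X); apply: rmean_le.
  - exact: (ln_circle_continuous hF'' Fn0 g1E r0 rr sr).
  - by move=> t; exact: cvg_cst.
  move=> t; have cr : normc (circle r t) = r by rewrite normc_circle ?ltW.
  have n0 := circle_nonzero Fn0 g1E r0 rr sr t.
  apply: (@le_trans _ _ (ln (1 + normc (g (circle r t))))).
    rewrite ler_ln ?posrE ?normc_gt0//; last by rewrite ltr_01D ?normc_ge0.
    by apply: (le_trans (g1_le _)); rewrite ?cr// lerDr.
  by apply: le_trans LX; apply: logmax_ub => //; rewrite cr ltW.
have lnr : d / (10 * Rd) <= ln r - ln b.
  rewrite -ln_div ?posrE//.
  have -> : ln (r / b) = - ln (b / r) by rewrite -lnV ?posrE ?divr_gt0// invf_div.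
  have := ln_le_sub1 (divr_gt0 b0 r0) => h1.
  apply: (@le_trans _ _ (1 - b / r)); last by move: h1; lra.
  have -> : 1 - b / r = (r - b) / r by field; rewrite gt_eqF.
  rewrite ler_pdivlMr// mulrAC ler_pdivrMr ?mulr_gt0//.
  apply: (@le_trans _ _ (d * (5 * Rd))).
    by rewrite ler_pM2l//; move: rr dR; lra.
  have -> : d * (5 * Rd) = (d / 2) * (10 * Rd) by field.
  by rewrite ler_pM2r ?mulr_gt0// /b; move: ra; lra.
have dX2 : (10 * X ^+ 2)^-1 <= ln r - ln b.
  apply: le_trans lnr; rewrite -[d / _]invrK lef_pV2 ?posrE ?invr_gt0 ?divr_gt0 ?mulr_gt0 ?exprn_gt0//.
  rewrite invf_div -mulrA ler_pM2l// expr2.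
  by apply: ler_pM => //; rewrite ?invr_ge0 ?(ltW d0) ?(ltW R0).
have : n%:R * (10 * X ^+ 2)^-1 <= X + X.
  apply: (@le_trans _ _ (n%:R * (ln r - ln b))); first by rewrite ler_wpM2l ?ler0n.
  by apply: (le_trans H); exact: lerD.
rewrite ler_pdivrMr ?mulr_gt0 ?exprn_gt0// => H2.
apply: (le_trans H2); apply: le_trans (X_step 3).
by have -> : (X + X) * (10 * X ^+ 2) = 20 * X ^+ 3 by ring.
Qed.

Variables (s : seq R[i]) (F : R[i] -> R[i]).
Hypotheses (hF : ent F) (Fn0 : forall z, normc z <= Rd + 3 * d -> F z != 0).
Hypothesis sr : forall w, w \in s -> w != 0 /\ normc w <= Rd + 3 * d.
Hypothesis g1E : forall z, g1 z = zprod s z * F z.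
Hypothesis sX : (size s)%:R <= X ^+ 4.

(** The Cauchy formula on the circle of radius Rd + 4 d, at distance d from all the zeros
   that were divided out. *)
Lemma ln_F_upper z : normc z <= Rd + 2 * d -> ln (normc (F z)) <= X ^+ 6.
Proof.
move=> zr; set n := size s; pose r := Rd + 4 * d.
have r0 : 0 < r by rewrite addr_gt0// mulr_gt0.
have rI : 0 < r < r + 1 by rewrite r0 ltrDl ltr01.
pose B := expR X * X ^+ n.
have B0 : 0 < B by rewrite mulr_gt0 ?expR_gt0 ?exprn_gt0.
have FB u : normc u = r -> normc (F u) <= B.
  move=> ur; have u1 : 1 <= normc u by rewrite ur /r; move: R1 d0; lra.
  have zp : d ^+ n <= normc (zprod s u).
    apply: normc_zprod_ge; first exact: ltW.
    move=> w /sr[_ wr]; apply: le_trans (ler_distc _ _).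
    by rewrite ur /r; move: wr; lra.
  have : normc (F u) * d ^+ n <= expR X.
    apply: (@le_trans _ _ (normc (g1 u))).
      by rewrite g1E normcM mulrC ler_wpM2r ?normc_ge0.
    apply: (le_trans (g1_le u1)); apply: (@le_trans _ _ (expR (logmax g r))).
      by apply: le_trans (logmax_normc hg (_ : normc u <= r)); rewrite ?ur// lerDr.
    by rewrite ler_expR.
  rewrite -ler_pdivlMr ?exprn_gt0// => /le_trans; apply.
  rewrite /B ler_pM2l ?expR_gt0// -exprVn.
  by apply: lerXn2r; rewrite ?nnegrE ?invr_ge0 ?(ltW d0) ?(ltW X0).
have zr' : normc z < r by apply: (le_lt_trans zr); rewrite /r; move: d0; lra.
have H := hol_bound (ent_hol (rho := r + 1) hF) rI zr' (ltW B0) FB.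
have Fz : F z != 0 by apply: Fn0; apply: (le_trans zr); move: d0; lra.
have {}H : normc (F z) <= 5 * X ^+ 2 * B.
  apply: (le_trans H).
  have -> : 2 * (B * r / (r - normc z)) = B * (2 * (r / (r - normc z))) by ring.
  rewrite mulrC ler_pM2r//.
  have h1 : r / (r - normc z) <= 5 * Rd / (2 * d).
    apply: ler_pM; rewrite ?(ltW r0) ?invr_ge0 ?subr_ge0 ?(ltW zr')//.
      by rewrite /r; move: dR; lra.
    rewrite lef_pV2 ?posrE ?subr_gt0 ?mulr_gt0//.
    by rewrite /r; move: zr; lra.
  apply: (@le_trans _ _ (2 * (5 * Rd / (2 * d)))); first by rewrite ler_pM2l.
  have -> : 2 * (5 * Rd / (2 * d)) = 5 * (Rd * d^-1) by field; rewrite gt_eqF.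
  rewrite ler_pM2l// expr2; apply: ler_pM; rewrite ?(ltW R0) ?invr_ge0 ?(ltW d0)//.
have : ln (normc (F z)) <= ln (5 * X ^+ 2 * B).
  by rewrite ler_ln ?posrE ?normc_gt0// mulr_gt0// mulr_gt0// exprn_gt0.
move=> /le_trans; apply.
have e5 : 0 < 5 * X ^+ 2 by exact: (mulr_gt0 (ltr0n R 5) (exprn_gt0 2 X0)).
rewrite lnM; [|by rewrite posrE|by rewrite posrE].
have -> : ln B = X + ln X *+ n.
  by rewrite /B lnM ?posrE ?expR_gt0 ?exprn_gt0// expRK lnXn.
have a1 := ln_le_id e5.
have a2 : ln X *+ n <= X ^+ 4 * X.
  rewrite -mulr_natl; apply: ler_pM; rewrite ?ler0n ?ln_ge0//; exact: ln_le_id.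
rewrite -exprSr in a2.
have a3 := ler_X (isT : (2 <= 5)%N); have a4 := ler_X (isT : (1 <= 5)%N).
have a5 := X_step 5; rewrite expr1 in a4.
by move: a1 a2 a3 a4 a5; lra.
Qed.

Lemma ln_F0_lower : - ln (normc (F 0)) <= X ^+ 6.
Proof.
set n := size s.
have F0 : F 0 != 0 by apply: Fn0; rewrite normc0 addr_ge0 ?mulr_ge0 ?(ltW R0) ?(ltW d0).
have X4 : 0 < 4 * X by rewrite mulr_gt0.
have : normc (g1 0) <= (4 * X) ^+ n * normc (F 0).
  rewrite g1E normcM ler_wpM2r ?normc_ge0//; apply: normc_zprod_le; first exact: ltW.
  move=> w /sr[_ wr]; rewrite sub0r normcN; apply: (le_trans wr).
  by move: dR RX; lra.
rewrite -ler_ln ?posrE ?normc_gt0 ?mulr_gt0 ?exprn_gt0// ?normc_gt0//.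
rewrite lnM ?posrE ?exprn_gt0 ?normc_gt0// lnXn// => H.
have a2 : ln (4 * X) *+ n <= X ^+ 4 * (4 * X).
  rewrite -[_ *+ n]mulr_natl; apply: ler_pM; rewrite ?ler0n//; last exact: ln_le_id.
  by rewrite ln_ge0//; move: X1; lra.
have -> : - ln (normc (F 0)) = - ln (normc (g1 0)) + (ln (normc (g1 0)) - ln (normc (F 0))) by ring.
have a3 : X ^+ 4 * (4 * X) = 4 * X ^+ 5 by ring.
have a4 := ler_X (isT : (1 <= 5)%N); rewrite expr1 in a4.
have a5 := X_step 5.
by move: H a2 a3 a4 a5 g1X; lra.
Qed.

End Zero_data.

(** The inequality |f'| <= B |f| at a point. Stated without division it also makes sense at
   zeros of [f] and for the zero function. *)
Definition logder_le f z B := exists2 l, cder f z l & normc l <= B * normc (f z).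

Lemma logder_leM f g z B B' : logder_le f z B -> logder_le g z B' ->
  logder_le (fun u => f u * g u) z (B + B').
Proof.
move=> [l dl lB] [l' dl' lB']; exists (l * g z + f z * l'); first exact: cderM.
apply: (le_trans (ler_normcD _ _)); rewrite !normcM mulrDl; apply: lerD.
  by rewrite mulrA ler_wpM2r ?normc_ge0.
by rewrite mulrCA ler_wpM2l ?normc_ge0.
Qed.

Lemma logder_le_zprod s z (e : R) : 0 < e -> (forall w, w \in s -> e <= normc (z - w)) ->
  logder_le (zprod s) z ((size s)%:R / e).
Proof.
move=> e0; elim: s => [|w s IH] H.
  exists 0; last by rewrite normc0 mul0r mul0r.
  by rewrite (_ : zprod [::] = fun=> 1); [exact: cder_cst|apply/funext => u; rewrite zprod_nil].
rewrite (_ : zprod (w :: s) = fun u => (u - w) * zprod s u); last first.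
  by apply/funext => u; rewrite zprod_cons.
have -> : (size (w :: s))%:R / e = e^-1 + (size s)%:R / e by rewrite /= -natr1 mulrDl mul1r addrC.
apply: logder_leM.
  exists 1; first by have := cderB (cder_id z) (cder_cst w z); rewrite subr0.
  by rewrite normc1 mulrC ler_pdivlMr// mul1r H// mem_head.
by apply: IH => u us; apply: H; rewrite in_cons us orbT.
Qed.

Lemma logder_leX m z : 1 <= normc z -> logder_le (fun u => u ^+ m) z m%:R.
Proof.
move=> z1; exists (m%:R * z ^+ m.-1); first exact: cderX.
rewrite normcM normcX normcX.
have -> : normc (m%:R : R[i]) = m%:R.
  by rewrite -(rmorph_nat (real_complex R)) normc_real ger0_norm ?ler0n.
rewrite ler_wpM2l ?ler0n//; case: m => [|m]//=.
by rewrite exprS ler_peMl ?exprn_ge0 ?normc_ge0.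
Qed.

End Log_derivative.

(** * Circles on which several logarithmic derivatives are small *)

Section Good_circle.
Variable R : realType.
Implicit Types (r x y a b rho B : R) (z w p c : R[i]) (f g h F : R[i] -> R[i]) (s : seq R[i]).

Definition scale_ok g (Rd d X : R) :=
  [/\ 1 <= Rd, 0 < d, d <= Rd & [/\ Rd <= X, d^-1 <= X & logmax g (Rd + 4 * d) <= X]].

Lemma zero_data g : ent g -> (exists z, g z != 0) -> exists C m g1,
  [/\ 20 <= C, m%:R <= C, - ln (normc (g1 0)) <= C, ent g1 & g1 0 != 0] /\
  (forall z, g z = z ^+ m * g1 z) /\
  (forall Rd d X, C <= X -> scale_ok g Rd d X -> exists s F,
    [/\ ent F, (forall z, normc z <= Rd + 3 * d -> F z != 0),
     (forall w, w \in s -> w != 0 /\ normc w <= Rd + 3 * d) &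
     (forall z, g1 z = zprod s z * F z)] /\
    [/\ (size s)%:R <= X ^+ 4,
     (forall z, normc z <= Rd + 2 * d -> ln (normc (F z)) <= X ^+ 6) &
     - ln (normc (F 0)) <= X ^+ 6]).
Proof.
move=> hg ng; have [m [g1 [hg1 g10 gE]]] := ent_factor 0 hg ng.
have {}gE z : g z = z ^+ m * g1 z by rewrite gE subr0.
pose C := Num.max 20 (Num.max m%:R (- ln (normc (g1 0)))).
have C20 : 20 <= C by rewrite /C le_max lexx.
have Cm : m%:R <= C by rewrite /C !le_max lexx orbT.
have Cg : - ln (normc (g1 0)) <= C by rewrite /C !le_max lexx !orbT.
exists C, m, g1; split => //; split => // Rd d X CX [R1 d0 dR [RX dX LX]].
have X20 := le_trans C20 CX; have Xg := le_trans Cg CX.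
have [s [F [hF Fn0 sr g1E sX]]] := zero_list_bound hg hg1 g10 gE R1 d0 dR X20 RX dX LX Xg.
exists s, F; split => //; split => //.
  move=> z zr; exact: (ln_F_upper hg gE R1 d0 dR X20 RX dX LX hF Fn0 sr g1E sX zr).
exact: (ln_F0_lower g10 R1 d0 dR X20 RX Xg Fn0 sr g1E sX).
Qed.

(** The absolute value is twice the positive part minus the function; with
   [jensen_zero_free] an upper bound for ln |f| and a lower bound for ln |f(0)| control the
   mean of |ln |f||. *)
Lemma mean_abs_of_upper (u : R -> R) (K : R) : continuous u -> 0 <= K ->
  (forall t, u t <= K) -> rmean (fun t => `|u t|) <= 2 * K - rmean u.
Proof.
move=> cu K0 uK; have cN : continuous (fun t => - u t) by move=> t; apply: cvgN; exact: cu.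
have -> : 2 * K - rmean u = rmean (fun t => 2 * K + - u t).
  by rewrite rmeanD ?rmean_cst ?rmeanN// => t; exact: cvg_cst.
apply: rmean_le; first by move=> t; apply: cvg_norm; exact: cu.
  by move=> t; apply: cvgD; [exact: cvg_cst|exact: cN].
by move=> t; have := uK t; case: (ger0P (u t)) => u0 h; lra.
Qed.

(** Write g as a power of z times the product over the zeros times a zero-free function.
   The first two factors are explicit, the third is controlled by [log_derive_bound]. The radius
   has to stay away from the moduli of the zeros, which form the exceptional set [S]. *)
Lemma log_derivative g : ent g -> exists2 C, 20 <= C &
  forall Rd d X, C <= X -> scale_ok g Rd d X -> exists2 S : seq R, (size S)%:R <= X ^+ 4 &
    forall r e, Rd <= r <= Rd + d -> 0 < e -> (forall x, x \in S -> e <= `|r - x|) ->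
      forall z, normc z = r ->
      logder_le g z (X ^+ 4 / e + X ^+ 11) /\ (g z = 0 -> forall u, g u = 0).
Proof.
move=> hg; have [g0|/existsNP[z0 /eqP gz0]] := pselect (forall z, g z = 0).
  exists 20 => // Rd d X XC _; exists [::]; first by rewrite exprn_ge0// (le_trans _ XC).
  move=> r e _ e0 _ z _; split; last by move=> _; exact: g0.
  exists 0; last by rewrite g0 !normc0 mulr0.
  by rewrite (_ : g = fun=> 0); [exact: cder_cst|apply/funext].
have [C [m [g1 [[C20 Cm Cg hg1 g10] [gE D]]]]] := zero_data hg (ex_intro _ z0 gz0).
exists C => // Rd d X CX ok.
have [s [F [[hF Fn0 sr g1E] [sX FU FL]]]] := D Rd d X CX ok.
have [R1 d0 dR [RX dX LX]] := ok.
have X20 := le_trans C20 CX; have X0 : 0 < X by exact: lt_le_trans X20.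
have X1 : 1 <= X by apply: le_trans X20; rewrite ler1n.
have R0 : 0 < Rd by exact: lt_le_trans R1.
exists [seq normc w | w <- s]; first by rewrite size_map.
move=> r e /andP[ra rb] e0 He z zr.
have sz w : w \in s -> e <= normc (z - w).
  move=> ws; apply: (le_trans (He (normc w) (map_f _ ws))).
  rewrite -zr ler_norml lerNl opprB [normc (z - w)]distcC ler_distc distcC.
  by rewrite ler_distc.
have z1 : 1 <= normc z by rewrite zr (le_trans R1).
have zs : z \notin s.
  by apply/negP => /sz; rewrite subrr normc0 leNgt e0.
have Fz : F z != 0 by apply: Fn0; rewrite zr (le_trans rb)// lerD2l ler_peMl ?ler1n// ltW.
have gz : g z != 0.
  by rewrite gE g1E !mulf_neq0 ?zprod_eq0// expf_neq0// -normc_gt0 (lt_le_trans _ z1).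
split; last by move=> E; rewrite E eqxx in gz.
have r1I : 0 < Rd + 2 * d < Rd + 3 * d.
  by rewrite addr_gt0 ?mulr_gt0//= ltrD2l ltr_pM2r// ltr_nat.
have hF3 := ent_hol (rho := Rd + 3 * d) hF.
have Fn3 u : normc u < Rd + 3 * d -> F u != 0 by move=> /ltW; exact: Fn0.
have r10 : 0 <= Rd + 2 * d by case/andP : r1I => /ltW.
have A : rmean (fun t => `|ln (normc (F (circle (Rd + 2 * d) t)))|) <= 3 * X ^+ 6.
  have X6 : 0 <= X ^+ 6 by rewrite exprn_ge0// ltW.
  apply: (le_trans (@mean_abs_of_upper _ (X ^+ 6) (ln_circle_cont hF3 r1I Fn3) X6 _)).
    by move=> t; apply: FU; rewrite normc_circle.
  rewrite (jensen_zero_free hF3 r1I Fn3); move: FL; lra.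
have zr1 : normc z < Rd + 2 * d by rewrite zr; move: rb d0; lra.
have LF : logder_le F z (36 * X ^+ 9).
  exists (derive1 F z); first exact: ent_cder.
  have := log_derive_bound hF3 r1I Fn3 zr1.
  rewrite normc_div ler_pdivrMr ?normc_gt0// => H; apply: (le_trans H).
  rewrite ler_wpM2r ?normc_ge0//.
  have q : (Rd + 2 * d) / (Rd + 2 * d - normc z) ^+ 2 <= 3 * X * X ^+ 2.
    apply: ler_pM => //.
    - by rewrite invr_ge0 sqr_ge0.
    - by move: dR RX; lra.
    rewrite -exprVn; apply: lerXn2r; rewrite ?nnegrE ?invr_ge0 ?subr_ge0 ?(ltW zr1) ?(ltW X0)//.
    apply: le_trans dX; rewrite lef_pV2 ?posrE ?subr_gt0//.
    by rewrite zr; move: rb; lra.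
  have -> : 36 * X ^+ 9 = 4 * (3 * X * X ^+ 2) * (3 * X ^+ 6) by ring.
  have A0 : 0 <= rmean (fun t => `|ln (normc (F (circle (Rd + 2 * d) t)))|).
    by apply: le_trans (log_abs_mean_ge hF3 r1I Fn3).
  apply: ler_pM => //; last by rewrite ler_pM2l.
  by rewrite mulr_ge0// divr_ge0// sqr_ge0.
have := logder_leM (logder_leX m z1) (logder_leM (logder_le_zprod e0 sz) LF).
rewrite (_ : (fun u => _) = g); last by apply/funext => u; rewrite gE g1E.
move=> [l dl lB]; exists l => //; apply: (le_trans lB).
rewrite ler_wpM2r ?normc_ge0// addrCA; apply: lerD.
  by rewrite ler_pM2r ?invr_gt0.
have h1 : X <= X ^+ 9 by rewrite -[X in X <= _]expr1 ler_weXn2l.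
have h2 : X ^+ 11 = X ^+ 2 * X ^+ 9 by ring.
have h3 : 400 <= X ^+ 2.
  have -> : 400 = 20 ^+ 2 :> R by ring.
  by apply: lerXn2r; rewrite ?nnegrE// ltW.
have h4 : 400 * X ^+ 9 <= X ^+ 2 * X ^+ 9 by rewrite ler_wpM2r// exprn_ge0// ltW.
have := le_trans Cm CX; move: h1 h2 h4; lra.
Qed.

Lemma family_log_derivative (gs : nat -> R[i] -> R[i]) n : (forall i, (i < n)%N -> ent (gs i)) ->
  exists2 C, 20 <= C & forall Rd d X, C <= X -> (forall i, (i < n)%N -> scale_ok (gs i) Rd d X) ->
   exists2 S : seq R, (size S)%:R <= n%:R * X ^+ 4 &
    forall r e, Rd <= r <= Rd + d -> 0 < e -> (forall x, x \in S -> e <= `|r - x|) ->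
      forall z, normc z = r -> forall i, (i < n)%N ->
      logder_le (gs i) z (X ^+ 4 / e + X ^+ 11) /\ (gs i z = 0 -> forall u, gs i u = 0).
Proof.
elim: n => [|n IH] hgs.
  by exists 20 => // Rd d X _ _; exists [::]; rewrite ?mul0r.
have [|C C20 HC] := IH; first by move=> i /ltnW; exact: hgs.
have [C' C'20 HC'] := log_derivative (hgs n (ltnSn n)).
exists (Num.max C C'); first by rewrite le_max C20.
move=> Rd d X; rewrite ge_max => /andP[CX CX'] ok.
have [|S SX HS] := HC Rd d X CX; first by move=> i /ltnW; exact: ok.
have [S' SX' HS'] := HC' Rd d X CX' (ok n (ltnSn n)).
exists (S ++ S'); first by rewrite size_cat natrD -natr1 mulrDl mul1r lerD.
move=> r e rI e0 He z zr i; rewrite ltnS leq_eqVlt => /orP[/eqP ->|ilt].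
  by apply: (HS' r e) => // x xS; apply: He; rewrite mem_cat xS orbT.
by apply: (HS r e) => // x xS; apply: He; rewrite mem_cat xS.
Qed.

(** The family has finitely many members, so all exceptional radii together are at most a
   fixed multiple of X^4 many, and [good_radius] finds a circle at distance X^-6 from all of
   them. *)
Lemma good_circle (gs : nat -> R[i] -> R[i]) n : (forall i, (i < n)%N -> ent (gs i)) ->
  exists2 C, 20 <= C & forall Rd d X (S0 : seq R), C <= X ->
   (forall i, (i < n)%N -> scale_ok (gs i) Rd d X) -> 0 < d -> d^-1 <= X ->
   (size S0)%:R <= X ^+ 4 ->
   exists r, [/\ Rd <= r <= Rd + d, (forall x, x \in S0 -> X ^- 6 <= `|r - x|) &
      forall z, normc z = r -> forall i, (i < n)%N ->
      logder_le (gs i) z (X ^+ 12) /\ (gs i z = 0 -> forall u, gs i u = 0)].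
Proof.
move=> hgs; have [C C20 HC] := family_log_derivative hgs.
exists (Num.max C (2 * n%:R + 4)); first by rewrite le_max C20.
move=> Rd d X S0; rewrite ge_max => /andP[CX nX] ok d0 dX S0X.
have X20 := le_trans C20 CX; have X0 : 0 < X by exact: lt_le_trans X20.
have X1 : 1 <= X by apply: le_trans X20; rewrite ler1n.
have [S SX HS] := HC Rd d X CX ok.
have [r rI Hr] := good_radius (S0 ++ S) Rd d0.
have e6 : X ^- 6 <= d / (2 * (size (S0 ++ S)).+1%:R).
  rewrite -[d / _]invrK lef_pV2 ?posrE ?exprn_gt0 ?invr_gt0 ?divr_gt0 ?mulr_gt0 ?ltr0n//.
  rewrite invf_div.
  have -> : (size (S0 ++ S)).+1%:R = (size S0)%:R + (size S)%:R + 1 :> R.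
    by rewrite size_cat -natr1 natrD.
  have X4 : 1 <= X ^+ 4 by rewrite exprn_ege1.
  have h1 : 2 * ((size S0)%:R + (size S)%:R + 1) <= (2 * n%:R + 4) * X ^+ 4.
    by move: SX S0X X4; lra.
  have -> : X ^+ 6 = X * X ^+ 4 * X by ring.
  apply: ler_pM; rewrite ?invr_ge0 ?(ltW d0)//.
  by apply: (le_trans h1); rewrite ler_pM2r ?exprn_gt0.
exists r; split => //.
  by move=> x xS; apply: (le_trans e6); apply: Hr; rewrite mem_cat xS.
have e0 : 0 < X ^- 6 by rewrite invr_gt0 exprn_gt0.
move=> z zr i ilt.
have [|[l dl lB] gz] := HS r (X ^- 6) rI e0 _ z zr i ilt.
  by move=> x xS; apply: (le_trans e6); apply: Hr; rewrite mem_cat xS orbT.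
split => //; exists l => //; apply: (le_trans lB).
rewrite ler_wpM2r ?normc_ge0// invrK.
have -> : X ^+ 4 * X ^+ 6 = X ^+ 10 by ring.
have h1 : X ^+ 10 <= X ^+ 11 by rewrite ler_weXn2l.
have -> : X ^+ 12 = X * X ^+ 11 by ring.
have : 20 * X ^+ 11 <= X * X ^+ 11 by rewrite ler_wpM2r// exprn_ge0// ltW.
have : 0 <= X ^+ 11 by rewrite exprn_ge0// ltW.
by move: h1; lra.
Qed.

End Good_circle.

(** * The auxiliary entire function of a shared value *)

Section Estimate.
Variable R : realType.
Implicit Types (r x y b rho B : R) (z w p c : R[i]) (f g h F u v : R[i] -> R[i]) (s : seq R[i]).

(** Divisibility is checked locally at each point; the pointwise quotients agree because
   zeros of [q] are isolated. *)
Lemma entire_quotient (p q : R[i] -> R[i]) : ent p -> ent q -> (exists z, q z != 0) ->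
  (forall w, exists m u v, [/\ ent u, ent v, u w != 0,
     forall z, q z = (z - w) ^+ m * u z & forall z, p z = (z - w) ^+ m * v z]) ->
  exists2 G, ent G & forall z, p z = q z * G z.
Proof.
move=> hp hq nq H.
have loc w : exists G : R[i] -> R[i], (exists l, cder G w l) /\
    exists2 d : R, 0 < d & forall z, normc (z - w) < d -> p z = q z * G z.
  have [m [u [v [hu hv uw qE pE]]]] := H w.
  have [|d d0 Hd] := ent_cont w hu (e := normc (u w)); first by rewrite normc_gt0.
  exists (fun z => v z * (u z)^-1); split.
    by eexists; exact: (cderM (ent_cder w hv) (cderV (ent_cder w hu) uw)).
  exists d => // z /Hd uz; have uz0 : u z != 0.
    by apply: contraTneq uz => /= ->; rewrite sub0r normcN ltxx.
  by rewrite qE pE; field.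
have [V HV] := choice loc; exists (fun z => V z z); last first.
  by move=> z; have [_ [d d0 ->//]] := HV z; rewrite subrr normc0.
move=> w; have [[l dl] [d d0 Hd]] := HV w; exists l.
have [e e0 He] := ent_isolated w hq nq.
have m0 : 0 < Num.min d e by rewrite lt_min d0.
apply: (gder_near m0 _ dl) => z /=; rewrite lt_min => /andP[zd ze].
have [->//|zw] := eqVneq z w.
have qz : q z != 0 by apply: He; rewrite ze andbT normc_gt0 subr_eq0.
apply: (mulfI qz); rewrite -Hd//.
by have [_ [d' d'0 ->//]] := HV z; rewrite subrr normc0.
Qed.

Lemma ent_factor_root g w : ent g -> (exists z, g z != 0) -> g w = 0 ->
  exists m h, [/\ ent h, h w != 0 & forall z, g z = (z - w) ^+ m.+1 * h z].
Proof.
move=> hg ng gw; have [[|m] [h [hh hw gE]]] := ent_factor w hg ng; last by exists m, h.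
by move: hw; have := gE w; rewrite gw expr0 mul1r => <-; rewrite eqxx.
Qed.

Lemma ent_powB w m : ent (fun z => (z - w) ^+ m).
Proof.
by move=> z; eexists; exact: gder_comp (cderB (cder_id z) (cder_cst w z)) (cderX m (z - w)).
Qed.

Section Shared_value.
Variables (f : R[i] -> R[i]) (k : nat) (a : R[i]).
Hypothesis hf : ent f.
Hypothesis share : forall z, f z = a -> derive1n k f z = a.
Hypothesis nconst : exists z, derive1 f z != 0.
Hypothesis nfix : exists z, derive1n k f z != f z.

Let hfk : ent (derive1n k f). Proof. exact: ent_derive1n. Qed.
Let hf1 : ent (derive1 f). Proof. exact: ent_derive1. Qed.
Let hfa : ent (fun z => f z - a). Proof. by apply: entB => //; exact: ent_cst. Qed.
Let hfkf : ent (fun z => derive1n k f z - f z). Proof. exact: entB. Qed.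

Lemma shifted_nonzero : exists z, f z - a != 0.
Proof.
apply: contrapT => H; have [z /eqP fz] := nconst; apply: fz.
have E : f = fun=> a.
  apply/funext => u; apply/eqP; rewrite -subr_eq0; apply/negPn/negP => nu.
  by apply: H; exists u.
by rewrite E; apply: derive1_cder; exact: cder_cst.
Qed.

(** The quotient f' (f^(k) - f) / (f - a) has no poles: at an a-point of [f] of multiplicity m
   the factor f' vanishes to order m - 1, and f^(k) - f vanishes as well because the value [a]
   is shared. *)
Lemma shared_quotient : exists2 G, ent G &
  (forall z, derive1 f z * (derive1n k f z - f z) = (f z - a) * G z) /\ exists z, G z != 0.
Proof.
have nfkf : exists z, derive1n k f z - f z != 0.
  by have [z nz] := nfix; exists z; rewrite subr_eq0.
have [|G hG GE] := entire_quotient (entM hf1 hfkf) hfa shifted_nonzero.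
  move=> w; have [faw|faw] := eqVneq (f w - a) 0; last first.
    exists 0%N, (fun z => f z - a), (fun z => derive1 f z * (derive1n k f z - f z)).
    by split => //; [exact: entM|move=> z; rewrite expr0 mul1r..].
  have fkw : derive1n k f w - f w = 0.
    have fw : f w = a by apply/eqP; rewrite -subr_eq0 faw.
    by rewrite share// fw subrr.
  have [m [u [hu uw fE]]] := ent_factor_root hfa shifted_nonzero faw.
  have [m' [t [ht tw tE]]] := ent_factor_root hfkf nfkf fkw.
  exists m.+1, u, (fun z => (m.+1%:R * u z + (z - w) * derive1 u z) * ((z - w) ^+ m' * t z)).
  have hzw : ent (fun z => z - w) by apply: entB; [exact: ent_id|exact: ent_cst].
  split => //.
    exact: (entM (entD (entM (ent_cst m.+1%:R) hu) (entM hzw (ent_derive1 hu)))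
                 (entM (ent_powB w m') ht)).
  move=> z; rewrite tE.
  have -> : derive1 f z = (z - w) ^+ m * (m.+1%:R * u z + (z - w) * derive1 u z).
    apply: derive1_cder.
    have D := cderM (gder_comp (cderB (cder_id z) (cder_cst w z)) (cderX m.+1 (z - w))) (ent_cder z hu).
    have := gderD D (cder_cst a z); rewrite subr0 mulr1 addr0 /=.
    have -> : m.+1%:R * (z - w) ^+ m * u z + (z - w) ^+ m.+1 * derive1 u z =
      (z - w) ^+ m * (m.+1%:R * u z + (z - w) * derive1 u z) by rewrite exprS; ring.
    congr (gder _ _ _ _); apply/funext => y; by rewrite -fE subrK.
  by rewrite !exprS; ring.
exists G => //; split => //.
apply: contrapT => H; have G0 z : G z = 0.
  by apply/eqP/negPn/negP => n; apply: H; exists z.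
have [] := ent_mul_eq0 hf1 hfkf; first by move=> z; rewrite GE G0 mulr0.
  by move=> E; have [z] := nconst; rewrite E eqxx.
by move=> E; have [z] := nfkf; rewrite E eqxx.
Qed.

Lemma logmax_derive1n i r (h : R) : 0 <= r -> 0 < h ->
  logmax (derive1n i f) r <= logmax f (r + i%:R * h) + i%:R * ln (1 + 2 / h).
Proof.
move=> r0 h0; elim: i r r0 => [|i IH] r r0; first by rewrite mul0r mul0r !addr0 derive1n0.
rewrite derive1nS; apply: (le_trans (logmax_derive1 (ent_derive1n i hf) r0 h0)).
have := IH (r + h) (addr_ge0 r0 (ltW h0)).
have -> : r + h + i%:R * h = r + i.+1%:R * h by rewrite -natr1; ring.
by rewrite -[i.+1%:R in X in _ -> _ <= _ + X]natr1 mulrDl mul1r; lra.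
Qed.

Lemma logmax_B g h r : ent g -> ent h -> 0 <= r ->
  logmax (fun z => g z - h z) r <= logmax g r + logmax h r.
Proof.
move=> hg hh r0; apply: logmax_le => // z zr.
have := logmax_ub hg zr; have := logmax_ub hh zr.
have : ln (1 + normc (g z - h z)) <= ln (1 + normc (g z)) + ln (1 + normc (h z)).
  have gz := normc_ge0 (g z); have hz := normc_ge0 (h z).
  rewrite -lnM ?posrE ?ltr_01D//.
  have -> : (1 + normc (g z)) * (1 + normc (h z)) =
    1 + (normc (g z) + normc (h z) + normc (g z) * normc (h z)) by ring.
  apply: ler_ln1; first exact: normc_ge0.
  by apply: (le_trans (ler_normcB _ _)); rewrite lerDl mulr_ge0.
by lra.
Qed.

(** The functions whose logarithmic derivatives are needed: for j <= k the bounds for the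
   derivatives of order j chain together to bound f^(k)/f, and f - a gives f'/(f - a). The
   second member only serves to make f^(k) - f nonzero on the circle. *)
Definition family i : R[i] -> R[i] :=
  match i with
  | 0%N => fun z => f z - a
  | 1%N => fun z => derive1n k f z - f z
  | j.+2 => derive1n j f
  end.

Lemma ent_family i : ent (family i).
Proof. by case: i => [|[|i]] //=; exact: ent_derive1n. Qed.

Lemma family_logmax i (Rd d Y : R) : (i < k.+3)%N -> 0 <= Rd -> 0 < d ->
  d^-1 <= Y -> logmax f (Rd + 5 * d) <= Y -> 3 + 2 * k%:R * k.+1%:R + normc a <= Y ->
  logmax (family i) (Rd + 4 * d) <= Y ^+ 2.
Proof.
move=> ik R0 d0 dY LY CY; have na := normc_ge0 a.
have kk : 0 <= 2 * k%:R * k.+1%:R :> R by rewrite !mulr_ge0 ?ler0n.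
have Y1 : 1 <= Y by move: CY; lra.
have Y0 : 0 < Y by move: Y1; lra.
have r0 : 0 <= Rd + 4 * d by rewrite addr_ge0// mulr_ge0// ltW.
have Lf : logmax f (Rd + 4 * d) <= Y.
  by apply: le_trans LY; apply: logmax_mono => //; move: d0; lra.
have D j : (j <= k)%N -> logmax (derive1n j f) (Rd + 4 * d) <= Y + 2 * k%:R * k.+1%:R * Y.
  move=> jk; have k1 : 0 < k.+1%:R :> R by rewrite ltr0n.
  have h0 : 0 < d / k.+1%:R by rewrite divr_gt0.
  apply: (le_trans (logmax_derive1n j r0 h0)); apply: lerD.
    apply: le_trans LY; apply: logmax_mono => //.
      by rewrite addr_ge0// mulr_ge0 ?ler0n// ltW.
    have : j%:R * (d / k.+1%:R) <= d.
      rewrite mulrCA ler_piMr ?(ltW d0)// ler_pdivrMr// mul1r ler_nat.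
      exact: leqW.
    have -> : Rd + 5 * d = Rd + 4 * d + d by ring.
    by move=> H; rewrite lerD2l.
  have -> : 2 * k%:R * k.+1%:R * Y = k%:R * (2 * k.+1%:R * Y) by ring.
  have e0 : 0 < 1 + 2 / (d / k.+1%:R) by rewrite ltr_01D// divr_ge0// ltW.
  apply: ler_pM; rewrite ?ler0n ?ler_nat//.
    by apply: ln1_ge0; rewrite divr_ge0// ltW.
  apply: (le_trans (ln_le_sub1 e0)); rewrite addrAC subrr add0r.
  have -> : 2 / (d / k.+1%:R) = 2 * k.+1%:R * d^-1 by field; rewrite !gt_eqF.
  by rewrite ler_pM2l// mulr_gt0.
have Q : 2 * Y + 2 * k%:R * k.+1%:R * Y + normc a <= Y ^+ 2.
  have : (3 + 2 * k%:R * k.+1%:R + normc a) * Y <= Y * Y by rewrite ler_pM2r.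
  have : normc a * 1 <= normc a * Y by rewrite ler_wpM2l.
  by rewrite expr2; move: Y0; lra.
have kY : 0 <= 2 * k%:R * k.+1%:R * Y by rewrite mulr_ge0// ltW.
case: i ik => [|[|j]] ik /=.
- apply: (le_trans (logmax_B hf (ent_cst a) r0)).
  have : logmax (fun=> a) (Rd + 4 * d) <= normc a.
    apply: logmax_le => // z _; apply: (le_trans (ln_le_sub1 _)); first exact: ltr_01D.
    by rewrite addrAC subrr add0r.
  by move: Lf Q Y0 kY; lra.
- apply: (le_trans (logmax_B hfk hf r0)); have := D k (leqnn k); move: Lf Q Y0 na; lra.
- have := D j ik; move: Q Y0 na; lra.
Qed.

End Shared_value.
End Estimate.

(** * Growth estimate for a function with few zeros *)

Section Main_estimate.
Variable R : realType.
Implicit Types (r x y b rho B : R) (z w p c : R[i]) (g h F : R[i] -> R[i]) (s : seq R[i]).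

Lemma rmean_affine (u v : R -> R) (x b c : R) : continuous u -> continuous v ->
  continuous (fun t => c + (x * u t + b * v t)) /\
  rmean (fun t => c + (x * u t + b * v t)) = c + (x * rmean u + b * rmean v).
Proof.
move=> cu cv.
have Z y (w : R -> R) : continuous w -> continuous (fun t => y * w t).
  by move=> cw t; apply: cvgM; [exact: cvg_cst|exact: cw].
have cD : continuous (fun t => x * u t + b * v t).
  by move=> t; apply: cvgD; [exact: Z cu t|exact: Z cv t].
split; first by move=> t; apply: cvgD; [exact: cvg_cst|exact: cD].
rewrite rmeanD ?rmean_cst//; last by move=> t; exact: cvg_cst.
by rewrite rmeanD ?rmeanZ//; exact: Z.
Qed.

Lemma ln1_circle_continuous f r : ent f -> 0 < r ->
  continuous (fun t => ln (1 + normc (f (circle r t)))).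
Proof.
move=> hf r0 t.
have c1 : continuous (fun t => 1 + normc (f (circle r t))).
  move=> u; apply: cvgD; first exact: cvg_cst.
  have rI : 0 < r < r + 1 by rewrite r0 ltrDl ltr01.
  exact: (rcont_normc (fun t => rcont_hol_circle t (ent_hol hf) rI)).
apply: continuous_cvg; last exact: c1.
by apply: continuous_ln; rewrite ltr_01D// normc_ge0.
Qed.

Lemma abs_ln_le x (X : R) n : 1 <= X -> X ^- n.+1 <= x -> x <= X ->
  `|ln x| <= n.+1%:R * ln X.
Proof.
move=> X1 lx xX; have X0 : 0 < X by exact: lt_le_trans X1.
have e0 : 0 < X ^- n.+1 by rewrite invr_gt0 exprn_gt0.
have x0 := lt_le_trans e0 lx; have l0 : 0 <= ln X by exact: ln_ge0.
rewrite ler_norml; apply/andP; split.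
  have : ln (X ^- n.+1) <= ln x by rewrite ler_ln.
  by rewrite lnV ?posrE ?exprn_gt0// lnXn// mulr_natl.
apply: (@le_trans _ _ (ln X)); first by rewrite ler_ln.
by rewrite ler_peMl// ler1n.
Qed.

Lemma sum_abs_ln_le s z (X : R) : 1 <= X ->
  (forall w, w \in s -> X ^- 6 <= normc (z - w) /\ normc (z - w) <= X) ->
  `|\sum_(w <- s) ln (normc (z - w))| <= (size s)%:R * (6 * ln X).
Proof.
move=> X1 H; apply: (le_trans (ler_norm_sum _ _ _)).
rewrite -sum1_size natr_sum mulr_suml big_seq [X in _ <= X]big_seq.
apply: ler_sum => w ws; have [h1 h2] := H w ws.
by rewrite mul1r; exact: abs_ln_le.
Qed.

(** Integrate the logarithm of the pointwise inequality (1 + |f|) |G| <= B |f|^2 over the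
   circle. The mean of ln |G| is bounded below by the Jensen formula, the mean of ln |f| is
   bounded above by [jensen_upper]; together they bound the mean of ln (1 + |f|), hence that of
   |ln |f||, hence that of |ln |F|| after removing the zeros. *)
Lemma circle_mean_estimate (f f1 G G1 F : R[i] -> R[i]) s m mG r rho (X B q Z : R) :
  ent f -> ent G1 -> ent F -> 0 < q ->
  (forall z, f z = z ^+ m * f1 z) -> (forall z, f1 z = zprod s z * F z) ->
  (forall w, w \in s -> w != 0) -> (forall z, normc z < rho -> F z != 0) ->
  (forall z, G z = z ^+ mG * G1 z) -> G1 0 != 0 ->
  1 <= r -> r < rho -> 1 <= X -> 1 <= B ->
  (forall z w, normc z = r -> w \in s -> X ^- 6 <= normc (z - w) /\ normc (z - w) <= X) ->
  (forall z, normc z = r -> [/\ f z != 0, G z != 0 &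
     (1 + normc (f z)) * normc (G z) <= B * normc (f z) ^+ 2]) ->
  \sum_(w <- s) normc w `^ (- q) <= Z ->
  rmean (fun t => `|ln (normc (F (circle r t)))|) <=
    2 * ln B - 2 * ln (normc (G1 0)) + 4 * (m%:R * ln r) +
    3 * (ln (normc (f1 0)) + q^-1 * (r `^ q * Z)) + (size s)%:R * (6 * ln X).
Proof.
move=> hf hG1 hF q0 fE f1E sn0 Fn0 GE g10 r1 rr X1 B1 Hs Hz HZ.
have r0 : 0 < r by exact: lt_le_trans r1.
have X0 : 0 < X by exact: lt_le_trans X1.
have cr t : normc (circle r t) = r by rewrite normc_circle// ltW.
have sr w : w \in s -> normc w != r.
  move=> ws; apply/eqP => wr; have [+ _] := Hs w w wr ws.
  by rewrite subrr normc0 leNgt invr_gt0 exprn_gt0.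
have [sG [FG [hFG FGn0 sGn0 G1E]]] := zero_list hG1 g10 (ltr_pwDl ltr01 (ltW r0)).
have sGr w : w \in sG -> normc w != r.
  move=> ws; apply/eqP => wr; have [_ + _] := Hz w wr.
  by rewrite GE G1E (_ : zprod sG w = 0) ?mul0r ?mulr0 ?eqxx//; apply/eqP; rewrite zprod_eq0.
have FGn z : normc z < 1 + r -> FG z != 0 by move=> /ltW; exact: FGn0.
have r1r : r < 1 + r by rewrite ltrDr.
have hFr := ent_hol (rho := rho) hF; have hFGr := ent_hol (rho := 1 + r) hFG.
have c1 := ln_circle_continuous hFr Fn0 f1E r0 rr sr.
have cG := ln_circle_continuous hFGr FGn G1E r0 r1r sGr.
have JG := jensen_lower hFGr FGn G1E (fun w ws => (sGn0 w ws).1) r0 r1r sGr.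
have J1 := jensen_upper hFr Fn0 f1E sn0 r0 rr sr q0.
have cU := ln1_circle_continuous hf r0.
have lr : 0 <= ln r by exact: ln_ge0.
set U := fun t => ln (1 + normc (f (circle r t))) in cU.
set L1 := fun t => ln (normc (f1 (circle r t))) in c1 J1.
set LG := fun t => ln (normc (G1 (circle r t))) in cG JG.
have lnf t : ln (normc (f (circle r t))) = m%:R * ln r + L1 t.
  have [fz _ _] := Hz _ (cr t); move: fz; rewrite fE mulf_eq0 negb_or => /andP[_ f1z].
  rewrite normcM lnM ?posrE ?normc_gt0// ?expf_neq0 ?circle_neq0//.
  by rewrite normcX cr lnXn// mulr_natl.
have lnG t : LG t <= ln (normc (G (circle r t))).
  have [_ Gz _] := Hz _ (cr t); move: Gz; rewrite GE mulf_eq0 negb_or => /andP[_ G1z].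
  rewrite normcM lnM ?posrE ?normc_gt0// ?expf_neq0 ?circle_neq0//.
  by rewrite normcX cr lnXn// lerDr mulrn_wge0.
(* r >= 1, so dropping the zeros of f and G at the origin costs only multiples of ln r *)
have pU t : U t <= (ln B + 2 * (m%:R * ln r)) + (2 * L1 t + (-1) * LG t).
  have [fz Gz] := Hz _ (cr t); have nf := ltr_01D (normc_ge0 (f (circle r t))).
  rewrite -normc_gt0 in fz; rewrite -normc_gt0 in Gz => H.
  have : ln ((1 + normc (f (circle r t))) * normc (G (circle r t))) <=
    ln (B * normc (f (circle r t)) ^+ 2) by rewrite ler_ln ?posrE ?mulr_gt0 ?exprn_gt0 ?(lt_le_trans _ B1).
  have B0 : 0 < B by exact: lt_le_trans B1.
  have -> : ln (B * normc (f (circle r t)) ^+ 2) = ln B + ln (normc (f (circle r t))) *+ 2.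
    by rewrite lnM ?posrE ?exprn_gt0// lnXn.
  rewrite lnM ?posrE// lnf -/(U t).
  by rewrite mulr2n; move: (lnG t); lra.
have [cA EA] := rmean_affine 2 (-1) (ln B + 2 * (m%:R * ln r)) c1 cG.
have MU := rmean_le cU cA pU; rewrite EA in MU.
have [cC EC] := rmean_affine 2 (-1) ((size s)%:R * (6 * ln X)) cU c1.
have rI : 0 < r < rho by rewrite r0.
have := rmean_le (log_abs_cont hFr rI Fn0) cC; rewrite EC => MF.
have qr : 0 <= q^-1 * r `^ q by rewrite mulr_ge0 ?invr_ge0 ?(ltW q0) ?powR_ge0.
apply: (le_trans (MF _)).
  move=> t; have zs := circle_notin_zeros r0 sr t.
  have zr : normc (circle r t) < rho by rewrite cr.
  have [fz _ _] := Hz _ (cr t).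
  have S := sum_abs_ln_le X1 (fun w ws => Hs _ w (cr t) ws).
  have E := ln_factor Fn0 f1E zs zr; rewrite -/(L1 t) in E.
  have u1 : ln (normc (f (circle r t))) <= U t.
    by rewrite ler_ln ?posrE ?normc_gt0 ?ltr_01D ?normc_ge0// lerDr.
  have u0 : 0 <= U t by apply: ln1_ge0; exact: normc_ge0.
  have mr : 0 <= m%:R * ln r by rewrite mulr_ge0 ?ler0n.
  move: S; rewrite ler_norml => /andP[S1 S2]; rewrite ler_norml.
  by move: (lnf t) u1; clear - S1 S2 E u0 mr; move=> *; apply/andP; split; lra.
have := ler_wpM2l qr HZ; rewrite -!mulrA => HZ'.
by move: MU JG J1 HZ'; lra.
Qed.

(** Inside the circle, the zero-free factor is bounded by [log_abs_bound], and the linear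
   factors trivially. *)
Lemma ln1_factor_le (f F : R[i] -> R[i]) s m r rho z (X A e : R) :
  hol F rho -> (forall z, normc z < rho -> F z != 0) ->
  (forall z, f z = z ^+ m * (zprod s z * F z)) ->
  1 <= r -> r < rho -> 1 <= X -> normc z < r -> (forall w, w \in s -> normc (z - w) <= X) ->
  rmean (fun t => `|ln (normc (F (circle r t)))|) <= A -> r / (r - normc z) <= e ->
  ln (1 + normc (f z)) <= 1 + m%:R * ln r + (size s)%:R * ln X + 5 * e * A.
Proof.
move=> hF Fn0 fE r1 rr X1 zr zs MA re.
have r0 : 0 < r by exact: lt_le_trans r1.
have X0 : 0 < X by exact: lt_le_trans X1.
have rI : 0 < r < rho by rewrite r0.
have Mge := le_trans (normr_ge0 _) (log_abs_mean_ge hF rI Fn0).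
have rz : 0 <= r / (r - normc z) by rewrite divr_ge0 ?subr_ge0 ?(ltW r0) ?(ltW zr).
have Fz : normc (F z) <= expR (5 * e * A).
  have nF : 0 < normc (F z) by rewrite normc_gt0 Fn0// (lt_trans zr).
  rewrite -{1}[normc (F z)]lnK ?posrE// ler_expR.
  apply: (le_trans (ler_norm _)); apply: (le_trans (log_abs_bound hF rI Fn0 zr)).
  by rewrite -[5 * e * A]mulrA -[X in X <= _]mulrA ler_pM2l//; apply: ler_pM.
have B0 : 0 <= 5 * e * A.
  exact: mulr_ge0 (mulr_ge0 _ (le_trans rz re)) (le_trans Mge MA).
set P := r ^+ m * (X ^+ size s * expR (5 * e * A)).
have fP : normc (f z) <= P.
  rewrite fE !normcM normcX /P; apply: ler_pM.
  - by rewrite exprn_ge0 ?normc_ge0.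
  - by rewrite mulr_ge0 ?normc_ge0.
  - by apply: lerXn2r; rewrite ?nnegrE ?normc_ge0 ?ltW.
  - apply: ler_pM; rewrite ?normc_ge0//.
    by apply: normc_zprod_le => //; exact: ltW.
have P1 : 1 <= P.
  rewrite /P mulr_ege1 ?exprn_ege1// mulr_ege1 ?exprn_ege1//.
  by apply: le_trans (expR_ge1Dx _); rewrite lerDl.
have P0 : 0 < P by exact: lt_le_trans P1.
have lP : ln P = m%:R * ln r + (size s)%:R * ln X + 5 * e * A.
  rewrite /P lnM ?posrE ?mulr_gt0 ?exprn_gt0 ?expR_gt0//.
  by rewrite lnM ?posrE ?exprn_gt0 ?expR_gt0// expRK !lnXn// !mulr_natl addrA.
have l2 : ln (2 : R) <= 1.
  apply: (le_trans (ln_le_sub1 _)) => //; lra.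
apply: (@le_trans _ _ (ln (2 * P))).
  rewrite ler_ln ?posrE ?(mulr_gt0 _ P0) ?(ltr_01D (normc_ge0 _))//.
  by rewrite mulr_natl mulr2n lerD.
by rewrite lnM ?posrE// lP; move: l2; lra.
Qed.

Section Shared_pointwise.
Variables (f G : R[i] -> R[i]) (k : nat) (a : R[i]).
Hypotheses (hf : ent f) (a0 : a != 0) (k0 : (0 < k)%N).
Hypothesis nconst : exists z, derive1 f z != 0.
Hypothesis nfix : exists z, derive1n k f z != f z.
Hypothesis GE : forall z, derive1 f z * (derive1n k f z - f z) = (f z - a) * G z.

(** Since f' and f^(k) are O(|f|) on the circle, (f - a) G = f' (f^(k) - f) is O(|f|^2), and
   since f' is also O(|f - a|), G itself is O(|f|). The identity a G = f G - (f - a) G then makes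
   G, and not only f G, of second order in |f|. *)
Lemma shared_pointwise z (Q : R) : 1 <= Q ->
  (forall i, (i < k.+3)%N -> logder_le (family f k a i) z Q /\
     (family f k a i z = 0 -> forall u, family f k a i u = 0)) ->
  [/\ f z != 0, G z != 0 & (1 + normc (f z)) * normc (G z) <=
     (4 / normc a + 2) * Q ^+ k.+1 * normc (f z) ^+ 2].
Proof.
move=> Q1 H; have Q0 : 0 <= Q by apply: le_trans Q1.
have na : 0 < normc a by rewrite normc_gt0.
have D i : (i <= k)%N -> normc (derive1n i.+1 f z) <= Q * normc (derive1n i f z).
  move=> ik; have [[l dl lB] _] := H i.+2 ik.
  by rewrite derive1nS (derive1_cder dl).
have Dk : normc (derive1n k f z) <= Q ^+ k * normc (f z).
  suff : forall j, (j <= k)%N -> normc (derive1n j f z) <= Q ^+ j * normc (f z) by exact.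
  elim=> [|j IH] jk; first by rewrite derive1n0 expr0 mul1r.
  apply: (le_trans (D j (ltnW jk))); rewrite exprS -mulrA ler_wpM2l//.
  exact: IH (ltnW jk).
have D1 : normc (derive1 f z) <= Q * normc (f z) by have := D 0%N (leq0n k).
have [[l dl lB] fa0] := H 0%N isT.
have D2 : normc (derive1 f z) <= Q * normc (f z - a).
  have := gderD dl (cder_cst a z); rewrite addr0 /= => E.
  have {}E : cder f z l.
    by move: E; congr (gder _ _ _ _); apply/funext => u; rewrite subrK.
  by rewrite (derive1_cder E).
have [_ fk0] := H 1%N isT.
have [_ f0] := H 2%N isT.
have fz : f z != 0.
  apply/eqP => fz; have [u] := nconst; rewrite (_ : f = fun=> 0).
    by rewrite (derive1_cder (cder_cst 0 u)) eqxx.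
  by apply/funext => u'; apply: f0.
have faz : f z - a != 0.
  apply/eqP => /fa0 E; have [u] := nconst; rewrite (_ : f = fun=> a).
    by rewrite (derive1_cder (cder_cst a u)) eqxx.
  by apply/funext => u'; apply/eqP; rewrite -subr_eq0; apply/eqP; apply: E.
have fkz : derive1n k f z - f z != 0.
  apply/eqP => /fk0 E; have [u] := nfix; rewrite -subr_eq0.
  by have /= -> := E u; rewrite eqxx.
have f1z : derive1 f z != 0.
  have k3 : (3 < k.+3)%N by rewrite !ltnS.
  have [_ f1] := H 3%N k3.
  by apply/eqP => /f1 E; have [u] := nconst; have /= -> := E u; rewrite eqxx.
have Gz : G z != 0.
  by apply/eqP => E; have := GE z; rewrite E mulr0 => /eqP; rewrite mulf_eq0 (negbTE f1z) (negbTE fkz).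
split => //.
have q : normc (derive1n k f z - f z) <= 2 * Q ^+ k * normc (f z).
  apply: (le_trans (ler_normcB _ _)).
  have : 1 * normc (f z) <= Q ^+ k * normc (f z) by rewrite ler_wpM2r ?normc_ge0// exprn_ege1.
  by move: Dk; lra.
have E : normc (derive1 f z) * normc (derive1n k f z - f z) = normc (f z - a) * normc (G z).
  by rewrite -!normcM GE.
have h1 : normc (G z) <= 2 * Q ^+ k.+1 * normc (f z).
  rewrite -(ler_pM2l (x := normc (f z - a))) ?normc_gt0// -E.
  have -> : normc (f z - a) * (2 * Q ^+ k.+1 * normc (f z)) =
    Q * normc (f z - a) * (2 * Q ^+ k * normc (f z)) by rewrite exprS; ring.
  by apply: ler_pM; rewrite ?normc_ge0.
have h2 : normc (f z - a) * normc (G z) <= 2 * Q ^+ k.+1 * normc (f z) ^+ 2.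
  rewrite -E; have -> : 2 * Q ^+ k.+1 * normc (f z) ^+ 2 =
    Q * normc (f z) * (2 * Q ^+ k * normc (f z)) by rewrite exprS; ring.
  by apply: ler_pM; rewrite ?normc_ge0.
have h3 : normc (f z) * normc (G z) <= 2 * Q ^+ k.+1 * normc (f z) ^+ 2.
  have -> : 2 * Q ^+ k.+1 * normc (f z) ^+ 2 =
    normc (f z) * (2 * Q ^+ k.+1 * normc (f z)) by ring.
  by rewrite ler_wpM2l ?normc_ge0.
have h4 : normc a * normc (G z) <= 4 * Q ^+ k.+1 * normc (f z) ^+ 2.
  have : normc a <= normc (f z) + normc (f z - a).
    have -> : normc a = normc (f z - (f z - a)) by rewrite opprB addrCA subrr addr0.
    exact: ler_normcB.
  move=> /(ler_wpM2r (normc_ge0 (G z))); move: h2 h3; lra.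
have h5 : normc (G z) <= 4 / normc a * Q ^+ k.+1 * normc (f z) ^+ 2.
  rewrite -(ler_pM2l na); apply: (le_trans h4).
  by rewrite le_eqVlt; apply/orP; left; apply/eqP; field; rewrite gt_eqF.
by move: h3 h5; lra.
Qed.


End Shared_pointwise.

Lemma size_le_sum s rho q (Z : R) : 0 < q -> 0 < rho -> (forall w, w \in s -> w != 0 /\ normc w <= rho) ->
  \sum_(w <- s) normc w `^ (- q) <= Z -> (size s)%:R <= rho `^ q * Z.
Proof.
move=> q0 rho0 Hs HZ.
rewrite -ler_pdivrMl ?powR_gt0// -powRN; apply: le_trans HZ.
rewrite -sum1_size natr_sum mulr_sumr big_seq [X in _ <= X]big_seq.
apply: ler_sum => w ws; have [w0 wr] := Hs w ws; rewrite -normc_gt0 in w0.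
by rewrite mulr1 !powRN lef_pV2 ?posrE ?powR_gt0// ge0_ler_powR// ?nnegrE ?ltW.
Qed.

(** If f^(k) differs from [f], then the growth of [f] on a disc is bounded by r^q, up to the
   logarithm of the growth on a slightly larger disc and the inverse of the relative gap d. The
   circle is found by [good_circle] in a ring of relative width d; X = Y^2 absorbs the constants. *)
Lemma main_estimate (f : R[i] -> R[i]) k a q (Z : R) :
  ent f -> a != 0 -> (0 < k)%N -> (forall z, f z = a -> derive1n k f z = a) ->
  (exists z, derive1 f z != 0) -> (exists z, derive1n k f z != f z) -> 0 < q -> 0 <= Z ->
  (forall s F m, ent F -> (forall z, f z = z ^+ m * (zprod s z * F z)) ->
    (forall w, w \in s -> w != 0) -> \sum_(w <- s) normc w `^ (- q) <= Z) ->
  exists2 C, 1 <= C & forall r0 d Y, 1 <= r0 -> 0 < d -> d <= 1 ->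
  C <= Y -> r0 <= Y -> d^-1 <= Y -> logmax f (r0 * (1 + 6 * d)) <= Y ->
  logmax f r0 <= C / d * (r0 `^ q * ln Y).
Proof.
move=> hf a0 k0 share nconst nfix q0 Z0 Hsum.
have [G hG [GE nG]] := shared_quotient hf share nconst nfix.
have nf : exists z, f z != 0.
  have [z] := nconst => H; apply: contrapT => N; move: H.
  rewrite (_ : f = fun=> 0) ?(derive1_cder (cder_cst 0 z)) ?eqxx//.
  by apply/funext => u; apply/eqP/negPn/negP => fu; apply: N; exists u.
have na : 0 < normc a by rewrite normc_gt0.
have [Cf [m [f1 [[Cf20 _ _ hf1 f10] [fE Df]]]]] := zero_data hf nf.
have [mG [G1 [hG1 g10 GE1]]] := ent_factor 0 hG nG.
have {}GE1 z : G z = z ^+ mG * G1 z by rewrite GE1 subr0.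
have [Cg Cg20 Hg] := good_circle (fun i (_ : (i < k.+3)%N) => ent_family k a hf i).
pose cf := ln (normc (f1 0)); pose cG := ln (normc (G1 0)).
pose kb := ln (4 / normc a + 2).
(* C1 collects the constants of circle_mean_estimate, using ln X >= 1/2 and r0^q >= 1 *)
pose C1 := 4 * kb + 24 * k.+1%:R + 4 * `|cG| + 4 * m%:R + 6 * `|cf| +
  6 * (q^-1 * (3 `^ q * Z)) + 6 * (5 `^ q * Z).
pose C2 := 2 * (2 + m%:R + 5 `^ q * Z + 15 * C1).
pose C3 := 3 + 2 * k%:R * k.+1%:R + normc a.
pose C := Num.max (Num.max Cf Cg) (Num.max C2 C3).
have [CCf CCg CC2 CC3] : [/\ Cf <= C, Cg <= C, C2 <= C & C3 <= C].
  by rewrite /C !le_max !lexx !orbT.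
exists C; first by apply: le_trans CCf; apply: le_trans Cf20; rewrite ler1n.
move=> r0 d Y r01 d0 d1 CY rY dY LY.
have r00 : 0 < r0 by exact: lt_le_trans r01.
have Y20 : 20 <= Y by apply: le_trans CY; exact: le_trans CCf.
have Y1 : 1 <= Y by apply: le_trans Y20; rewrite ler1n.
have Y0 : 0 < Y by exact: lt_le_trans Y1.
pose X := Y ^+ 2; pose e := r0 * d; pose Rd := r0 + e.
have YX : 20 * Y <= X by rewrite /X expr2 ler_pM2r.
have X1 : 1 <= X by rewrite exprn_ege1.
have X0 : 0 < X by exact: lt_le_trans X1.
have e0 : 0 < e by rewrite mulr_gt0.
have er : e <= r0 by rewrite /e ler_piMr// ltW.
have eX : e^-1 <= X.
  have : e^-1 <= Y.
    apply: le_trans dY; rewrite lef_pV2 ?posrE//.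
    by rewrite /e ler_peMl// ltW.
  by move: YX Y0; clear; lra.
have E6 : Rd + 5 * e = r0 * (1 + 6 * d) by rewrite /Rd /e; ring.
have Rd1 : 1 <= Rd by rewrite /Rd; move: r01 e0; clear; lra.
have eRd : e <= Rd by rewrite /Rd; move: r00; clear; lra.
have RdX : Rd <= X by rewrite /Rd; move: er rY YX r00; clear; lra.
have ok i : (i < k.+3)%N -> scale_ok (family f k a i) Rd e X.
  move=> ik; split => //; split => //.
  apply: (family_logmax hf ik (le_trans ler01 Rd1) e0); last exact: le_trans CY.
    apply: le_trans dY; rewrite lef_pV2 ?posrE//.
    by rewrite /e ler_peMl// ltW.
  by rewrite E6.
have okf : scale_ok f Rd e X by have := ok 2%N isT.
have CfX : Cf <= X by move: (le_trans CCf CY) YX Y0; clear; lra.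
have CgX : Cg <= X by move: (le_trans CCg CY) YX Y0; clear; lra.
have [s [F [[hF Fn0 sr f1E] [sX _ _]]]] := Df Rd e X CfX okf.
have [|r [rI rs Hr]] := Hg Rd e X [seq normc w | w <- s] CgX ok e0 eX; first by rewrite size_map.
have [rl ru] := andP rI.
have r1 : 1 <= r by exact: le_trans rl.
have rR : r < Rd + 3 * e by move: ru e0; clear; lra.
have Fn z : normc z < Rd + 3 * e -> F z != 0 by move=> /ltW; exact: Fn0.
have R3 : Rd + 3 * e <= 5 * r0 by rewrite /Rd; move: er; clear; lra.
have r3 : r <= 3 * r0 by move: ru er; rewrite /Rd; clear; lra.
have fE' z : f z = z ^+ m * (zprod s z * F z) by rewrite fE f1E.
have HZ := Hsum s F m hF fE' (fun w ws => (sr w ws).1).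
have R30 : 0 < Rd + 3 * e by apply: lt_trans rR; exact: lt_le_trans r1.
have nZ : (size s)%:R <= 5 `^ q * Z * r0 `^ q.
  apply: (le_trans (size_le_sum q0 R30 sr HZ)).
  rewrite mulrAC; apply: ler_wpM2r => //.
  rewrite -powRM ?(ltW r00)//; apply: ge0_ler_powR => //; rewrite ?nnegrE ?mulr_ge0 ?(ltW q0) ?(ltW r00) ?(ltW R30)//.
have Hs z w : normc z <= r -> w \in s -> normc (z - w) <= X.
  move=> zr ws; have [_ wR] := sr w ws; apply: (le_trans (ler_normcB _ _)).
  by move: zr wR R3 r3 rY YX r00; clear; lra.
pose Q := X ^+ 12.
have Q1 : 1 <= Q by rewrite exprn_ege1.
pose B := (4 / normc a + 2) * Q ^+ k.+1.
have b1 : 1 <= 4 / normc a + 2.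
  have : 0 <= 4 / normc a by rewrite divr_ge0// ltW.
  by clear; lra.
have B1 : 1 <= B by rewrite mulr_ege1// exprn_ege1.
have lnB : ln B = kb + 12 * k.+1%:R * ln X.
  have Q0 : 0 < Q by exact: lt_le_trans Q1.
  rewrite /B lnM ?posrE ?exprn_gt0// ?(lt_le_trans _ b1)//.
  have lnQ : ln Q = 12 * ln X by rewrite /Q lnXn// mulr_natl.
  by rewrite lnXn// lnQ -[_ *+ k.+1]mulr_natl /kb; ring.
have kb0 : 0 <= kb by apply: ln_ge0.
pose A := 2 * ln B - 2 * cG + 4 * (m%:R * ln r) + 3 * (cf + q^-1 * (r `^ q * Z)) +
  (size s)%:R * (6 * ln X).
have MA : rmean (fun t => `|ln (normc (F (circle r t)))|) <= A.
  apply: (circle_mean_estimate (G := G) hf hG1 hF q0 fE f1E _ Fn GE1 g10 r1 rR X1 B1) => //.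
  - by move=> w /sr[].
  - move=> z w zr ws; split; last by apply: Hs; rewrite ?zr.
    apply: (le_trans (rs _ (map_f _ ws))).
    rewrite -zr ler_norml lerNl opprB [normc (z - w)]distcC ler_distc distcC.
    by rewrite ler_distc.
  - by move=> z zr; apply: shared_pointwise => // i ik; exact: Hr.
have lX : 1 / 2 <= ln X.
  have := @ln_le_sub1 _ X^-1; rewrite lnV ?posrE// invr_gt0 => /(_ X0).
  have : X^-1 <= 1 / 2 by rewrite ler_pdivlMr// mulrC ler_pdivrMr// mul1r; move: YX Y1; clear; lra.
  by clear; lra.
pose T := r0 `^ q * ln X.
have rq1 : 1 <= r0 `^ q.
  have -> : 1 = 1 `^ q :> R by rewrite powR1.
  by apply: ge0_ler_powR; rewrite ?nnegrE ?(ltW q0) ?(ltW r00).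
have T1 : ln X <= T by rewrite /T ler_peMl//; move: lX; clear; lra.
have T2 : r0 `^ q <= 2 * T.
  have : r0 `^ q * (1 / 2) <= T by rewrite /T ler_wpM2l// powR_ge0.
  by clear; lra.
have lrX : ln r <= ln X.
  rewrite ler_ln ?posrE ?(lt_le_trans _ r1)//; move: r3 rY YX Y1 r00; clear; lra.
have T0 : 0 <= T by rewrite mulr_ge0 ?powR_ge0//; move: lX; clear; lra.
have AT : A <= C1 * T.
  have rqZ : r `^ q * Z <= 3 `^ q * Z * (2 * T).
    rewrite mulrAC ler_wpM2r//.
    apply: le_trans (_ : 3 `^ q * r0 `^ q <= _); last by rewrite ler_wpM2l ?powR_ge0.
    rewrite -powRM ?(ltW r00)//; apply: ge0_ler_powR; rewrite ?nnegrE ?(ltW q0)//.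
      exact: le_trans r1.
    by rewrite mulr_ge0// ltW.
  have iq : 0 <= q^-1 by rewrite invr_ge0 ltW.
  have h1 := ler_wpM2l iq rqZ.
  have nT : (size s)%:R * ln X <= 5 `^ q * Z * T.
    rewrite /T mulrA ler_wpM2r//; move: lX; clear; lra.
  have m0 : 0 <= m%:R * (T - ln r).
    by rewrite mulr_ge0 ?ler0n ?subr_ge0// (le_trans lrX).
  have k1 : 0 <= k.+1%:R * (T - ln X) by rewrite mulr_ge0 ?ler0n ?subr_ge0.
  have g1 : 0 <= (`|cG| + cG) + `|cG| * (2 * T - 1).
    have : 0 <= `|cG| * (2 * T - 1).
      by rewrite mulr_ge0//; move: T1 lX; clear; lra.
    by have := ler_norm (- cG); rewrite normrN; clear; lra.
  have f2 : cf <= `|cf| * (2 * T).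
    have : 0 <= `|cf| * (2 * T - 1).
      by rewrite mulr_ge0//; move: T1 lX; clear; lra.
    by have := ler_norm cf; clear; lra.
  have b2 : 0 <= kb * (2 * T - 1).
    by rewrite mulr_ge0//; move: T1 lX; clear; lra.
  rewrite /A /C1 lnB; move: h1 nT m0 k1 g1 f2 b2 T0; clear.
  lra.
have nT : (size s)%:R * ln X <= 5 `^ q * Z * T.
  rewrite /T mulrA ler_wpM2r//; move: lX; clear; lra.
have C10 : 0 <= C1.
  by rewrite /C1 !addr_ge0// !mulr_ge0// ?ler0n ?powR_ge0 ?invr_ge0 ?(ltW q0).
apply: (@le_trans _ _ (C2 / d * (r0 `^ q * ln Y))); last first.
  rewrite ler_wpM2r ?ler_pM2r ?invr_gt0// mulr_ge0 ?powR_ge0//.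
  by apply: ln_ge0.
have TE : T = 2 * (r0 `^ q * ln Y) by rewrite /T /X lnXn// mulr2n; ring.
have -> : C2 / d * (r0 `^ q * ln Y) = (2 + m%:R + 5 `^ q * Z + 15 * C1) * d^-1 * T.
  by rewrite TE /C2; ring.
apply: logmax_le => [|z zr]; first exact: ltW.
have zr' : normc z < r.
  by apply: (le_lt_trans zr); apply: lt_le_trans rl; rewrite /Rd ltrDl.
have re : r / (r - normc z) <= 3 / d.
  apply: (@le_trans _ _ (3 * r0 / e)).
    apply: ler_pM; rewrite ?invr_ge0 ?subr_ge0 ?(ltW zr') ?(le_trans ler01)//.
    rewrite lef_pV2 ?posrE ?subr_gt0//.
    by move: rl zr; rewrite /Rd; clear; lra.
  by rewrite le_eqVlt; apply/orP; left; apply/eqP; rewrite /e; field; rewrite !gt_eqF.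
have := ln1_factor_le (ent_hol hF) Fn fE' r1 rR X1 zr' _ (le_trans MA AT) re.
move=> /(_ (fun w ws => Hs z w (ltW zr') ws)) H; apply: (le_trans H).
have d1' : 1 <= d^-1 by rewrite -[X in X <= _]invr1 lef_pV2 ?posrE.
have m0 : 0 <= m%:R * (T - ln r).
  by rewrite mulr_ge0 ?ler0n ?subr_ge0// (le_trans lrX).
have P0 : 0 <= 2 + m%:R + 5 `^ q * Z.
  by rewrite !addr_ge0 ?ler0n// mulr_ge0 ?powR_ge0.
have := mulr_ge0 (mulr_ge0 P0 T0) (_ : 0 <= d^-1 - 1); rewrite subr_ge0 => /(_ d1').
by move: m0 nT T1 lX; clear; lra.
Qed.

End Main_estimate.

(** * A growth lemma *)

Section Growth.
Variable R : realType.
Implicit Types (r x y q s e : R) (L : R -> R).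

Lemma ln_le_powR x e : 0 < e -> 1 <= x -> ln x <= e^-1 * x `^ e.
Proof.
move=> e0 x1; have x0 : 0 < x by exact: lt_le_trans x1.
rewrite -(ler_pM2l e0) mulrA mulfV ?gt_eqF// mul1r -ln_powR.
by apply: ln_le_id; rewrite powR_gt0.
Qed.

Lemma powR_mono s x y : 0 <= s -> 0 <= x -> x <= y -> x `^ s <= y `^ s.
Proof.
by move=> s0 x0 xy; apply: ge0_ler_powR => //; rewrite nnegrE// (le_trans x0).
Qed.

Lemma powR_ge1 s x : 0 <= s -> 1 <= x -> 1 <= x `^ s.
Proof.
by move=> s0 x1; have := powR_mono s0 ler01 x1; rewrite powR1.
Qed.

(** Suppose L(r) >= r^s at a large radius r0, and apply the hypothesis with relative gap
   d = L(r)^-e, where e is a third of 1 - q/s. If L did not grow by the factor A between r and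
   r (1 + 6 d), the hypothesis would give L(r) <= C L(r)^(e + q/s) ln L(r), which is false for
   large L(r). So L grows by the factor A over and over again, while the gaps decrease
   geometrically and the radii never exceed 2 r0: then L(2 r0) would be infinite. *)
Lemma growth_contradiction L q s (C : R) : 0 < q -> q < s -> 1 <= C ->
  (forall r r', 0 <= r -> r <= r' -> L r <= L r') ->
  (forall r0 d Y, 1 <= r0 -> 0 < d -> d <= 1 -> C <= Y -> r0 <= Y -> d^-1 <= Y ->
     L (r0 * (1 + 6 * d)) <= Y -> L r0 <= C / d * (r0 `^ q * ln Y)) ->
  (forall M : R, exists2 r, M <= r & r `^ s <= L r) -> False.
Proof.
move=> q0 qs C1 Lm H big; have s0 := lt_trans q0 qs.
pose e := (1 - q / s) / 3.
have qs1 : 0 < q / s < 1 by rewrite divr_gt0//= ltr_pdivrMr// mul1r.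
have [qs_gt0 qs_lt1] := andP qs1.
have e0 : 0 < e by rewrite divr_gt0// subr_gt0.
have e1 : e <= 1 by rewrite /e; move: qs_gt0; clear; lra.
(* the exponent p makes x^p dominate both x and the radius, whatever the size of s *)
pose p := 1 + s^-1.
have si : 0 < s^-1 by rewrite invr_gt0.
(* A^e = 2, so that the gaps L^-e are halved at each step *)
pose A := 2 `^ e^-1.
have A2 : 2 <= A.
  rewrite -[X in X <= _]powRr1// /A; apply: ler_powR; first by rewrite ler1n.
  by rewrite -[X in X <= _]invr1 lef_pV2 ?posrE.
have A0 : 0 < A by exact: lt_le_trans A2.
have lA : 0 <= ln A by apply: ln_ge0; apply: le_trans A2; rewrite ler1n.
pose K := C * 2 `^ q * (ln A + p / e).
(* 24 = 2 * 12: a gap moves the radius by at most 12 r0 / L^e, and the sum of all moves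
   must stay below r0 *)
pose N := Num.max (Num.max C 24) (K + 1).
have [NC N24 NK] : [/\ C <= N, 24 <= N & K + 1 <= N].
  by rewrite /N !le_max !lexx ?orbT.
have N1 : 1 <= N by exact: le_trans NC.
have N0 : 0 < N by exact: lt_le_trans N1.
have [r0 r0M Lr0] := big (N `^ (s * e)^-1).
have se0 : 0 < s * e by rewrite mulr_gt0.
have r01 : 1 <= r0.
  by apply: le_trans r0M; apply: powR_ge1 => //; rewrite invr_ge0 ltW.
have r00 : 0 < r0 by exact: lt_le_trans r01.
set La := r0 `^ s in Lr0.
have La1 : 1 <= La by apply: powR_ge1 => //; exact: ltW.
have La0 : 0 < La by exact: lt_le_trans La1.
have LaN : N <= La `^ e.
  rewrite /La -powRrM.
  have -> : N = (N `^ (s * e)^-1) `^ (s * e) by rewrite -powRrM mulVf ?gt_eqF// powRr1// ltW.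
  by apply: powR_mono r0M; rewrite ?powR_ge0// ltW.
have pe x : 1 <= x -> x `^ e <= x.
  by move=> x1; rewrite -[X in _ <= X]powRr1 ?ler_powR// (le_trans _ x1).
have LaC : C <= La by apply: (le_trans NC); apply: (le_trans LaN); exact: pe.
have step r : r0 <= r -> r <= 2 * r0 -> La <= L r ->
    A * L r <= L (r * (1 + 6 * (L r `^ e)^-1)).
  move=> rl ru; set x := L r => xL.
  have x1 : 1 <= x by exact: le_trans xL.
  have x0 : 0 < x by exact: lt_le_trans x1.
  have xe1 : 1 <= x `^ e by apply: powR_ge1 => //; exact: ltW.
  have xe0 : 0 < x `^ e by exact: lt_le_trans xe1.
  have xN : N <= x `^ e.
    by apply: (le_trans LaN); apply: powR_mono xL; exact: ltW.
  rewrite leNgt; apply/negP => Ly.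
  have xs : r0 <= x `^ s^-1.
    have -> : r0 = La `^ s^-1 by rewrite /La -powRrM mulfV ?gt_eqF// powRr1// ltW.
    by apply: powR_mono xL; exact: ltW.
  have xp : x <= x `^ p.
    by rewrite -[X in X <= _]powRr1 ?(ltW x0)// ler_powR// /p lerDl ltW.
  have xp' : x `^ s^-1 <= x `^ p by rewrite ler_powR// /p lerDr.
  have Yx : A * x <= A * x `^ p by rewrite ler_pM2l.
  have Y0 : 0 < x `^ p by rewrite powR_gt0.
  have xA : x <= A * x.
    by rewrite ler_peMl ?(ltW x0)// (le_trans _ A2)// ler1n.
  have := H r (x `^ e)^-1 (A * x `^ p) (le_trans r01 rl).
  rewrite invr_gt0 invrK invf_le1// => /(_ xe0 xe1).
  have h1 : C <= A * x `^ p.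
    by apply: (le_trans LaC); apply: (le_trans xL); exact: le_trans Yx.
  have h2 : r <= A * x `^ p.
    by apply: (le_trans ru); apply: ler_pM => //; [exact: ltW|exact: le_trans xp'].
  have h3 : x `^ e <= A * x `^ p by apply: (le_trans (pe _ x1)); exact: le_trans Yx.
  have h4 : L (r * (1 + 6 * (x `^ e)^-1)) <= A * x `^ p by exact: (le_trans (ltW Ly)).
  move=> /(_ h1 h2 h3 h4); rewrite -/x.
  rewrite lnM ?posrE// ln_powR => Hx.
  have lx : 0 <= ln x by exact: ln_ge0.
  have p0 : 0 <= p by rewrite /p addr_ge0// ltW.
  have l1 : ln A + p * ln x <= (ln A + p / e) * x `^ e.
    rewrite [X in _ <= X]mulrDl; apply: lerD; first by rewrite ler_peMr.
    by rewrite -mulrA ler_wpM2l//; exact: ln_le_powR.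
  have rq : r `^ q <= 2 `^ q * x `^ (q / s).
    have -> : x `^ (q / s) = (x `^ s^-1) `^ q by rewrite -powRrM mulrC.
    rewrite -powRM ?powR_ge0//; apply: powR_mono; rewrite ?(ltW q0)//.
      exact: le_trans (ltW r00) rl.
    by apply: (le_trans ru); rewrite ler_pM2l.
  have : x <= K * (x `^ e * (x `^ (q / s) * x `^ e)).
    apply: (le_trans Hx).
    have -> : K * (x `^ e * (x `^ (q / s) * x `^ e)) =
      C * x `^ e * (2 `^ q * x `^ (q / s) * ((ln A + p / e) * x `^ e)) by rewrite /K; ring.
    rewrite ler_wpM2l ?mulr_ge0 ?(ltW xe0) ?(le_trans ler01)//.
    apply: ler_pM => //; first exact: powR_ge0.
    by rewrite addr_ge0// mulr_ge0.
  have pD u v : x `^ u * x `^ v = x `^ (u + v).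
    by rewrite powRD// (gt_eqF x0) implybT.
  rewrite !pD.
  have xE : x = x `^ e * x `^ (e + (q / s + e)).
    have -> : x `^ e * x `^ (e + (q / s + e)) = x `^ (3 * e + q / s).
      by rewrite pD; congr (_ `^ _); ring.
    have -> : 3 * e + q / s = 1 by rewrite /e; field; rewrite gt_eqF.
    by rewrite powRr1// ltW.
  rewrite {1}xE ler_pM2r ?powR_gt0// => xK.
  by move: xK xN NK; clear; lra.
have iter n : exists r, [/\ r0 <= r, r <= r0 * (2 - 2 ^- n) & A ^+ n * La <= L r].
  elim: n => [|n [r [rl ru rL]]].
    exists r0; split => //; last by rewrite expr0 mul1r.
    by rewrite expr0 invr1 -[X in _ - X]mulr1n -natrB// mulr1.
  have p2 : 0 < 2 ^- n :> R by rewrite invr_gt0 exprn_gt0.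
  have An : 1 <= A ^+ n by rewrite exprn_ege1// (le_trans _ A2)// ler1n.
  have xLa : La <= L r by apply: le_trans rL; rewrite ler_peMl// ltW.
  have x0 : 0 < L r by exact: lt_le_trans xLa.
  have ru2 : r <= 2 * r0.
    by apply: (le_trans ru); rewrite mulrC ler_pM2r// lerBlDr lerDl ltW.
  have St := step r rl ru2 xLa.
  have d24 : (L r `^ e)^-1 <= 2 ^- n / 24.
    have En : (A ^+ n) `^ e = 2 ^+ n.
      rewrite -powR_mulrn ?(ltW A0)// /A -!powRrM mulrA mulrAC mulVf ?gt_eqF// mul1r.
      by rewrite powR_mulrn.
    rewrite -invfM lef_pV2 ?posrE ?powR_gt0 ?mulr_gt0 ?exprn_gt0//.
    apply: (@le_trans _ _ ((A ^+ n * La) `^ e)).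
      rewrite powRM ?exprn_ge0 ?(ltW A0) ?(ltW La0)// En.
      by rewrite ler_pM2l ?exprn_gt0// (le_trans N24).
    by apply: powR_mono rL; rewrite ?(ltW e0)// mulr_ge0 ?exprn_ge0// ltW.
  exists (r * (1 + 6 * (L r `^ e)^-1)); split.
  - apply: (le_trans rl); rewrite ler_peMr ?(le_trans _ rl) ?(ltW r00)//.
    by rewrite lerDl mulr_ge0// invr_ge0 powR_ge0.
  - have h : r * (L r `^ e)^-1 <= 2 * r0 * (2 ^- n / 24).
      by apply: ler_pM; rewrite ?invr_ge0 ?powR_ge0 ?(le_trans _ rl) ?(ltW r00).
    have -> : 2 ^- n.+1 = 2 ^- n / 2 :> R by rewrite exprS invfM mulrC.
    by move: h ru; clear; lra.
  - by apply: le_trans St; rewrite exprS -mulrA ler_pM2l.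
have bound n : n%:R <= L (2 * r0).
  have [r [rl ru rL]] := iter n.
  have rr : r <= 2 * r0.
    by apply: (le_trans ru); rewrite mulrC ler_pM2r// lerBlDr lerDl invr_ge0 exprn_ge0.
  apply: le_trans (Lm _ _ (le_trans (ltW r00) rl) rr); apply: le_trans rL.
  have n2 : n%:R <= A ^+ n.
    apply: (@le_trans _ _ (2 ^+ n)).
      by rewrite -natrX ler_nat ltnW// ltn_expl.
    by apply: lerXn2r; rewrite ?nnegrE ?(ltW A0).
  by apply: (le_trans n2); rewrite ler_peMr// exprn_ge0// ltW.
have := bound (Num.truncn (L (2 * r0))).+1.
by rewrite leNgt truncnS_gt.
Qed.

End Growth.

(** * Entire functions equal to one of their derivatives *)

Section Fixed_derivative.
Variable R : realType.
Implicit Types (r x y rho B : R) (z w u : R[i]).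

(** A function with f^(k) = f gives the linear system F_j' = F_(j+1) with indices modulo k. The
   mean value inequality gives uniqueness for it, and at most exponential growth. *)
Section Cyclic_system.
Variables (F : nat -> R[i] -> R[i]) (k : nat).
Hypotheses (k0 : (0 < k)%N) (dF : forall j z, cder (F j) z (F j.+1 z)).
Hypothesis Fk : forall z, F k z = F 0%N z.

Let values r := [set x | exists j z, [/\ (j < k)%N, normc z < r & x = normc (F j z)]].

Definition system_sup r : R := sup (values r).

Let values_bounded r : has_ubound (values r).
Proof.
suff [B HB] : exists B, forall j z, (j < k)%N -> normc z <= r -> normc (F j z) <= B.
  by exists B => _ [j [z [jk /ltW zr ->]]]; exact: HB.
elim: (k) => [|n [B HB]]; first by exists 0.
have hFn : ent (F n) by move=> z; exists (F n.+1 z).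
have [B' _ HB'] := ent_bounded r hFn.
exists (Num.max B B') => j z; rewrite ltnS leq_eqVlt => /orP[/eqP ->|jn] zr.
  by rewrite le_max HB' ?orbT.
by rewrite le_max HB.
Qed.

Lemma system_sup_ub r j z : (j <= k)%N -> normc z < r -> normc (F j z) <= system_sup r.
Proof.
move=> jk zr; rewrite /system_sup.
suff [i ik ->] : exists2 i, (i < k)%N & F j z = F i z.
  by apply: (ub_le_sup (values_bounded r)); exists i, z.
move: jk; rewrite leq_eqVlt => /orP[/eqP ->|jk]; first by exists 0%N.
by exists j.
Qed.

Lemma system_sup_le r B : 0 < r ->
  (forall j z, (j < k)%N -> normc z < r -> normc (F j z) <= B) -> system_sup r <= B.
Proof.
move=> r0 H; apply: ge_sup; last by move=> _ [j [z [jk zr ->]]]; exact: H.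
by exists (normc (F 0%N 0)); exists 0%N, 0; rewrite normc0.
Qed.

Lemma system_sup_ge0 r : 0 < r -> 0 <= system_sup r.
Proof.
by move=> r0; apply: le_trans (normc_ge0 (F 0%N 0)) (system_sup_ub _ _); rewrite ?normc0.
Qed.

Lemma system_increment r j z w : (j < k)%N -> normc z < r -> normc w < r ->
  normc (F j z - F j w) <= 2 * system_sup r * normc (z - w).
Proof.
move=> jk; apply: (disc_mean_value (fun u _ => dF j u)) => u ur.
exact: system_sup_ub.
Qed.

(** On a disc of radius 1/4 the mean value inequality improves any bound by the factor 1/2. *)
Lemma system_zero : (forall j, (j < k)%N -> F j 0 = 0) ->
  forall z, normc z < 1 / 4 -> F 0%N z = 0.
Proof.
move=> F0 z zr; have q0 : 0 < 1 / 4 :> R by [].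
have : system_sup (1 / 4) <= system_sup (1 / 4) / 2.
  apply: system_sup_le => // j u jk ur.
  have := system_increment jk ur (_ : normc 0 < 1 / 4); rewrite normc0 => /(_ q0).
  rewrite F0// !subr0 => H; apply: (le_trans H).
  have := ler_wpM2l (system_sup_ge0 q0) (ltW ur); lra.
have := system_sup_ub (leq0n k) zr; have := normc_ge0 (F 0%N z) => *.
by apply/eqP; rewrite -normc_eq0 eq_le; apply/andP; split; lra.
Qed.

(** Moving each point of the larger disc radially by at most 1/4 gives
   A(r + 1/4) <= A(r) + A(r + 1/4)/2. *)
Lemma system_doubling r : 0 < r -> system_sup (r + 1 / 4) <= 2 * system_sup r.
Proof.
move=> r0; have q0 : 0 < 1 / 4 :> R by [].
have r1 : 0 < r + 1 / 4 by rewrite addr_gt0.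
suff : system_sup (r + 1 / 4) <= system_sup r + system_sup (r + 1 / 4) / 2 by lra.
have S1 := system_sup_ge0 r1.
apply: system_sup_le => // j z jk zr.
pose t := r / (r + 1 / 4); pose w := t%:C * z.
have t0 : 0 <= t by rewrite divr_ge0// ltW.
have tr : t * (r + 1 / 4) = r by rewrite divfK// gt_eqF.
have t1 : t <= 1 by rewrite ler_pdivrMr// !mul1r lerDl.
have wr : normc w < r.
  rewrite normcM normc_real ger0_norm// -[X in _ < X]tr ltr_pM2l//.
  by rewrite divr_gt0.
have zw : normc (z - w) <= 1 / 4.
  have -> : z - w = (1 - t)%:C * z by rewrite rmorphB/= rmorph1 mulrBl mul1r.
  rewrite normcM normc_real ger0_norm ?subr_ge0//.
  apply: (@le_trans _ _ ((1 - t) * (r + 1 / 4))); last by rewrite mulrBl tr; lra.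
  by rewrite ler_wpM2l ?subr_ge0// ltW.
have wr1 : normc w < r + 1 / 4 by rewrite (lt_trans wr)// ltrDl.
have H := system_increment jk zr wr1.
have wS := system_sup_ub (ltnW jk) wr.
have : normc (F j z) <= normc (F j z - F j w) + normc (F j w).
  by rewrite -{1}[F j z](subrK (F j w)); exact: ler_normcD.
by have := ler_wpM2l S1 zw; lra.
Qed.

Lemma system_growth n : system_sup (n.+1%:R / 4) <= 2 ^+ n * system_sup (1 / 4).
Proof.
elim: n => [|n IH]; first by rewrite expr0 mul1r.
have -> : n.+2%:R / 4 = n.+1%:R / 4 + 1 / 4 :> R by rewrite -[n.+2%:R]natr1 mulrDl.
apply: (le_trans (system_doubling _)); first by rewrite divr_gt0// ltr0n.
by rewrite exprS -mulrA ler_pM2l.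
Qed.

End Cyclic_system.

Section Fixed.
Variables (f : R[i] -> R[i]) (k : nat).
Hypotheses (k0 : (0 < k)%N) (hf : ent f) (fk : forall z, derive1n k f z = f z).

Let df j z : cder (derive1n j f) z (derive1n j.+1 f z).
Proof. by rewrite derive1nS; apply: ent_cder; exact: ent_derive1n. Qed.

Lemma fixed_zero w : (forall j, (j < k)%N -> derive1n j f w = 0) -> forall z, f z = 0.
Proof.
move=> fw0; apply: contrapT => /existsNP[z0 /eqP fz0].
pose F j z := derive1n j f (w + z).
have dF j z : cder (F j) z (F j.+1 z) by apply: cder_shift; exact: df.
have Fk z : F k z = F 0%N z by rewrite /F fk.
have F0 j : (j < k)%N -> F j 0 = 0 by rewrite /F addr0; exact: fw0.
have [e e0 He] := ent_isolated w hf (ex_intro _ z0 fz0).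
pose d : R := Num.min (e / 2) (1 / 8).
have d0 : 0 < d by rewrite lt_min divr_gt0//= divr_gt0.
have nd : normc (d%:C : R[i]) = d by rewrite normc_real ger0_norm// ltW.
have dq : d < 1 / 4.
  have : d <= 1 / 8 by rewrite /d ge_min lexx orbT.
  by lra.
have de : d < e.
  have : d <= e / 2 by rewrite /d ge_min lexx.
  by lra.
have := system_zero k0 dF Fk F0 (z := d%:C); rewrite nd => /(_ dq).
rewrite /F derive1n0 => E.
have := He (d%:C + w); rewrite addrK nd d0 de => /(_ isT).
by rewrite addrC E eqxx.
Qed.

Lemma fixed_growth : exists2 c : R, 0 <= c & forall n, logmax f n%:R <= 4 * n%:R + c.
Proof.
have q0 : 0 < 1 / 4 :> R by [].
pose S := system_sup (fun j => derive1n j f) k (1 / 4).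
have S0 : 0 <= S by apply: system_sup_ge0.
have l2 : ln (2 : R) <= 1 by apply: (le_trans (ln_le_sub1 _)) => //; lra.
exists (ln (1 + S)); first exact: ln1_ge0.
move=> n; apply: logmax_le => [|z zn]; first exact: ler0n.
have H := system_growth k0 df fk (4 * n).
have zn' : normc z < (4 * n).+1%:R / 4.
  by apply: (le_lt_trans zn); rewrite ltr_pdivlMr// -natrM ltr_nat mulnC.
have := le_trans (system_sup_ub k0 df fk (leq0n k) zn') H; rewrite -/S derive1n0 => fz.
have p1 : 1 <= 2 ^+ (4 * n) :> R by rewrite exprn_ege1// ler1n.
have : ln (1 + normc (f z)) <= ln (2 ^+ (4 * n) * (1 + S)).
  rewrite ler_ln ?posrE ?mulr_gt0 ?exprn_gt0 ?ltr_01D ?normc_ge0//.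
  by rewrite mulrDr mulr1 lerD.
rewrite lnM ?posrE ?exprn_gt0 ?ltr_01D// lnXn// => E; apply: (le_trans E).
by rewrite lerD2r -natrM -[_ *+ (4 * n)]mulr_natr ler_piMl ?ler0n.
Qed.

Hypothesis fn0 : forall z, f z != 0.

(** The growth of [f] is at most exponential, so the mean of |ln |f|| over the circle of radius
   n is O(n), and [log_derive_bound] divides it by n. *)
Lemma fixed_log_derive_bounded : exists B : R, forall z, normc (derive1 f z / f z) <= B.
Proof.
have [c c0 Hc] := fixed_growth; pose l : R := `|ln (normc (f 0))|.
exists (16 * (8 + 2 * c + l)).
move=> z; pose n := (Num.truncn (2 * normc z)).+1.
have n1 : 1 <= n%:R :> R by rewrite ler1n.
have n0 : 0 < n%:R :> R by exact: lt_le_trans n1.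
have zn2 : 2 * normc z < n%:R by rewrite truncnS_gt.
have nz := normc_ge0 z.
have zn : normc z < n%:R by lra.
have rI : 0 < (n%:R : R) < n%:R + 1 by rewrite n0 ltrDl ltr01.
have hh := ent_hol (rho := n%:R + 1) hf.
have fn0' w : normc w < n%:R + 1 -> f w != 0 by [].
apply: (le_trans (log_derive_bound hh rI fn0' zn)).
have K0 : 0 <= logmax f n%:R by apply: logmax_ge0 => //; exact: ltW.
have M : rmean (fun t => `|ln (normc (f (circle n%:R t)))|) <= n%:R * (8 + 2 * c + l).
  apply: (le_trans (@mean_abs_of_upper _ _ (logmax f n%:R) (ln_circle_cont hh rI fn0') K0 _)).
    move=> t; apply: le_trans (logmax_ub hf (z := circle n%:R t) _).
      by rewrite ler_ln ?posrE ?normc_gt0 ?ltr_01D ?normc_ge0// lerDr.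
    by rewrite normc_circle// ltW.
  rewrite (jensen_zero_free hh rI fn0').
  have l0 : - ln (normc (f 0)) <= l by rewrite /l -normrN ler_norm.
  have l1 : 0 <= l by exact: normr_ge0.
  have := Hc n; have := ler_wpM2r c0 n1; have := ler_wpM2r l1 n1.
  by move: l0; lra.
have q : n%:R / (n%:R - normc z) ^+ 2 <= 4 / n%:R.
  have h : 0 < n%:R - normc z by rewrite subr_gt0.
  rewrite ler_pdivrMr ?exprn_gt0// mulrAC ler_pdivlMr// -expr2.
  have -> : 4 * (n%:R - normc z) ^+ 2 = (2 * (n%:R - normc z)) ^+ 2 :> R by ring.
  by apply: lerXn2r; rewrite ?nnegrE ?mulr_ge0 ?(ltW h) ?(ltW n0)//; move: zn2; lra.
have M0 := le_trans (normr_ge0 _) (log_abs_mean_ge hh rI fn0').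
apply: (@le_trans _ _ (4 * (4 / n%:R) * (n%:R * (8 + 2 * c + l)))).
  apply: ler_pM => //; last by rewrite ler_pM2l.
  by rewrite mulr_ge0// divr_ge0 ?sqr_ge0// ltW.
by rewrite le_eqVlt; apply/orP; left; apply/eqP; field; rewrite gt_eqF.
Qed.

End Fixed.

Lemma liouville (h : R[i] -> R[i]) B : ent h -> (forall z, normc (h z) <= B) ->
  forall z, h z = h 0.
Proof.
move=> hh hB z; have B0 := le_trans (normc_ge0 _) (hB 0).
suff d0 w : derive1 h w = 0.
  apply: (@zero_derive_const _ _ (normc z + 1)); last by rewrite ltrDl.
  by move=> u _; rewrite -(d0 u); exact: ent_cder.
apply/eqP; rewrite -normc_eq0 eq_le normc_ge0 andbT.
apply/ler_addgt0Pr => e e0; rewrite add0r.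
have nw := normc_ge0 w.
pose r := 2 * normc w + 1 + 8 * B / e.
have Be : 0 <= 8 * B / e by rewrite divr_ge0 ?mulr_ge0// ltW.
have r0 : 0 < r by rewrite /r; move: nw Be; clear; lra.
have wr : normc w < r by rewrite /r; move: nw Be; clear; lra.
have rI : 0 < r < r + 1 by rewrite r0 ltrDl ltr01.
apply: (le_trans (hol_derive_bound (ent_hol hh) rI wr B0 (fun u _ => hB u))).
have h0 : 0 < r - normc w by rewrite subr_gt0.
have q : r <= 2 * (r - normc w) by rewrite /r; move: nw Be; clear; lra.
rewrite mulrA ler_pdivrMr ?exprn_gt0//.
have h1 : 8 * B <= e * r.
  have -> : 8 * B = e * (8 * B / e) by field; rewrite gt_eqF.
  by rewrite ler_pM2l// /r; move: nw; clear; lra.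
have h2 : 8 * B * r <= e * r * r by rewrite ler_pM2r.
have h3 : r * r <= 2 * (r - normc w) * (2 * (r - normc w)) by apply: ler_pM; rewrite ?(ltW r0).
have := ler_wpM2l (ltW e0) h3; rewrite expr2; move: h2; clear; lra.
Qed.

(** By the Liouville theorem f'/f is a constant lambda. *)
Lemma zero_free_exponential (f : R[i] -> R[i]) k : (0 < k)%N -> ent f ->
  (forall z, derive1n k f z = f z) -> (forall z, f z != 0) ->
  exists A lambda, [/\ A != 0, lambda != 0, lambda ^+ k = 1 &
    forall z, f z = A * cexp (lambda * z)].
Proof.
move=> k0 hf fk fn0.
have [B HB] := fixed_log_derive_bounded k0 hf fk fn0.
have hh : ent (fun z => derive1 f z / f z).
  move=> z; eexists.
  exact: (cderM (ent_cder z (ent_derive1 hf)) (cderV (ent_cder z hf) (fn0 z))).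
have L := liouville hh HB.
pose l := derive1 f 0 / f 0.
have f1 z : derive1 f z = l * f z by rewrite -[LHS](divfK (fn0 z)) L.
have fE z : f z = f 0 * cexp (l * z).
  pose g u := f u * cexp (- l * u).
  have dg u : cder g u 0.
    have D := gder_comp (cderM (cder_cst (- l) u) (cder_id u)) (cder_cexp (- l * u)).
    have := cderM (ent_cder u hf) D.
    by rewrite (_ : _ + _ = 0)//= f1; ring.
  have := @zero_derive_const _ g (normc z + 1) z (fun u _ => dg u).
  rewrite ltrDl ltr01 => /(_ isT); rewrite /g mulr0 cexp0 mulr1 => <-.
  by rewrite mulNr cexpN divfK ?cexp_neq0.
have fj j z : derive1n j f z = l ^+ j * f z.
  elim: j z => [|j IH] z; first by rewrite derive1n0 expr0 mul1r.
  rewrite derive1nS (_ : derive1n j f = fun u => l ^+ j * f u); last exact/funext.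
  rewrite exprSr -mulrA -f1; apply: derive1_cder; apply: cderZ; exact: ent_cder.
have lk : l ^+ k = 1.
  by apply: (mulIf (fn0 0)); rewrite -fj fk mul1r.
exists (f 0), l; split => //.
by apply/eqP => l0; move: lk; rewrite l0 expr0n gtn_eqF// => /eqP; rewrite eq_sym oner_eq0.
Qed.

End Fixed_derivative.

(** * Poles *)

Section Poles.
Variable R : realType.
Implicit Types (r x y d rho : R) (z w u c : R[i]) (f g D : R[i] -> R[i]).

Lemma near_normcP (P : R[i] -> Prop) z :
  (\forall w \near z, P w) <-> exists2 d : R, 0 < d & forall w, normc (w - z) < d -> P w.
Proof.
split=> [/nbhs_ballP[e /= e0 H]|[d d0 H]].
  have [d d0 E] := posC e0; exists d => // w wd; apply: H.
  by rewrite -ball_normE /ball_/= distrC E ltcR.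
apply/nbhs_ballP; exists d%:C; first by rewrite /= ltcR.
by move=> w; rewrite -ball_normE /ball_/= distrC ltcR; exact: H.
Qed.

Lemma near_dnormcP (P : R[i] -> Prop) z : (\forall w \near z^', P w) <->
  exists2 d : R, 0 < d & forall w, 0 < normc (w - z) < d -> P w.
Proof.
split=> [|[d d0 H]]; rewrite near_withinE.
  move=> /near_normcP[d d0 H]; exists d => // w; by move=> /andP[w0 wd]; apply: H => //; rewrite -subr_eq0 -normc_gt0.
by apply/near_normcP; exists d => // w wd wz; apply: H; rewrite wd andbT normc_gt0 subr_eq0.
Qed.

Lemma holomorphic_atP f z : holomorphic_at f z <->
  exists2 d : R, 0 < d & forall w, normc (w - z) < d -> exists l, cder f w l.
Proof.
by rewrite /holomorphic_at near_normcP; split=> -[d d0 H]; exists d => // w /H /cderP.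
Qed.

Lemma is_poleP f z : is_pole f z ->
  (exists2 d : R, 0 < d & forall w, 0 < normc (w - z) < d -> exists l, cder f w l) /\
  forall A : R, exists2 d : R, 0 < d & forall w, 0 < normc (w - z) < d -> A <= normc (f w).
Proof.
move=> [/near_dnormcP[d d0 H] /cvgryPge fz]; split.
  by exists d => // w /H /cderP.
by move=> A; apply/near_dnormcP; exact: fz.
Qed.

Lemma holomorphic_at_open f c d : 0 < d ->
  (forall w, 0 < normc (w - c) < d -> exists l, cder f w l) ->
  forall w, 0 < normc (w - c) < d -> holomorphic_at f w.
Proof.
move=> d0 H w /andP[w0 wd]; apply/holomorphic_atP.
exists (Num.min (normc (w - c)) (d - normc (w - c))); first by rewrite lt_min w0 subr_gt0.
move=> u; rewrite lt_min => /andP[u1 u2]; apply: H; apply/andP; split.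
  have -> : u - c = (w - c) - (w - u) by ring.
  by apply: lt_le_trans (ler_distc _ _); rewrite subr_gt0 distcC.
have -> : u - c = (u - w) + (w - c) by ring.
by apply: (le_lt_trans (ler_normcD _ _)); rewrite -ltrBrDr.
Qed.

(** The function (z - c)/f, extended by 0, is differentiable at [c], and its order of
   vanishing there is one more than the order of the pole; orders 0 and 1 would make [f] bounded
   near [c]. *)
Lemma pole_order f c : is_pole f c -> exists d p v, [/\ 0 < d, (0 < p)%N, hol v d, v 0 != 0 &
  forall u, 0 < normc u < d -> (exists l, cder f (c + u) l) /\ f (c + u) = v u / u ^+ p].
Proof.
move=> /is_poleP[[d1 d10 df] fbig].
have [d2 d20 f1] := fbig 1.
pose d := Num.min d1 d2; have d0 : 0 < d by rewrite lt_min d10.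
have dfc u : 0 < normc u < d -> exists l, cder f (c + u) l.
  rewrite /d lt_min => /and3P[u0 ud1 _]; apply: df.
  by rewrite addrC addKr u0.
have fc1 u : 0 < normc u < d -> 1 <= normc (f (c + u)).
  rewrite /d lt_min => /and3P[u0 _ ud]; apply: f1.
  by rewrite addrC addKr u0.
have fc0 u : 0 < normc u < d -> f (c + u) != 0.
  by move=> /fc1 H; rewrite -normc_gt0 (lt_le_trans _ H).
clearbody d; pose H u := u * (if u == 0 then 0 else (f (c + u))^-1).
have hH : hol H d.
  move=> u ud; have [->|u0] := eqVneq u 0.
    exists 0 => e e0; have [d3 d30 f3] := fbig e^-1.
    exists (Num.min d3 d); first by rewrite lt_min d30.
    move=> w; rewrite subr0 lt_min => /andP[w3 wd]; rewrite /H eqxx !mulr0 mul0r !subr0.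
    case: eqP => [->|/eqP w0]; first by rewrite mulr0 normc0 mulr0.
    rewrite normcM mulrC ler_wpM2r ?normc_ge0//.
    have fw : e^-1 <= normc (f (c + w)) by apply: f3; rewrite addrC addKr normc_gt0 w0.
    have e'0 : 0 < e^-1 by rewrite invr_gt0.
    rewrite -[(f _)^-1]mul1r normc_div normc1 mul1r -[e]invrK lef_pV2// posrE.
    exact: lt_le_trans fw.
  have uI : 0 < normc u < d by rewrite normc_gt0 u0.
  have [l dl] := dfc u uI.
  have D := cderM (cder_id u) (cderV (cder_shift dl) (fc0 u uI)).
  eexists; apply: (gder_near _ _ D); first by rewrite -normc_gt0 in u0; exact: u0.
  move=> w /= wu; rewrite /H; case: eqP => // w0.
  by move: wu; rewrite w0 sub0r normcN ltxx.
pose h : R[i] := (d / 2)%:C.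
have nh : normc h = d / 2 by rewrite normc_real ger0_norm// ltW// divr_gt0.
have hd : normc h < d by rewrite nh ltr_pdivrMr// ltr_pMr// ltr1n.
have hI : 0 < normc h < d by rewrite hd nh divr_gt0.
have h0 : h != 0 by rewrite -normc_gt0 nh divr_gt0.
have [|m [g [hg g0 gE]]] := hol_order0 d0 hH.
  by exists h => //; rewrite /H (negbTE h0) mulf_neq0// invr_neq0// fc0.
have fE u : 0 < normc u < d -> f (c + u) = u / (u ^+ m * g u).
  move=> /[dup] uI /andP[u0 ud]; rewrite -gE// /H.
  have u0' : u != 0 by rewrite -normc_gt0.
  by rewrite (negbTE u0') invfM invrK mulrA mulfV// mul1r.
have ng : 0 < normc (g 0) by rewrite normc_gt0.
have n0 : normc (0 : R[i]) < d by rewrite normc0.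
have e0 : 0 < normc (g 0) / 2 by rewrite divr_gt0.
have [d3 d30 Hg] := hol_cont hg n0 e0.
have gl u : normc u < d3 -> normc (g 0) / 2 <= normc (g u).
  rewrite -[u]subr0 => /Hg; rewrite subr0 => gu.
  by have := ler_distc (g 0) (g 0 - g u); rewrite subKr [normc (g 0 - _)]distcC; lra.
have gn u : normc u < d3 -> g u != 0.
  by move=> /gl gu; rewrite -normc_gt0; apply: lt_le_trans gu; rewrite divr_gt0.
have Hm n : (n < 2)%N -> (forall u, 0 < normc u < d -> f (c + u) = u / (u ^+ n * g u)) -> False.
  move=> n2 {}fE; have [d4 d40 Hf] := fbig (2 / normc (g 0) + 1).
  pose e : R := Num.min (Num.min d d3) (Num.min d4 1).
  have ep : 0 < e by rewrite !lt_min d0 d30 d40 ltr01.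
  pose h' : R := e / 2.
  have h'0 : 0 < h' by rewrite divr_gt0.
  have he : h' < e by rewrite ltr_pdivrMr// ltr_pMr// ltr1n.
  have nh' : normc (h'%:C : R[i]) = h' by rewrite normc_real ger0_norm// ltW.
  move: he; rewrite !lt_min => /andP[/andP[hd' hd3] /andP[hd4 h1]].
  have := Hf (c + h'%:C); rewrite addrC addKr nh' h'0 hd4 => /(_ isT).
  have hI' : 0 < normc (h'%:C : R[i]) < d by rewrite nh' h'0.
  have g3 := gl h'%:C; rewrite nh' in g3; have {}g3 := g3 hd3.
  have gp : 0 < normc (g h'%:C) by apply: lt_le_trans g3; rewrite divr_gt0.
  rewrite fE// normc_div normcM normcX nh'.
  have hn : h' <= h' ^+ n.
    by case: n n2 {fE} => [|[|//]] _; rewrite ?expr0 ?expr1// ltW.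
  have : h' / (h' ^+ n * normc (g h'%:C)) <= 2 / normc (g 0).
    rewrite ler_pdivrMr ?mulr_gt0 ?exprn_gt0//; apply: (le_trans hn).
    rewrite mulrCA ler_peMr ?exprn_ge0 ?(ltW h'0)//.
    by rewrite mulrAC ler_pdivlMr// mul1r; move: g3; lra.
  lra.
case: m gE fE => [|[|p]] gE fE.
- exfalso; exact: (Hm 0%N isT fE).
- exfalso; exact: (Hm 1%N isT fE).
exists (Num.min d d3), p.+1, (fun u => (g u)^-1); split => //.
- by rewrite lt_min d0.
- move=> u; rewrite lt_min => /andP[ud u3]; have [l dl] := hg u ud.
  by eexists; exact: cderV dl (gn u u3).
- by rewrite invr_neq0.
move=> u; rewrite lt_min => /and3P[u0 ud u3].
have uI : 0 < normc u < d by rewrite u0.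
split; first exact: dfc.
rewrite fE// exprS; have u0' : u != 0 by rewrite -normc_gt0.
by rewrite -mulrA invfM mulrA mulfV// mul1r invfM mulrC.
Qed.

Lemma ccont_zero D c d : ccont D c -> 0 < d ->
  (forall u, 0 < normc (u - c) < d -> D u = 0) -> D c = 0.
Proof.
move=> cD d0 D0; apply/eqP; rewrite -normc_eq0; apply/negPn/negP => nD.
have D0' : 0 < normc (D c) by rewrite lt_neqAle eq_sym nD normc_ge0.
have [d5 d50 H] := cD _ D0'.
pose h : R := Num.min d d5 / 2.
have m0 : 0 < Num.min d d5 by rewrite lt_min d0.
have h0 : 0 < h by rewrite divr_gt0.
have hm : h < Num.min d d5 by rewrite ltr_pdivrMr// ltr_pMr// ltr1n.
have nh : normc (h%:C : R[i]) = h by rewrite normc_real ger0_norm// ltW.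
move: hm; rewrite lt_min => /andP[hd h5].
have := H (h%:C + c); rewrite addrK nh => /(_ h5).
by rewrite D0 ?addrK ?nh ?h0// sub0r normcN ltxx.
Qed.

(** Differentiation raises the order of a pole by exactly one: the leading coefficient is
   multiplied by -(p + j), which is not zero. *)
Lemma pole_derivatives f c d p v : hol v d ->
  (forall u, 0 < normc u < d -> (exists l, cder f (c + u) l) /\ f (c + u) = v u / u ^+ p) ->
  0 < d -> v 0 != 0 -> (0 < p)%N -> forall j, exists vj, [/\ hol vj d, vj 0 != 0 &
  forall u, 0 < normc u < d -> derive1n j f (c + u) = vj u / u ^+ (p + j)].
Proof.
move=> hv fE d0 v0 p0; elim=> [|j [w [hw w0 wE]]].
  by exists v; split => // u /fE[_ E]; rewrite derive1n0 E addn0.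
exists (fun u => u * derive1 w u - (p + j)%:R * w u); split.
- move=> u ud; have [l dl] := hw u ud; have [l' dl'] := hol_derive1 hw ud.
  eexists; apply: (cderB (cderM (cder_id u) dl')); exact: cderZ dl.
- rewrite mul0r sub0r oppr_eq0 mulf_neq0// pnatr_eq0 -lt0n.
  by rewrite addn_gt0 p0.
move=> u /[dup] uI /andP[u0 ud]; rewrite derive1nS; apply: derive1_cder.
have u0' : u != 0 by rewrite -normc_gt0.
have [l dl] := hw u ud; rewrite (derive1_cder dl).
have D := cderM dl (cderV (cderX (p + j) u) (expf_neq0 _ u0')).
have E : cder (fun z => derive1n j f (c + z)) u
    ((u * l - (p + j)%:R * w u) / u ^+ (p + j.+1)).
  pose m := Num.min (normc u) (d - normc u).
  have m0 : 0 < m by rewrite lt_min u0 subr_gt0.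
  apply: (gder_near m0 (f := fun z => w z / z ^+ (p + j))).
    move=> z /=; rewrite /m lt_min => /andP[z1 z2]; rewrite wE//; apply/andP; split.
      have := ler_distc u (u - z); rewrite subKr [normc (u - z)]distcC.
      by apply: lt_le_trans; rewrite subr_gt0.
    rewrite -[z](subrK u); apply: (le_lt_trans (ler_normcD _ _)).
    by rewrite -ltrBrDr.
  move: D; congr (gder _ _ _ _).
  rewrite addnS; move: (p + j)%N (addn_gt0 p j) => [|n]; first by rewrite p0.
  by move=> _ /=; rewrite !exprS; field; rewrite u0' expf_neq0.
have -> : (derive1n j f) = (fun z => derive1n j f (c + (z - c))).
  by apply/funext => z; rewrite addrC subrK.
have := cder_shift (c := - c) (f := fun z => derive1n j f (c + z)) (z := c + u).
rewrite addKr => /(_ _ E); congr (gder _ _ _ _).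
by apply/funext => z; congr (_ _); ring.
Qed.

(** At a pole of order p the left-hand side of the equation has a pole of order
   (p + k + 1) + (p + k), the right-hand side one of order at most p + (p + k). After multiplication
   by the larger power both sides are continuous, and their values at the pole differ. *)
Lemma entire_solution phi f k a : entire phi -> (0 < k)%N -> meromorphic f ->
  (forall z, holomorphic_at f z ->
     derive1n k.+1 f z * (derive1n k f z - f z) = phi z * (f z - a) * derive1n k f z) ->
  ent f.
Proof.
move=> /entP hphi k0 fm eqn.
suff np c : ~ is_pole f c.
  by move=> z; case: (fm z) => [/holomorphic_atP[d d0 H]|/np//]; apply: H; rewrite subrr normc0.
move=> /pole_order[d [p [v [d0 p0 hv v0 fE]]]].
have Hd := pole_derivatives hv fE d0 v0 p0.
have [vk [hvk vk0 vkE]] := Hd k.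
have [vk1 [hvk1 vk10 vk1E]] := Hd k.+1.
pose D u := vk1 u * (vk u - u ^+ k * v u) -
  phi (c + u) * (v u - a * u ^+ p) * vk u * u ^+ k.+1.
have D0 u : 0 < normc u < d -> D u = 0.
  move=> /[dup] uI /andP[u0 ud]; have u0' : u != 0 by rewrite -normc_gt0.
  have hu : holomorphic_at f (c + u).
    apply: (holomorphic_at_open d0 (c := c)); last by rewrite addrC addKr.
    by move=> w wI; have [] := fE _ wI; rewrite addrC subrK.
  have := eqn _ hu; have [_ E0] := fE u uI; rewrite vkE// vk1E// E0 => E.
  have : D u = u ^+ (p + k.+1) * u ^+ (p + k) *
   (vk1 u / u ^+ (p + k.+1) * (vk u / u ^+ (p + k) - v u / u ^+ p) -
     phi (c + u) * (v u / u ^+ p - a) * (vk u / u ^+ (p + k))).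
    rewrite /D !exprD !exprS; field.
    by rewrite !expf_neq0.
  by rewrite E subrr mulr0.
have cD : ccont D 0.
  have n0 : normc (0 : R[i]) < d by rewrite normc0.
  have c1 := hol_cont hv n0; have c2 := hol_cont hvk n0; have c3 := hol_cont hvk1 n0.
  have cphi := ent_cont 0 (ent_shift c hphi).
  have cX n : ccont (fun u => u ^+ n) 0 by exact: gder_cont (cderX n 0).
  apply: gcontD.
    apply: (gcontM c3); apply: gcontD => //; apply: gcontN; exact: gcontM (cX k) c1.
  apply: gcontN; apply: gcontM (cX _); apply: gcontM c2; apply: (gcontM cphi).
  apply: gcontD => //; apply: gcontN; exact: (gcontM (gcont_cst _ _ a) (cX p)).
have : D 0 = 0.
  by apply: (ccont_zero cD d0) => u; rewrite subr0; exact: D0.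
rewrite /D !expr0n /= (gtn_eqF k0) mul0r subr0 mulr0 subr0 => /eqP.
by rewrite mulf_eq0 (negbTE vk0) (negbTE vk10).
Qed.

End Poles.

(** * Zero multiplicity, exponent of convergence and order *)

Section Bridge.
Variable R : realType.
Implicit Types (r x y d rho : R) (z w u c : R[i]) (f g h : R[i] -> R[i]).

(** If the orders differ, cancelling the smaller power and letting z tend to [w] shows that
   one of the two nonvanishing factors vanishes at [w]. *)
Lemma has_order_unique h w m (n : int) f : ent h -> h w != 0 ->
  (forall z, f z = (z - w) ^+ m * h z) -> has_order f w n -> n = m.
Proof.
move=> hh hw fE [g [/holomorphic_atP[d d0 hg] gw /near_dnormcP[e e0 He]]].
have m0 : 0 < Num.min d e by rewrite lt_min d0.
have cg : ccont g w.
  by have [|l dl] := hg w; [rewrite subrr normc0|exact: gder_cont dl].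
have ch := ent_cont w hh.
have cX j : ccont (fun z => (z - w) ^+ j) w by exact: ent_cont (ent_powB w j).
have E z : 0 < normc (z - w) < Num.min d e -> (z - w) ^+ m * h z = (z - w) ^ n * g z.
  by rewrite lt_min => /and3P[z0 zd ze]; rewrite -fE He// z0.
have [lt|gt|//] := ltgtP n m%:Z.
- have [j jE] : exists j, m%:Z = n + j.+1%:Z.
    by exists (absz (m%:Z - n)).-1; lia.
  have : h w * (w - w) ^+ j.+1 - g w = 0.
    apply: (@ccont_zero _ (fun z => h z * (z - w) ^+ j.+1 - g z) w _ _ m0).
      by apply: gcontD; [exact: gcontM ch (cX _)|exact: gcontN].
    move=> z zI; have zw : z - w != 0 by case/andP: zI; rewrite normc_gt0.
    apply: (mulfI (expfz_neq0 n zw)); rewrite mulr0 mulrBr -E//.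
    have -> : (z - w) ^+ m = (z - w) ^ n * (z - w) ^+ j.+1.
      by rewrite [LHS]exprnP jE expfzDr.
    by ring.
  by rewrite subrr expr0n mulr0 sub0r => /eqP; rewrite oppr_eq0 (negbTE gw).
- have [j jE] : exists j, n = m%:Z + j.+1%:Z.
    by exists (absz (n - m%:Z)).-1; lia.
  have : h w - (w - w) ^+ j.+1 * g w = 0.
    apply: (@ccont_zero _ (fun z => h z - (z - w) ^+ j.+1 * g z) w _ _ m0).
      by apply: gcontD => //; apply: gcontN; exact: gcontM (cX _) cg.
    move=> z zI; have zw : z - w != 0 by case/andP: zI; rewrite normc_gt0.
    apply: (mulfI (expf_neq0 m zw)); rewrite mulr0 mulrBr E//.
    by rewrite jE expfzDr// mulrA subrr.
  by rewrite subrr expr0n mul0r subr0 => /eqP; rewrite (negbTE hw).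
Qed.

Lemma mero_order_ent h w m f : ent h -> h w != 0 ->
  (forall z, f z = (z - w) ^+ m * h z) -> mero_order f w = m.
Proof.
move=> hh hw fE; apply: xget_unique; last by move=> n; exact: has_order_unique hw fE.
exists h; split => //.
  by apply/holomorphic_atP; exists 1 => // u _; exact: hh.
by apply/near_dnormcP; exists 1 => // u _; rewrite fE exprnP.
Qed.

Lemma zero_mult_ent h w m f : ent h -> h w != 0 ->
  (forall z, f z = (z - w) ^+ m * h z) -> zero_mult f w = m.
Proof. by move=> hh hw fE; rewrite /zero_mult (mero_order_ent hh hw fE); case: m {fE}. Qed.

Lemma pole_mult_ent f w : ent f -> pole_mult f w = 0%N.
Proof.
move=> hf; have [f0|/existsNP[z /eqP fz]] := pselect (forall z, f z = 0); last first.
  have [m [h [hh hw fE]]] := ent_factor w hf (ex_intro _ z fz).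
  by rewrite /pole_mult (mero_order_ent hh hw fE).
rewrite /pole_mult /mero_order xgetPN// => n [g [/holomorphic_atP[d d0 hg] gw]].
move=> /near_dnormcP[e e0 He]; move: gw; rewrite (@ccont_zero _ g w e) ?eqxx//.
  by have [|l dl] := hg w; [rewrite subrr normc0|exact: gder_cont dl].
move=> u uI; have uw : u - w != 0 by case/andP: uI; rewrite normc_gt0.
by apply: (mulfI (expfz_neq0 n uw)); rewrite mulr0 -He.
Qed.

Lemma derivatives_vanish f h w m : ent h -> (forall z, f z = (z - w) ^+ m * h z) ->
  forall j, (j < m)%N -> derive1n j f w = 0.
Proof.
move=> hh fE j jm.
suff [g _ ->] : exists2 g, ent g & forall z, derive1n j f z = (z - w) ^+ (m - j) * g z.
  by rewrite subrr expr0n subn_eq0 leqNgt jm mul0r.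
elim: j jm => [|j IH] jm; first by exists h => // z; rewrite derive1n0 subn0.
have [g hg gE] := IH (ltnW jm).
exists (fun z => (m - j)%:R * g z + (z - w) * derive1 g z).
  apply: entD; first exact: (entM (ent_cst (m - j)%:R) hg).
  have hzw : ent (fun z => z - w) by exact: entB (@ent_id R) (ent_cst w).
  exact: entM hzw (ent_derive1 hg).
move=> z; rewrite derive1nS (_ : derive1n j f = fun z => (z - w) ^+ (m - j) * g z); last exact/funext.
apply: derive1_cder.
have := cderM (gder_comp (cderB (cder_id z) (cder_cst w z)) (cderX (m - j) (z - w))) (ent_cder z hg).
rewrite subnS subr0 mulr1 /= (_ : (m - j = (m - j).-1.+1)%N); last by lia.
rewrite /= exprS; congr (gder _ _ _ _); ring.
Qed.

(** The remaining factor may vanish at [w] too, so that only an inequality holds; it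
   suffices, and it spares an identification of the list with all the zeros in the disc. *)
Lemma count_le_zero_mult f F s m w : ent F -> (exists z, f z != 0) ->
  (forall z, f z = z ^+ m * (zprod s z * F z)) -> (count_mem w s <= zero_mult f w)%N.
Proof.
move=> hF nf fE.
have sE z : zprod s z = (z - w) ^+ count_mem w s * zprod (seq.filter (predC (pred1 w)) s) z.
  rewrite (zprod_filter (pred1 w)); congr (_ * _); rewrite -size_filter.
  elim: s {fE} => [|u l IH] /=; first by rewrite zprod_nil expr0.
  by case: eqP => // ->; rewrite zprod_cons IH exprS.
pose h z := z ^+ m * (zprod (seq.filter (predC (pred1 w)) s) z * F z).
have fh z : f z = (z - w) ^+ count_mem w s * h z by rewrite fE sE /h; ring.
have hh : ent h.
  apply: entM; last exact: entM (ent_zprod _) hF.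
  by move=> z; eexists; exact: cderX.
have nh : exists z, h z != 0.
  by have [z fz] := nf; exists z; apply: contraNneq fz => hz; rewrite fh hz mulr0.
have [j [h1 [hh1 h1w hE]]] := ent_factor w hh nh.
rewrite (zero_mult_ent (m := (count_mem w s + j)%N) hh1 h1w) ?leq_addr// => z.
by rewrite fh hE exprD mulrA.
Qed.

Lemma zeros_sum_le f F s m q : ent F -> (exists z, f z != 0) ->
  (forall z, f z = z ^+ m * (zprod s z * F z)) -> (forall w, w \in s -> w != 0) ->
  ((\sum_(w <- s) normc w `^ (- q))%:E <=
   \esum_(z in [set z | (z != 0)%R]) ((zero_mult f z)%:R * normc z `^ (- q))%:E)%E.
Proof.
move=> hF nf fE sn0; apply: esum_ge; exists [set` undup s].
  split; first exact: finite_seq.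
  by move=> w /=; rewrite mem_undup => /sn0.
rewrite -fsbig_seq ?undup_uniq// sumEFin lee_fin -big_undup_iterop_count/=.
apply: ler_sum => w _.
have -> : iterop (count_mem w s) +%R (normc w `^ (- q)) 0 = (count_mem w s)%:R * normc w `^ (- q).
  by rewrite -[LHS]/(_ *+ _) mulr_natl.
by rewrite ler_wpM2r ?powR_ge0// ler_nat; exact: count_le_zero_mult fE.
Qed.

Local Notation mu := (@lebesgue_measure R).

Lemma proximity_le f r : ent f -> 0 < r -> (proximity f r <= (logmax f r)%:E)%E.
Proof.
move=> hf r0; rewrite /proximity.
have pi0 : 0 < 2 * pi :> R by rewrite mulr_gt0// pi_gt0.
have K0 := logmax_ge0 hf (ltW r0).
have rI : 0 < r < r + 1 by rewrite r0 ltrDl ltr01.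
have cf : continuous (fun t => normc (f (circle r t))).
  exact: (rcont_normc (fun t => rcont_hol_circle t (ent_hol hf) rI)).
have : (\int[mu]_(t in `[0%R, (2 * pi)%R])
    (Num.max 0 (ln (normc (f (r%:C * cis t)))))%:E <=
    \int[mu]_(t in `[0%R, (2 * pi)%R]) (cst (logmax f r)%:E t))%E.
  apply: ge0_le_integral => //.
  - by move=> t _; rewrite lee_fin le_max lexx.
  - apply/measurable_EFinP; apply: measurable_funS (_ : measurable_fun setT _) => //.
    apply: measurable_maxr; first exact: measurable_cst.
    apply: measurableT_comp; first exact: measurable_ln.
    exact: continuous_measurable_fun cf.
  - move=> t _; rewrite lee_fin ge_max K0/=.
    apply: le_trans (logmax_ub hf (z := circle r t) _); last by rewrite normc_circle// ltW.
    have [->|fn0] := eqVneq (normc (f (circle r t))) 0.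
      by rewrite ln0// addr0 ln1.
    rewrite ler_ln ?posrE ?ltr_01D ?normc_ge0//; first by rewrite lerDr.
    by rewrite lt_neqAle eq_sym fn0 normc_ge0.
rewrite integral_cst//= lebesgue_measure_itv/= lte_fin pi0 sube0 => H.
have ip : (0 <= ((2 * pi)^-1 : R)%:E)%E by rewrite lee_fin invr_ge0 ltW.
apply: (le_trans (lee_wpmul2l ip H)).
by rewrite -!EFinM lee_fin mulrCA mulVf ?mulr1// gt_eqF.
Qed.

Lemma characteristic_ent f r : ent f -> characteristic f r = proximity f r.
Proof.
move=> hf; rewrite /characteristic /integrated_count.
have P0 x : pole_count f x = 0%E.
  by apply: esum1 => z _; rewrite pole_mult_ent.
rewrite P0 mul0e adde0 (_ : (fun t => _) = cst 0%E) ?integral0 ?adde0//.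
by apply/funext => t; rewrite P0 sube0 mul0e.
Qed.

(** An entire function has no poles, so that its characteristic is the proximity function,
   a mean that is at most [logmax]. *)
Lemma growth_order_large f x : ent f -> (x%:E < growth_order f)%E -> 0 < x -> forall M : R, exists2 r, M <= r & r `^ x <= logmax f r.
Proof.
move=> hf xf x0 M; pose M' := Num.max M 2.
have [MM M2] : M <= M' /\ 2 <= M' by rewrite /M' !le_max !lexx orbT.
have : (x%:E < ereal_sup ((fun r => maxe 0 (lne (characteristic f r)) * ((ln r)^-1)%:E)
    @` [set r | (M' <= r)%R]))%E.
  apply: (lt_le_trans xf); apply: ereal_inf_lbound; exists [set r | M' <= r] => //.
  by exists M'; split; [exact: num_real|move=> r /ltW].
move=> /ereal_sup_gt[_ [r /= Mr <-]].
rewrite characteristic_ent// => H; exists r; first exact: le_trans Mr.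
have r2 : 2 <= r by exact: le_trans Mr.
have r0 : 0 < r by exact: lt_le_trans r2.
have lr : 0 < ln r by rewrite ln_gt0// (lt_le_trans _ r2)// ltr1n.
have := proximity_le hf r0; move: H; case: (proximity f r) => [p|//|].
  rewrite lee_fin => H pl; apply: le_trans pl; move: H => /=.
  case: ifPn => [p0|]; last rewrite -ltNge => p0.
    by rewrite max_l ?leNye// mul0e lte_fin ltNge (ltW x0).
  rewrite -EFin_max -EFinM lte_fin ltr_pdivlMr// lt_max.
  rewrite ltNge mulr_ge0 ?(ltW x0) ?(ltW lr)//= => /ltW.
  by rewrite -ln_powR ler_ln ?posrE ?powR_gt0.
by rewrite /= max_l ?leNye// mul0e lte_fin ltNge (ltW x0).
Qed.

End Bridge.

(** * Conclusion *)

Section Conclusion.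
Variable R : realType.
Implicit Types (f : R[i] -> R[i]) (a : R[i]) (q x Z : R).

Lemma positive_order_nonconst f x : ent f -> (x%:E < growth_order f)%E -> 0 < x ->
  exists z, derive1 f z != 0.
Proof.
move=> hf xf x0; apply: contrapT => H.
have f1 z : derive1 f z = 0 by apply/eqP/negPn/negP => fz; apply: H; exists z.
have fc z : f z = f 0.
  apply: (@zero_derive_const _ f (normc z + 1)); last by rewrite ltrDl.
  by move=> u _; rewrite -(f1 u); exact: ent_cder.
pose K := ln (1 + normc (f 0)); have K0 : 0 <= K by apply: ln1_ge0; exact: normc_ge0.
have [r rM rL] := growth_order_large hf xf x0 ((K + 1) `^ x^-1).
have r0 : 0 <= r by apply: le_trans rM; exact: powR_ge0.
have LK : logmax f r <= K by apply: logmax_le => // z _; rewrite fc.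
have : K + 1 <= r `^ x.
  have -> : K + 1 = ((K + 1) `^ x^-1) `^ x.
    by rewrite -powRrM mulVf ?gt_eqF// powRr1// addr_ge0.
  by apply: powR_mono rM; rewrite ?powR_ge0// ltW.
by move: (le_trans rL LK); lra.
Qed.

(** The case f^(k) <> f is excluded by [main_estimate] and [growth_contradiction]: the convergent
   sum over the zeros limits the growth to order q, while the order of [f] exceeds x > q. *)
Lemma shared_value_fixed f k a q x : ent f -> a != 0 -> (0 < k)%N ->
  (forall z, f z = a -> derive1n k f z = a) -> 0 < q -> q < x ->
  (\esum_(z in [set z | (z != 0)%R]) ((zero_mult f z)%:R * normc z `^ (- q))%:E < +oo)%E ->
  (x%:E < growth_order f)%E -> forall z, derive1n k f z = f z.
Proof.
move=> hf a0 k0 share q0 qx Hq Hx; have x0 := lt_trans q0 qx.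
have nconst := positive_order_nonconst hf Hx x0.
have nf : exists z, f z != 0.
  have [z] := nconst => H; apply: contrapT => N; move: H.
  rewrite (_ : f = fun=> 0) ?(derive1_cder (cder_cst 0 z)) ?eqxx//.
  by apply/funext => u; apply/eqP/negPn/negP => fu; apply: N; exists u.
apply: contrapT => /existsNP[z0 /eqP fz0].
set S := (\esum_(z in _) _)%E in Hq.
have S0 : (0 <= S)%E.
  by apply: esum_ge0 => z _; rewrite lee_fin mulr_ge0 ?ler0n ?powR_ge0.
have Sfin : S \is a fin_num by rewrite ge0_fin_numE.
have [|C C1 HC] := main_estimate hf a0 k0 share nconst (ex_intro _ z0 fz0) q0 (fine_ge0 S0).
  move=> s F m hF fE sn0; rewrite -lee_fin fineK//.
  exact: zeros_sum_le fE sn0.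
apply: (growth_contradiction q0 qx C1 _ HC (growth_order_large hf Hx x0)).
by move=> r r'; exact: logmax_mono.
Qed.

End Conclusion.

Theorem theorem5p2 (R : realType) (phi f : R[i] -> R[i]) (k : nat) (a : R[i])
    (phi_entire : entire phi) (k_gt0 : (0 < k)%N) (a_neq0 : a != 0)
    (f_mero : meromorphic f)
    (f_sol : forall z, holomorphic_at f z ->
       derive1n k.+1 f z * (derive1n k f z - f z) = phi z * (f z - a) * derive1n k f z)
    (f_zeros : (forall z, ~ takes_value f 0 z) \/
       (forall z, takes_value f 0 z -> (k <= zero_mult f z)%N))
    (f_share : value_implies f (derive1n k f) a)
    (f_exponent : (zeros_exponent f < growth_order f)%E) :
  exists A lambda : R[i],
    [/\ A != 0, lambda != 0, lambda ^+ k = 1 &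
        forall z, f z = A * cexp (lambda * z)].
Proof.
have hf := entire_solution phi_entire k_gt0 f_mero f_sol.
have takes c z : f z = c -> takes_value f c z.
  by split=> //; apply/holomorphic_atP; exists 1 => // w _; exact: hf.
have share z : f z = a -> derive1n k f z = a by move=> /takes/f_share[].
have [_ [q [q0 Hq] <-] qf] := ereal_inf_lt f_exponent.
have [x qx xf] : exists2 x, q < x & (x%:E < growth_order f)%E.
  case: (growth_order f) qf => [g| |]//; last by move=> _; exists (q + 1); rewrite ?ltry// ltrDl.
  rewrite lte_fin => qg; exists ((q + g) / 2); first by rewrite midf_lt.
  by rewrite lte_fin midf_lt.
have fk := shared_value_fixed hf a_neq0 k_gt0 share q0 qx Hq xf.
have [z1 f1] := positive_order_nonconst hf xf (lt_trans q0 qx).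
have nf : ~ forall z, f z = 0.
  move=> f0; move: f1; rewrite (_ : f = fun=> 0); last exact/funext.
  by rewrite (derive1_cder (cder_cst 0 z1)) eqxx.
apply: (zero_free_exponential k_gt0 hf fk) => z; apply/eqP => fz.
case: f_zeros => [no|mult]; first exact: no z (takes _ _ fz).
apply: nf; have [z2 fz2] : exists z, f z != 0.
  apply: contrapT => N; move: f1; rewrite (_ : f = fun=> 0).
    by rewrite (derive1_cder (cder_cst 0 z1)) eqxx.
  by apply/funext => u; apply/eqP/negPn/negP => fu; apply: N; exists u.
have [m [h [hh hz fE]]] := ent_factor z hf (ex_intro _ z2 fz2).
have km := mult z (takes _ _ fz); rewrite (zero_mult_ent hh hz fE) in km.
apply: (fixed_zero k_gt0 hf fk (w := z)) => j jk.
by apply: (derivatives_vanish hh fE); exact: leq_trans km.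
Qed.
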